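(* Let $\lambda=(\lambda_1,\lambda_2,\lambda_3)\in\mathbb C^3$ with $\lambda_1+\lambda_2+\lambda_3=0$, let $m_1,m_2\in\mathbb Z$ and $\psi(n(x,y,z))=e^{2\pi i(m_1x+m_2y)}$. If $f=\begin{pmatrix}f_1\\ f_2\end{pmatrix}\in\widetilde V^\infty_{-\lambda,{}^\intercal\phi^{-1}}$, then $$\Big\langle f(\tilde g),\int_{\Gamma_\infty\backslash N}\tilde E_{\mathrm{id}}(n\tilde g)\psi(n)\,dn\Big\rangle_{\lambda,\phi}=\Big(\int_{\Gamma_\infty\backslash N}\psi(n)\,dn\Big)f_1((w_\ell,1)).$$ This distribution is nonzero if and only if $m_1=m_2=0$.
   Context: **Groups.** $G=\mathrm{SL}(3,\mathbb R)$; $B$ is its upper triangular subgroup; $N=\{n(x,y,z)\}$ with $n(x,y,z)=\begin{pmatrix}1&x&z\\0&1&y\\0&0&1\end{pmatrix}$; $A$ is the group of diagonal matrices with positive entries; $\mathrm t(a,b,c)=\mathrm{diag}(a,b,c)$. $w_{\alpha_1}=\begin{pmatrix}0&-1&0\\1&0&0\\0&0&1\end{pmatrix}$, $w_{\alpha_2}=\begin{pmatrix}1&0&0\\0&0&-1\\0&1&0\end{pmatrix}$, $w_\ell=w_{\alpha_1}w_{\alpha_2}w_{\alpha_1}=\begin{pmatrix}0&0&1\\0&-1&0\\1&0&0\end{pmatrix}$. For nonzero reals $(x,y)_{\mathbb R}=-1$ if $x,y<0$ and $1$ otherwise. The Plücker coordinates of a matrix with second row $(d,e,f)$ and third row $(g,h,i)$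 are $(A_1',B_1',C_1',A_2',B_2',C_2')=(-g,-h,-i,-(dh-eg),di-fg,-(ei-fh))$. **Double cover.** Let $X_1(g)=\det g$, let $X_2(g)$ be the first nonzero entry of $-A_2',B_2',-C_2'$, let $X_3(g)$ be the first nonzero entry of $-A_1',-B_1',-C_1'$, and $\Delta(g)=\mathrm t(X_1/X_2,X_2/X_3,X_3)$. The Banks–Levy–Sepanski cocycle $\sigma:G\times G\to\{\pm1\}$ is computed by: $\sigma(\mathrm t(a_1,a_2,a_3),\mathrm t(b_1,b_2,b_3))=(a_1,b_2)_{\mathbb R}(a_1,b_3)_{\mathbb R}(a_2,b_3)_{\mathbb R}$ (for diagonal matrices of any determinant); $\sigma(a,h)=\sigma(a,\Delta(h))$ for $a$ diagonal; $\sigma(w_\alpha,h)=\sigma(\Delta(w_\alpha h)\Delta(h),-\Delta(h))$ for $w_\alpha\in\{w_{\alpha_1},w_{\alpha_2}\}$; and if $g_1=naw_1\cdots w_kn'$ is the Bruhat decomposition ($n,n'\in N$, $a$ diagonal, $w_1\cdots w_k$ a reduced word in $w_{\alpha_1},w_{\alpha_2}$) then $\sigma(g_1,g_2)=\sigma(a,w_1\cdots w_kn'g_2)\sigma(w_1,w_2\cdots w_kn'g_2)\cdots\sigma(w_k,n'g_2)$. $\widetilde G=G\times\{\pm1\}$ with $(g_1,\epsilon_1)(g_2,\epsilon_2)=(g_1g_2,\epsilon_1\epsilon_2\sigma(g_1,g_2))$. $N$ and $A$ are regarded as subgroups $\widetilde N,\widetilde A$ of $\widetilde G$ via $g\mapsto(g,1)$.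 $\widetilde N_-=(w_\ell,1)^{-1}\widetilde N(w_\ell,1)$; $\widetilde M=\{(\mathrm t(\epsilon_1,\epsilon_2,\epsilon_1\epsilon_2),\pm1):\epsilon_i=\pm1\}$. **Principal series.** $\phi:\widetilde M\to \mathrm{SL}(2,\mathbb C)$ is the representation $\phi((\mathrm t(\epsilon_1,\epsilon_2,\epsilon_1\epsilon_2),\pm1))=\pm\begin{pmatrix}0&-1\\1&0\end{pmatrix}^{(1-\epsilon_1)/2}\begin{pmatrix}-i&0\\0&i\end{pmatrix}^{(1-\epsilon_2)/2}$. $\rho=(1,0,-1)$. For $\mu\in\mathbb C^3$ with coordinate sum $0$ and a two-dimensional representation $\eta$ of $\widetilde M$, $\widetilde V^{\infty}_{\mu,\eta}$ (resp. $\widetilde V^{-\infty}_{\mu,\eta}$) is the space of smooth (resp. distributional) $f:\widetilde G\to\mathbb C^2$ with $f(\tilde g\tilde m an_-)=\prod_i a_i^{-(\mu_i-\rho_i)}\,\eta(\tilde m^{-1})f(\tilde g)$ for $\tilde m\in\widetilde M$, $a=\mathrm t(a_1,a_2,a_3)\in\widetilde A$, $n_-\in\widetilde N_-$; $\widetilde G$ acts by $(\pi(h)f)(g)=f(h^{-1}g)$. The $\widetilde G$-invariant pairing $\widetilde V^\infty_{-\lambda,{}^\intercal\phi^{-1}}\times\widetilde V^{-\infty}_{\lambda,\phi}\to\mathbb C$ is the extension to distributions of $\langle f,h\rangle_{\lambda,\phi}=\int_{N}(f_1h_1+f_2h_2)((w',1)n)\,dn$ ($w'$ any Weyl representative, $dn=dx\,dy\,dz$).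 $\tilde\tau\in\widetilde V^{-\infty}_{\lambda,\phi}$ is the element whose restriction to $(w_\ell,1)n(x,y,z)$ is $\begin{pmatrix}\delta_{(0,0,0)}(x,y,z)\\0\end{pmatrix}$. **Identity-cell part of the Eisenstein distribution.** $\Gamma=\Gamma_1(4)$ is the group of $\gamma\in\mathrm{SL}(3,\mathbb Z)$ congruent mod $4$ to an upper triangular unipotent matrix; $\Gamma_\infty=N\cap\mathrm{SL}(3,\mathbb Z)$. $S:\Gamma\to\widetilde G$, $S(\gamma)=(\gamma,s(\gamma))$ is Miller's splitting homomorphism; $s=1$ on $\Gamma\cap B=\Gamma_\infty$. $\tilde E_{\mathrm{id}}(\tilde g)=\sum_{\gamma\in\Gamma_\infty\backslash(\Gamma\cap B)}\pi(S(\gamma)^{-1})\tilde\tau(\tilde g)\in\widetilde V^{-\infty}_{\lambda,\phi}$. The measure on $\Gamma_\infty\backslash N$ is induced by $dx\,dy\,dz$, and $\tilde E_{\mathrm{id}}(n\tilde g)$ means $\pi(n^{-1})\tilde E_{\mathrm{id}}$. *)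

(* Defs.v *)
From HB Require Import structures.
From mathcomp Require Import all_boot all_order all_algebra.
From mathcomp Require Import complex ring.
From mathcomp Require Import all_classical all_reals all_analysis.
Set Implicit Arguments.
Unset Strict Implicit.
Unset Printing Implicit Defensive.
Import Order.TTheory GRing.Theory Num.Theory.
Import numFieldNormedType.Exports.
Local Open Scope classical_set_scope.
Local Open Scope ring_scope.
Local Open Scope complex_scope.

Section ComplexAnalysis.
Context {R : realType}.
Local Notation C := R[i].

Definition cint d (T : measurableType d) (mu : {measure set T -> \bar R})
    (D : set T) (F : T -> C) : C :=
  (\int[mu]_(x in D) complex.Re (F x)) +i* (\int[mu]_(x in D) complex.Im (F x)).

Definition int2 (F : R * R -> C) : C :=
  cint (@lebesgue_measure R \x @lebesgue_measure R)%E setT F.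

Definition int3_on (D : set (R * R * R)) (F : R * R * R -> C) : C :=
  cint ((@lebesgue_measure R \x @lebesgue_measure R) \x @lebesgue_measure R)%E
    D F.

Definition int3 (F : R * R * R -> C) : C := int3_on setT F.

Definition cexp (z : C) : C :=
  (expR (complex.Re z))%:C * (cos (complex.Im z) +i* sin (complex.Im z)).

(* The power a ^ z, for real a > 0. *)
Definition cpow (a : R) (z : C) : C := cexp (z * (ln a)%:C).

Definition ccvg (u : nat -> C) (l : C) : Prop :=
  ((fun k => complex.Re (u k)) @ \oo --> complex.Re l) /\
  ((fun k => complex.Im (u k)) @ \oo --> complex.Im l).

Fixpoint Ck (k : nat) (f : 'rV[R]_8 -> R) : Prop :=
  continuous f /\
  match k with
  | 0 => True
  | k'.+1 => forall j : 'I_8, (forall p, derivable f p (delta_mx 0 j)) /\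
                              Ck k' (fun p => 'D_(delta_mx 0 j) f p)
  end.

Definition Cinfty (f : 'rV[R]_8 -> R) : Prop := forall k, Ck k f.

End ComplexAnalysis.

Definition SL3 (R : realType) := {g : 'M[R]_3 | \det g == 1}.

Section SL3.
Context {R : realType}.
Implicit Types g h : SL3 R.

Definition slmx (g : SL3 R) : 'M[R]_3 := sval g.

Definition mx3 (T : pzRingType) (a b c d e f g h i : T) : 'M[T]_3 :=
  \matrix_(k, l) nth 0 (nth [::] [:: [:: a; b; c]; [:: d; e; f]; [:: g; h; i]] k) l.

Lemma det_mx3 (a b c d e f g h i : R) : \det (mx3 a b c d e f g h i) =
  a * (e * i - f * h) - b * (d * i - f * g) + c * (d * h - e * g).
Proof.
rewrite (expand_det_row _ ord0) !big_ord_recl big_ord0 /cofactor.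
rewrite !(expand_det_row _ ord0) !big_ord_recl !big_ord0 /cofactor !det_mx11.
rewrite !mxE /= !exprS !expr0; ring.
Qed.

Definition mkSL3 (M : 'M[R]_3) (detM : \det M == 1) : SL3 R :=
  exist (fun g : 'M[R]_3 => \det g == 1) M detM.

Lemma sl1_proof : \det (1%:M : 'M[R]_3) == 1.
Proof. by rewrite det1. Qed.
Definition sl1 : SL3 R := mkSL3 sl1_proof.

Lemma slmul_proof g h : \det (slmx g *m slmx h) == 1.
Proof. by rewrite det_mulmx (eqP (svalP g)) (eqP (svalP h)) mulr1. Qed.
Definition slmul g h : SL3 R := mkSL3 (slmul_proof g h).

Lemma slinv_proof g : \det (invmx (slmx g)) == 1.
Proof. by rewrite det_inv (eqP (svalP g)) invr1. Qed.
Definition slinv g : SL3 R := mkSL3 (slinv_proof g).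

(* n(x, y, z) with the triple (x, y, z) encoded as ((x, y), z). *)
Lemma nmat_proof (p : R * R * R) :
  \det (mx3 1 p.1.1 p.2 0 1 p.1.2 0 0 1) == 1.
Proof. by rewrite det_mx3; apply/eqP; ring. Qed.
Definition nmat (p : R * R * R) : SL3 R := mkSL3 (nmat_proof p).

(* The elements t(e^s, e^u, e^(-s-u)) of A. *)
Lemma amat_proof (q : R * R) :
  \det (mx3 (expR q.1) 0 0 0 (expR q.2) 0 0 0 (expR (- q.1 - q.2))) == 1.
Proof.
rewrite det_mx3 !(mul0r, subr0, addr0, mulr0) mulrA -!expRD.
by rewrite [X in expR X](_ : _ = 0) ?expR0 //; ring.
Qed.
Definition amat (q : R * R) : SL3 R := mkSL3 (amat_proof q).

Lemma mmat_proof (e1 e2 : bool) :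
  \det (mx3 ((-1) ^+ e1) 0 0 0 ((-1) ^+ e2) 0 0 0 ((-1) ^+ (e1 (+) e2)) : 'M[R]_3)
  == 1.
Proof. by rewrite det_mx3; case: e1; case: e2; apply/eqP => /=; ring. Qed.
Definition mmat (e1 e2 : bool) : SL3 R := mkSL3 (mmat_proof e1 e2).

Lemma w1_proof : \det (mx3 0 (-1) 0 1 0 0 0 0 1 : 'M[R]_3) == 1.
Proof. by rewrite det_mx3; apply/eqP; ring. Qed.
Lemma w2_proof : \det (mx3 1 0 0 0 0 (-1) 0 1 0 : 'M[R]_3) == 1.
Proof. by rewrite det_mx3; apply/eqP; ring. Qed.

(* The simple roots alpha_1, alpha_2 are encoded as false, true. *)
Definition wsimple (alpha : bool) : SL3 R :=
  if alpha then mkSL3 w2_proof else mkSL3 w1_proof.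

Definition wprod (w : seq bool) : SL3 R := foldr (slmul \o wsimple) sl1 w.

Definition wlong : SL3 R := wprod [:: false; true; false].

Definition reduced (w : seq bool) : bool :=
  (size w <= 3)%N && sorted (fun a b => a != b) w.

Definition Ngrp : set (SL3 R) := range nmat.

Definition Bgrp : set (SL3 R) :=
  [set g | forall i j : 'I_3, (j < i)%N -> slmx g i j = 0].

Definition Diag : set (SL3 R) := [set g | is_diag_mx (slmx g)].

Definition Agrp : set (SL3 R) :=
  [set g | is_diag_mx (slmx g) /\ forall i, 0 < slmx g i i].

(* Signs are encoded as booleans, b standing for (-1)^b; products of signs
   become addb. *)
Definition hilbert (x y : R) : bool := (x < 0) && (y < 0).

Definition sigma_diag (a b : 'rV[R]_3) : bool :=
  hilbert (a 0 0) (b 0 1) (+) hilbert (a 0 0) (b 0 2) (+)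
  hilbert (a 0 1) (b 0 2).

Definition A1' (g : 'M[R]_3) : R := - g 2 0.
Definition B1' (g : 'M[R]_3) : R := - g 2 1.
Definition C1' (g : 'M[R]_3) : R := - g 2 2.
Definition A2' (g : 'M[R]_3) : R := - (g 1 0 * g 2 1 - g 1 1 * g 2 0).
Definition B2' (g : 'M[R]_3) : R := g 1 0 * g 2 2 - g 1 2 * g 2 0.
Definition C2' (g : 'M[R]_3) : R := - (g 1 1 * g 2 2 - g 1 2 * g 2 1).

Definition first_nonzero (a b c : R) : R :=
  if a != 0 then a else if b != 0 then b else c.

Definition X1 (g : 'M[R]_3) : R := \det g.
Definition X2 (g : 'M[R]_3) : R := first_nonzero (- A2' g) (B2' g) (- C2' g).
Definition X3 (g : 'M[R]_3) : R := first_nonzero (- A1' g) (- B1' g) (- C1' g).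

(* A diagonal matrix is represented by the row of its diagonal entries. *)
Definition Delta (g : SL3 R) : 'rV[R]_3 :=
  \row_i nth 0 [:: X1 (slmx g) / X2 (slmx g); X2 (slmx g) / X3 (slmx g); X3 (slmx g)] i.

Definition diag_of (g : SL3 R) : 'rV[R]_3 := \row_i slmx g i i.

(* sigma(w_1, w_2 ... w_k h) sigma(w_2, w_3 ... w_k h) ... sigma(w_k, h) *)
Fixpoint sigma_word (sigma : SL3 R -> SL3 R -> bool) (w : seq bool) h : bool :=
  if w is alpha :: w' then
    sigma (wsimple alpha) (slmul (wprod w') h) (+) sigma_word sigma w' h
  else false.

(* By the Bruhat decomposition, the last three rules determine sigma. *)
Record BLS_cocycle (sigma : SL3 R -> SL3 R -> bool) : Prop := {
  BLS_cocycleP : forall g1 g2 g3,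
    sigma g1 g2 (+) sigma (slmul g1 g2) g3 =
    sigma g1 (slmul g2 g3) (+) sigma g2 g3;
  BLS_diag_diag : forall a b, Diag a -> Diag b ->
    sigma a b = sigma_diag (diag_of a) (diag_of b);
  BLS_diag : forall a h, Diag a -> sigma a h = sigma_diag (diag_of a) (Delta h);
  BLS_simple : forall alpha h,
    sigma (wsimple alpha) h =
    sigma_diag (\row_i (Delta (slmul (wsimple alpha) h) 0 i * Delta h 0 i))
               (- Delta h);
  BLS_bruhat : forall n a w n' g, Ngrp n -> Diag a -> reduced w -> Ngrp n' ->
    sigma (slmul (slmul (slmul n a) (wprod w)) n') g =
    sigma a (slmul (wprod w) (slmul n' g)) (+) sigma_word sigma w (slmul n' g)
}.

End SL3.

Definition Gt (R : realType) := (SL3 R * bool)%type.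

Section DoubleCover.
Context {R : realType}.
Local Notation C := R[i].
Variable sigma : SL3 R -> SL3 R -> bool.
Implicit Types g : Gt R.

Definition gmul (g h : Gt R) : Gt R :=
  (slmul g.1 h.1, g.2 (+) h.2 (+) sigma g.1 h.1).
Definition ginv g : Gt R := (slinv g.1, g.2 (+) sigma g.1 (slinv g.1)).

Definition emb (x : SL3 R) : Gt R := (x, false).

Definition Nt : set (Gt R) := emb @` Ngrp.
Definition conj_wlong (n : Gt R) : Gt R :=
  gmul (gmul (ginv (emb wlong)) n) (emb wlong).
Definition Nmt : set (Gt R) := conj_wlong @` Nt.
Definition mtilde (e1 e2 eps : bool) : Gt R := (mmat e1 e2, eps).
Definition Mt : set (Gt R) :=
  [set m | exists e1 e2 eps, m = mtilde e1 e2 eps].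

Definition nminus (p : R * R * R) : Gt R := conj_wlong (emb (nmat p)).

(* Lie group structure of the cover.  As sigma is not continuous, the topology
   of the cover is not the product topology of SL(3, R) x {1, -1}.  The
   subgroups N, A, N_- of the cover are the (unique, continuous) lifts of
   simply connected closed subgroups of SL(3, R), so chart is a diffeomorphism
   of R^8 onto an open neighbourhood of the identity of the cover, and its left
   translates form an atlas. *)
Definition chart (p : 'rV[R]_8) : Gt R :=
  gmul (gmul (emb (nmat (p 0 0, p 0 1, p 0 2))) (emb (amat (p 0 3, p 0 4))))
       (nminus (p 0 5, p 0 6, p 0 7)).

Definition smooth (f : Gt R -> 'cV[C]_2) : Prop :=
  forall g i, Cinfty (fun p => complex.Re (f (gmul g (chart p)) i 0)) /\
              Cinfty (fun p => complex.Im (f (gmul g (chart p)) i 0)).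

Definition phi (g : Gt R) : 'M[C]_2 :=
  (-1) ^+ g.2 *:
  ((\matrix_(k, l) nth 0 (nth [::] [:: [:: 0; -1]; [:: 1; 0]] k) l)
     ^+ (slmx g.1 0 0 < 0)%R *
   (\matrix_(k, l) nth 0 (nth [::] [:: [:: 0 -i* 1; 0]; [:: 0; 0 +i* 1]] k) l)
     ^+ (slmx g.1 1 1 < 0)%R).

Definition tphi_inv (g : Gt R) : 'M[C]_2 := (invmx (phi g))^T.

Definition rho : 'rV[C]_3 := \row_i nth 0 [:: 1; 0; -1] i.

Definition apow (a : SL3 R) (mu : 'rV[C]_3) : C :=
  \prod_(i < 3) cpow (slmx a i i) (mu 0 i).

Definition Vsmooth (mu : 'rV[C]_3) (eta : Gt R -> 'M[C]_2)
    (f : Gt R -> 'cV[C]_2) : Prop :=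
  smooth f /\
  forall g m (a : SL3 R) n, Mt m -> Agrp a -> Nmt n ->
    f (gmul (gmul (gmul g m) (emb a)) n) =
    apow a (- (mu - rho)) *: (eta (ginv m) *m f g).

(* A C^2-valued distribution T on the cover is a continuous linear functional
   on test functions, T u standing for \int (T_1 u_1 + T_2 u_2) dg.  Values of
   T outside test functions are irrelevant. *)
Definition functional := (Gt R -> 'cV[C]_2) -> C.

(* The cover is finite over SL(3, R), which is closed in the space of matrices,
   so u has compact support iff it is supported in such a set. *)
Definition supp_in (M : R) (u : Gt R -> 'cV[C]_2) : Prop :=
  forall g, (exists i j, M < `|slmx g.1 i j|) -> u g = 0.

Definition test_fun (u : Gt R -> 'cV[C]_2) : Prop :=
  smooth u /\ exists M, supp_in M u.

(* The left-invariant vector fields attached to a basis of the Lie algebra. *)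
Definition lie_deriv (j : 'I_8) (u : Gt R -> 'cV[C]_2) : Gt R -> 'cV[C]_2 :=
  fun g => \col_i
    (derive1 (fun t : R => complex.Re (u (gmul g (chart (t *: delta_mx 0 j))) i 0)) 0
     +i*
     derive1 (fun t : R => complex.Im (u (gmul g (chart (t *: delta_mx 0 j))) i 0)) 0).

Definition distribution_on_cover (T : functional) : Prop :=
  (forall c u v, test_fun u -> test_fun v ->
     T (fun g => c *: u g + v g) = c * T u + T v) /\
  (forall M : R, exists (c : R) (k : nat), forall (u : Gt R -> 'cV[C]_2) (K : R),
     test_fun u -> supp_in M u ->
     (forall (js : seq 'I_8) g i, (size js <= k)%N ->
        `|foldr lie_deriv u js g i 0| <= K%:C) ->
     `|T u| <= (c * K)%:C).

(* f(g m a n_-) = prod_i a_i^(- (mu_i - rho_i)) eta(m^-1) f(g), in the sense of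
   distributions (the cover is unimodular). *)
Definition Vdist (mu : 'rV[C]_3) (eta : Gt R -> 'M[C]_2) (T : functional) : Prop :=
  distribution_on_cover T /\
  forall m (a : SL3 R) n u, Mt m -> Agrp a -> Nmt n -> test_fun u ->
    T (fun g => u (gmul g (ginv (gmul (gmul m (emb a)) n)))) =
    apow a (- (mu - rho)) * T (fun g => (eta (ginv m))^T *m u g).

Definition pi_fun (h : Gt R) (f : Gt R -> 'cV[C]_2) : Gt R -> 'cV[C]_2 :=
  fun g => f (gmul (ginv h) g).
Definition pi_dist (h : Gt R) (T : functional) : functional :=
  fun u => T (pi_fun (ginv h) u).

(* \int over A and N_-, and sum over M, of F(g m a n_-) prod_i a_i^(-2 rho_i);
   da n_- |-> da dn_- is a left Haar measure of A N_-, and a^(-2 rho) turns it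
   into a right Haar measure. *)
Definition int_opposite_borel (F : Gt R -> Gt R -> SL3 R -> C) (g : Gt R) : C :=
  int2 (fun q => int3 (fun p =>
    \sum_(e1 : bool) \sum_(e2 : bool) \sum_(eps : bool)
      F (gmul (gmul (gmul g (mtilde e1 e2 eps)) (emb (amat q))) (nminus p))
        (mtilde e1 e2 eps) (amat q) * apow (amat q) (- (rho *+ 2)))).

(* Haar integral on the cover, in the coordinates w_l n m a n_- of the open cell
   w_l N M A N_-, whose complement is negligible. *)
Definition haar_int (F : Gt R -> C) : C :=
  int3 (fun x =>
    int_opposite_borel (fun g _ _ => F g) (gmul (emb wlong) (emb (nmat x)))).

Definition dot (u v : 'cV[C]_2) : C := u 0 0 * v 0 0 + u 1 0 * v 1 0.

Definition dist_of (h : Gt R -> 'cV[C]_2) : functional :=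
  fun u => haar_int (fun g => dot (u g) (h g)).

(* For h in V_{mu,eta}, unfolding dist_of h with
   h(w_l n m a n_-) = a^(- (mu - rho)) eta(m^-1) h(w_l n) gives
   dist_of h u = \int_N (cell_average u)(n) . h(w_l n) dn. Hence a C^2-valued
   distribution t of compact support on N = R^3 (t v standing for
   \int t . v dn) is the restriction to w_l N of
   u |-> t (cell_average u), extended by 0 outside the open cell. *)
Definition cell_average (mu : 'rV[C]_3) (eta : Gt R -> 'M[C]_2)
    (u : Gt R -> 'cV[C]_2) : R * R * R -> 'cV[C]_2 :=
  fun x => \col_i int_opposite_borel
    (fun g m a => apow a (- (mu - rho)) * ((eta (ginv m))^T *m u g) i 0)
    (gmul (emb wlong) (emb (nmat x))).

Definition dist_from_cell (mu : 'rV[C]_3) (eta : Gt R -> 'M[C]_2)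
    (t : (R * R * R -> 'cV[C]_2) -> C) : functional :=
  fun u => t (cell_average mu eta u).

Definition delta_e1 (v : R * R * R -> 'cV[C]_2) : C := v (0, 0, 0) 0 0.

Definition tau (lambda : 'rV[C]_3) : functional :=
  dist_from_cell lambda phi delta_e1.

Definition pairing_int (w : seq bool) (f h : Gt R -> 'cV[C]_2) : C :=
  int3 (fun x => let g := gmul (emb (wprod w)) (emb (nmat x)) in dot (f g) (h g)).

(* The pairing is the extension by continuity of pairing_int from smooth to
   distributional second arguments; it is unique because the smooth vectors are
   weakly sequentially dense in the distributional ones. *)
Record is_pairing (lambda : 'rV[C]_3)
    (pair : (Gt R -> 'cV[C]_2) -> functional -> C) : Prop := {
  pairing_smooth : forall w f h, reduced w ->
    Vsmooth (- lambda) tphi_inv f -> Vsmooth lambda phi h ->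
    pair f (dist_of h) = pairing_int w f h;
  pairing_continuous : forall f (h : nat -> Gt R -> 'cV[C]_2) T,
    Vsmooth (- lambda) tphi_inv f ->
    (forall k, Vsmooth lambda phi (h k)) -> Vdist lambda phi T ->
    (forall u, test_fun u -> ccvg (fun k => dist_of (h k) u) (T u)) ->
    ccvg (fun k => pair f (dist_of (h k))) (pair f T)
}.

Definition SL3Z : set (SL3 R) :=
  [set g | exists z : 'M[int]_3, slmx g = map_mx intr z].

Definition Gamma : set (SL3 R) :=
  [set g | exists z : 'M[int]_3, [/\ slmx g = map_mx intr z,
     forall i j : 'I_3, (j < i)%N -> (4 %| z i j)%Z &
     forall i, (4 %| z i i - 1)%Z]].

Definition Gamma_inf : set (SL3 R) := Ngrp `&` SL3Z.

Definition splitting (s : SL3 R -> bool) : Prop :=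
  (forall c d, Gamma c -> Gamma d ->
     (slmul c d, s (slmul c d)) = gmul (c, s c) (d, s d)) /\
  (forall c, (Gamma `&` Bgrp) c -> s c = false).

(* Gamma_inf \ (Gamma cap B), as a set of right cosets *)
Definition cosets : set (set (SL3 R)) :=
  [set D | exists2 c, (Gamma `&` Bgrp) c & D = [set slmul n c | n in Gamma_inf]].

Definition E_id (lambda : 'rV[C]_3) (s : SL3 R -> bool) : functional :=
  fun u => \sum_(D \in cosets)
    (let c := xget sl1 D in pi_dist (ginv (c, s c)) (tau lambda) u).

Definition psi (m1 m2 : int) (p : R * R * R) : C :=
  cexp (0 +i* (2 * pi * (m1%:~R * p.1.1 + m2%:~R * p.1.2))).

(* [0, 1)^3 is a fundamental domain for the left action of Gamma_inf on N. *)
Definition int_quotient (F : R * R * R -> C) : C :=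
  int3_on [set p | [/\ 0 <= p.1.1 < 1, 0 <= p.1.2 < 1 & 0 <= p.2 < 1]] F.

Definition E_id_coeff (lambda : 'rV[C]_3) (s : SL3 R -> bool) (m1 m2 : int) :
    functional :=
  fun u => int_quotient (fun p =>
    pi_dist (ginv (emb (nmat p))) (E_id lambda s) u * psi m1 m2 p).

Definition nonzero_dist (T : functional) : Prop := exists2 u, test_fun u & T u != 0.

End DoubleCover.

(* Main.v *)
(** Since Gamma cap B = Gamma_inf, the sum defining E_id has a single term,
    and tau is invariant under left translation by N: such a translation only
    moves the N_- variable in the integral that defines tau.  Hence the
    coefficient is the multiple c tau of tau, where c is the integral of psi.

    To pair c tau with f, approximate it by smooth vectors: the section of the
    principal series that equals c chi_k e_1 on w_l N, with chi_k an approximate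
    identity at the origin, extends by 0 to a smooth function on the cover,
    and integrating it against f over the cell gives c times the average of
    f_1(w_l n) against chi_k, which tends to c f_1(w_l).  Smoothness on the
    cover is the delicate point, because the cocycle is not continuous: one has
    to see that the component in M of the open cell coordinates is locally
    constant.

    Finally tau does not vanish on a bump function of the open cell, and c is 1
    or 0 according to whether psi is trivial. *)
Require Import Defs.
From HB Require Import structures.
From mathcomp Require Import all_boot all_order all_algebra.
From mathcomp Require Import complex.
From mathcomp Require Import all_classical all_reals all_analysis.
From mathcomp Require Import ring lra measurable_realfun.
Set Implicit Arguments.
Unset Strict Implicit.
Unset Printing Implicit Defensive.
Import Order.TTheory GRing.Theory Num.Theory.
Import numFieldNormedType.Exports.
Local Open Scope classical_set_scope.
Local Open Scope ring_scope.
Local Open Scope complex_scope.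


(** * The double cover *)

(** The pairing is controlled only on smooth vectors and along weak sequential limits inside
    [Vdist]. Hence the coefficient must itself be shown to be a distribution vector, not merely a
    weak limit. Its continuity holds with order zero: a function of compact support meets the cell
    over a fixed $x$ only for $(a,n_-)$ in a compact set. Its equivariance under $\widetilde M A
    N_-$ is a change of variables whose Jacobian $a^{2\rho}$ on $N_-$ cancels the weight
    $a^{-2\rho}$ of the Haar measure. Local constancy of the $\widetilde M$ component is decided by
    the elements $n_-(r)n(t)$ with $t$ small. The sign of their lift is a function of three signs of
    Plücker coordinates. Two never change; the third can jump only where the first coordinate of $r$
    is $0$, and then either the other two make it irrelevant or it does not change after all.
    Extension by zero is smooth because $x$ leaves every bounded set at the boundary of the cell:
    where a denominator of the coordinates vanishes, some numerator of $x$ does not. *)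

Section SL3Group.
Context {R : realType}.
Implicit Types g h k : SL3 R.

Lemma slmx_inj : injective (@slmx R).
Proof. exact: val_inj. Qed.

Lemma slmulA : associative (@slmul R).
Proof. by move=> g h k; apply: slmx_inj; rewrite /= mulmxA. Qed.

Lemma slmul1g : left_id sl1 (@slmul R).
Proof. by move=> g; apply: slmx_inj; rewrite /= mul1mx. Qed.

Lemma slmulg1 : right_id sl1 (@slmul R).
Proof. by move=> g; apply: slmx_inj; rewrite /= mulmx1. Qed.

Lemma slmx_unit g : slmx g \in unitmx.
Proof. by rewrite unitmxE (eqP (svalP g)) unitr1. Qed.

Lemma slmulVg g : slmul (slinv g) g = sl1.
Proof. by apply: slmx_inj; rewrite /= mulVmx ?slmx_unit. Qed.

Lemma slmulgV g : slmul g (slinv g) = sl1.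
Proof. by apply: slmx_inj; rewrite /= mulmxV ?slmx_unit. Qed.

Lemma slmx_mx3 g : slmx g = mx3 (slmx g 0 0) (slmx g 0 1) (slmx g 0 2)
  (slmx g 1 0) (slmx g 1 1) (slmx g 1 2) (slmx g 2 0) (slmx g 2 1) (slmx g 2 2).
Proof.
apply/matrixP => i j; rewrite !mxE.
case: i => [[|[|[|//]]] ?]; case: j => [[|[|[|//]]] ?] /=;
by congr (slmx g _ _); apply/val_inj.
Qed.

(** A product of equalities instead of a conjunction, so that [rewrite] can use all nine as
    rules. *)
Lemma mx3E (T : pzRingType) (a b c d e f g h i : T) : let m := mx3 a b c d e f g h i in
  ((m 0 0 = a) * (m 0 1 = b) * (m 0 2 = c) * (m 1 0 = d) * (m 1 1 = e) *
  (m 1 2 = f) * (m 2 0 = g) * (m 2 1 = h) * (m 2 2 = i))%type.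
Proof. by rewrite /= !mxE. Qed.

Lemma mulmx3 (a b c d e f g h i a' b' c' d' e' f' g' h' i' : R) :
  mx3 a b c d e f g h i *m mx3 a' b' c' d' e' f' g' h' i' =
  mx3 (a * a' + b * d' + c * g') (a * b' + b * e' + c * h') (a * c' + b * f' + c * i')
      (d * a' + e * d' + f * g') (d * b' + e * e' + f * h') (d * c' + e * f' + f * i')
      (g * a' + h * d' + i * g') (g * b' + h * e' + i * h') (g * c' + h * f' + i * i').
Proof.
apply/matrixP => k l; rewrite !mxE !big_ord_recl big_ord0 !mxE /=.
by case: k => [[|[|[|//]]] ?]; case: l => [[|[|[|//]]] ?] /=; rewrite !addrA addr0.
Qed.

Lemma slmulE g h : slmx (slmul g h) = slmx g *m slmx h. Proof. by []. Qed.

Lemma slmul_entry g h i j : slmx (slmul g h) i j =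
  slmx g i 0 * slmx h 0 j + slmx g i 1 * slmx h 1 j + slmx g i 2 * slmx h 2 j.
Proof.
rewrite slmulE mxE !big_ord_recl big_ord0 addr0 addrA.
by congr (_ * _ + _ * _ + _ * _); congr (slmx _ _ _); apply/val_inj.
Qed.

Lemma slmx1 : slmx (sl1 : SL3 R) = mx3 1 0 0 0 1 0 0 0 1.
Proof.
apply/matrixP => i j; rewrite !mxE.
by case: i => [[|[|[|//]]] ?]; case: j => [[|[|[|//]]] ?].
Qed.

Lemma wlong_mx : slmx (wlong : SL3 R) = mx3 0 0 1 0 (-1) 0 1 0 0.
Proof.
rewrite /wlong /wprod /= mulmx1 !mulmx3.
by congr mx3; ring.
Qed.

Lemma wlongK : slmul wlong wlong = (sl1 : SL3 R).
Proof.
apply: slmx_inj; rewrite slmulE wlong_mx mulmx3 slmx1.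
by congr mx3; ring.
Qed.

(** The Heisenberg group law of $N$ in coordinates. Its left and right translations are unimodular
    shears of $\mathbb R^3$. *)
Definition nprod (p q : R * R * R) : R * R * R :=
  (p.1.1 + q.1.1, p.1.2 + q.1.2, p.2 + q.2 + p.1.1 * q.1.2).
Definition ninv (p : R * R * R) : R * R * R :=
  (- p.1.1, - p.1.2, p.1.1 * p.1.2 - p.2).

Lemma nmatM p q : slmul (nmat p) (nmat q) = nmat (nprod p q) :> SL3 R.
Proof.
apply: slmx_inj; rewrite slmulE mulmx3 /nprod /=; congr mx3; ring.
Qed.

Lemma nmat0 : nmat (0, 0, 0) = sl1 :> SL3 R.
Proof. by apply: slmx_inj; rewrite slmx1. Qed.

Lemma ninvl p : nprod (ninv p) p = (0, 0, 0).
Proof. by rewrite /nprod /ninv /=; congr (_, _, _); ring. Qed.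

Lemma ninvr p : nprod p (ninv p) = (0, 0, 0).
Proof. by rewrite /nprod /ninv /=; congr (_, _, _); ring. Qed.

Lemma nprodA : associative nprod.
Proof. by move=> p q r; rewrite /nprod /=; congr (_, _, _); ring. Qed.

Lemma nprod0 p : nprod p (0, 0, 0) = p.
Proof. by case: p => [[x y] z]; rewrite /nprod /= mulr0 !addr0. Qed.

Lemma nprod0l p : nprod (0, 0, 0) p = p.
Proof. by case: p => [[x y] z]; rewrite /nprod /= mul0r !add0r addr0. Qed.

Definition lmat (p : R * R * R) : SL3 R := slmul (slmul wlong (nmat p)) wlong.

Lemma lmatE p : slmx (lmat p) = mx3 1 0 0 (- p.1.2) 1 0 p.2 (- p.1.1) 1.
Proof. by rewrite /lmat 2!slmulE wlong_mx !mulmx3; congr mx3; ring. Qed.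

Lemma amatM q r : slmul (amat q) (amat r) = amat (q.1 + r.1, q.2 + r.2) :> SL3 R.
Proof.
apply: slmx_inj; rewrite slmulE mulmx3 /= opprD.
have -> : - q.1 - r.1 - (q.2 + r.2) = (- q.1 - q.2) + (- r.1 - r.2) by ring.
by rewrite !expRD; congr mx3; ring.
Qed.

Lemma amat0 : amat (0, 0) = sl1 :> SL3 R.
Proof. by apply: slmx_inj; rewrite slmx1 /= oppr0 addr0 expR0. Qed.

End SL3Group.

Section Cover.
Context {R : realType} (sigma : SL3 R -> SL3 R -> bool).
Hypothesis Hs : BLS_cocycle sigma.
Local Notation gm := (gmul sigma).
Local Notation gi := (ginv sigma).

Lemma Diag_mx3 (g : SL3 R) a b c : slmx g = mx3 a 0 0 0 b 0 0 0 c -> Diag g.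
Proof.
move=> E; rewrite /Diag /= E; apply/is_diag_mxP => i j.
by case: i => [[|[|[|//]]] ?]; case: j => [[|[|[|//]]] ?]; rewrite !mxE.
Qed.

Lemma diag_ofE (g : SL3 R) a b c : slmx g = mx3 a 0 0 0 b 0 0 0 c ->
  ((diag_of g 0 0 = a) * (diag_of g 0 1 = b) * (diag_of g 0 2 = c))%type.
Proof. by move=> E; rewrite !mxE E !mx3E. Qed.

Lemma hilbertpl (a x : R) : 0 < a -> hilbert a x = false.
Proof. by move=> a0; rewrite /hilbert ltNge ltW. Qed.
Lemma hilbertpr (a x : R) : 0 < a -> hilbert x a = false.
Proof. by move=> a0; rewrite /hilbert andbC ltNge ltW. Qed.

Lemma sigma_amat q h : sigma (amat q) h = false.
Proof.
have E : slmx (amat q) = mx3 (expR q.1) 0 0 0 (expR q.2) 0 0 0 (expR (- q.1 - q.2)) by [].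
rewrite (BLS_diag Hs) /sigma_diag; last exact: Diag_mx3 E.
rewrite !(diag_ofE E).
by rewrite !hilbertpl ?expR_gt0.
Qed.

Lemma sigma1g h : sigma sl1 h = false.
Proof. by rewrite -amat0 sigma_amat. Qed.

Lemma sigmag1 g : sigma g sl1 = false.
Proof.
have := BLS_cocycleP Hs g sl1 sl1; rewrite !slmulg1 sigma1g addbF.
by move/eqP; rewrite addbb eq_sym => /eqP.
Qed.

(** The Bruhat rule with the empty word and trivial torus part reduces the value to that at
    [sl1]. *)
Lemma sigma_nmat p h : sigma (nmat p) h = false.
Proof.
have := @BLS_bruhat _ _ Hs (nmat p) sl1 [::] sl1 h.
rewrite /= !slmulg1 !slmul1g sigma1g => -> //.
- by exists p.
- exact: (Diag_mx3 slmx1).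
- by exists (0, 0, 0) => //; rewrite nmat0.
Qed.

Lemma gmulA : associative gm.
Proof.
move=> [g a] [h b] [k c]; rewrite /gmul /= slmulA; congr (_, _).
have := BLS_cocycleP Hs g h k.
move: (sigma g h) (sigma h k) (sigma (slmul g h) k) (sigma g (slmul h k)).
by case: a; case: b; case: c; do 4 case.
Qed.

Lemma gmul1g : left_id (emb sl1) gm.
Proof. by move=> [g e]; rewrite /gmul /= slmul1g sigma1g addbF. Qed.

Lemma gmulg1 : right_id (emb sl1) gm.
Proof. by move=> [g e]; rewrite /gmul /= slmulg1 sigmag1 !addbF. Qed.

Lemma gmulgV g : gm g (gi g) = emb sl1.
Proof.
case: g => g e; rewrite /gmul /ginv /= slmulgV /emb; congr (_, _).
by case: e; case: (sigma _ _).
Qed.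

Lemma gmulVg g : gm (gi g) g = emb sl1.
Proof.
rewrite -[LHS]gmulg1 -(gmulgV (gi g)) gmulA -(gmulA (gi g) g) gmulgV gmulg1 gmulgV.
by [].
Qed.

Lemma gmulKg g h : gm (gi g) (gm g h) = h.
Proof. by rewrite gmulA gmulVg gmul1g. Qed.
Lemma gmulKVg g h : gm g (gm (gi g) h) = h.
Proof. by rewrite gmulA gmulgV gmul1g. Qed.
Lemma gmulgK g h : gm (gm h g) (gi g) = h.
Proof. by rewrite -gmulA gmulgV gmulg1. Qed.
Lemma gmulgKV g h : gm (gm h (gi g)) g = h.
Proof. by rewrite -gmulA gmulVg gmulg1. Qed.

Lemma gmul_injl g : injective (gm g).
Proof. by move=> h k E; rewrite -(gmulKg g h) E gmulKg. Qed.

Lemma ginvK : involutive gi.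
Proof. by move=> g; apply: (@gmul_injl (gi g)); rewrite gmulgV gmulVg. Qed.

Lemma ginvM g h : gi (gm g h) = gm (gi h) (gi g).
Proof.
by apply: (@gmul_injl (gm g h)); rewrite gmulgV -gmulA gmulKVg gmulgV.
Qed.

Lemma ginv1 : gi (emb sl1) = emb sl1.
Proof. by apply: (@gmul_injl (emb sl1)); rewrite gmulgV gmul1g. Qed.

Lemma emb_nmatM p q : gm (emb (nmat p)) (emb (nmat q)) = emb (nmat (nprod p q)).
Proof. by rewrite /gmul /= sigma_nmat nmatM. Qed.

Lemma emb_amatM q r : gm (emb (amat q)) (emb (amat r)) = emb (amat (q.1 + r.1, q.2 + r.2)).
Proof. by rewrite /gmul /= sigma_amat amatM. Qed.

Lemma ginv_nmat p : gi (emb (nmat p)) = emb (nmat (ninv p)).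
Proof.
by apply: (@gmul_injl (emb (nmat p))); rewrite gmulgV emb_nmatM ninvr nmat0.
Qed.

Lemma ginv_amat q : gi (emb (amat q)) = emb (amat (- q.1, - q.2)).
Proof.
by apply: (@gmul_injl (emb (amat q))); rewrite gmulgV emb_amatM !addrN amat0.
Qed.

End Cover.


(** * Signs of the Plücker coordinates and the cocycle at $w_\ell$ *)

Section FirstNonzero.
Context {R : realType}.
Implicit Types a b c x y z k : R.

(** An entry changes only by multiples of earlier ones, and those before the first nonzero entry are
    all $0$. Right multiplication by $N$ acts in this way on the bottom row and on the minors of the
    bottom two rows. *)
Lemma first_nonzero_shear a b c x y z :
  first_nonzero a (b + a * x) (c + b * y + a * z) = first_nonzero a b c.
Proof.
rewrite /first_nonzero; case: eqP => // ->; rewrite !mul0r !addr0.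
by case: eqP => // ->; rewrite mul0r addr0.
Qed.

Lemma first_nonzeroM k a b c : k != 0 ->
  first_nonzero (k * a) (k * b) (k * c) = k * first_nonzero a b c.
Proof.
by move=> k0; rewrite /first_nonzero !mulf_eq0 (negbTE k0) /=; case: ifP => // _; case: ifP.
Qed.

Lemma first_nonzero_neq0 a b c : c != 0 -> first_nonzero a b c != 0.
Proof. by rewrite /first_nonzero; case: ifP => //; case: ifP. Qed.

Lemma mul_lt0b x y : x != 0 -> y != 0 -> (x * y < 0) = (x < 0) (+) (y < 0).
Proof.
move=> x0 y0; case: (ltrgt0P x) (x0) => // hx _; case: (ltrgt0P y) (y0) => // hy _.
- by apply/negbTE; rewrite -leNgt ltW ?mulr_gt0.
- by rewrite pmulr_rlt0.
- by rewrite nmulr_rlt0.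
- by apply/negbTE; rewrite -leNgt ltW ?nmulr_rgt0.
Qed.

Lemma oppr_lt0b x : x != 0 -> (- x < 0) = ~~ (x < 0).
Proof. by move=> x0; rewrite oppr_lt0 -leNgt le_eqVlt eq_sym (negbTE x0). Qed.

End FirstNonzero.

Section DeltaUnipotent.
Context {R : realType} (sigma : SL3 R -> SL3 R -> bool).
Hypothesis Hs : BLS_cocycle sigma.
Implicit Types (g h : SL3 R) (p : R * R * R).

Lemma X3_nmat g p : X3 (slmx (slmul g (nmat p))) = X3 (slmx g).
Proof.
rewrite /X3 /A1' /B1' /C1' !opprK !slmul_entry !mx3E.
rewrite -[RHS](first_nonzero_shear _ _ _ p.1.1 p.1.2 p.2).
by congr first_nonzero; ring.
Qed.

Lemma X2_nmat g p : X2 (slmx (slmul g (nmat p))) = X2 (slmx g).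
Proof.
rewrite /X2 /A2' /B2' /C2' !opprK !slmul_entry !mx3E.
(* On $2\times2$ minors $n(x,y,z)$ acts by its second exterior power, which exchanges $x$ and $y$
   and replaces $z$ by $xy-z$. *)
rewrite -[RHS](first_nonzero_shear _ _ _ p.1.2 p.1.1 (p.1.1 * p.1.2 - p.2)).
by congr first_nonzero; ring.
Qed.

Lemma Delta_nmat g p : Delta (slmul g (nmat p)) = Delta g.
Proof.
by rewrite /Delta X2_nmat X3_nmat /X1 slmulE det_mulmx (eqP (svalP (nmat p))) mulr1.
Qed.

Lemma X3_na g p q : X3 (slmx (slmul (slmul (nmat p) (amat q)) g)) =
  expR (- q.1 - q.2) * X3 (slmx g).
Proof.
rewrite /X3 /A1' /B1' /C1' !opprK !slmul_entry !mx3E -first_nonzeroM ?gt_eqF ?expR_gt0//.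
by congr first_nonzero; ring.
Qed.

Lemma X2_na g p q : X2 (slmx (slmul (slmul (nmat p) (amat q)) g)) =
  expR (- q.1) * X2 (slmx g).
Proof.
rewrite /X2 /A2' /B2' /C2' !opprK !slmul_entry !mx3E.
(* The minors of the bottom two rows scale by the product of the last two diagonal entries. *)
rewrite (_ : expR (- q.1) = expR q.2 * expR (- q.1 - q.2)); last first.
  by rewrite -expRD; congr expR; ring.
rewrite -first_nonzeroM ?gt_eqF ?mulr_gt0 ?expR_gt0//.
by congr first_nonzero; ring.
Qed.

Lemma sigma_simple_nmat alpha h p :
  sigma (wsimple alpha) (slmul h (nmat p)) = sigma (wsimple alpha) h.
Proof. by rewrite !(BLS_simple Hs) slmulA !Delta_nmat. Qed.

Lemma sigma_wlongE h : sigma wlong h =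
  sigma (wsimple false) (slmul (wsimple true) (slmul (wsimple false) h)) (+)
  (sigma (wsimple true) (slmul (wsimple false) h) (+) sigma (wsimple false) h).
Proof.
have := @BLS_bruhat _ _ Hs sl1 sl1 [:: false; true; false] sl1 h.
rewrite -/wlong !slmulg1 !slmul1g (sigma1g Hs) => ->; rewrite //.
- rewrite /sigma_word /wprod /foldr /comp !slmulg1 !slmul1g addbF.
  by rewrite -slmulA.
- by exists (0, 0, 0) => //; rewrite nmat0.
- exact: (Diag_mx3 slmx1).
- by exists (0, 0, 0) => //; rewrite nmat0.
Qed.

Lemma sigma_wlong_nmat h p : sigma wlong (slmul h (nmat p)) = sigma wlong h.
Proof. by rewrite !sigma_wlongE !slmulA !sigma_simple_nmat. Qed.

(** For determinant $1$ the diagonal matrix $\Delta$ is $(1/X_2, X_2/X_3, X_3)$, so the Hilbert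
    symbols only see the signs of $X_2$ and $X_3$ at [h] and at [h']. *)
Lemma sigma_simple_sign alpha h :
  let h' := slmul (wsimple alpha) h in
  X2 (slmx h) != 0 -> X3 (slmx h) != 0 -> X2 (slmx h') != 0 -> X3 (slmx h') != 0 ->
  let s2 := X2 (slmx h) < 0 in let s3 := X3 (slmx h) < 0 in
  let t2 := X2 (slmx h') < 0 in let t3 := X3 (slmx h') < 0 in
  sigma (wsimple alpha) h =
    (t2 (+) s2) && ~~ (s2 (+) s3) (+) (t2 (+) s2) && ~~ s3
    (+) (t2 (+) t3 (+) s2 (+) s3) && ~~ s3.
Proof.
move=> h' h2 h3 k2 k3 s2 s3 t2 t3.
rewrite (BLS_simple Hs) -/h' /sigma_diag /hilbert !mxE /= /X1.
rewrite (eqP (svalP h)) (eqP (svalP h')) !div1r.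
rewrite !mul_lt0b ?mulf_neq0 ?invr_eq0 ?mulf_neq0 ?invr_eq0//.
rewrite !oppr_lt0b ?mulf_neq0 ?invr_eq0// !mul_lt0b ?invr_eq0// !invr_lt0.
by rewrite -/s2 -/s3 -/t2 -/t3 addbA.
Qed.

(** Along the reduced word of $w_\ell$ only three signs occur: [e2] and [e3] are those of $X_2$ and
    $X_3$ at [lmat p], and [ey] is that of $X_2$ after the first reflection, which the second one
    preserves. All other values are $1$. *)
Lemma sigma_wlong_lmat p :
  let e3 := first_nonzero p.2 (- p.1.1) 1 < 0 in
  let e2 := first_nonzero (p.1.1 * p.1.2 - p.2) (- p.1.2) 1 < 0 in
  let ey := first_nonzero (- p.1.1) 1 1 < 0 in
  sigma wlong (lmat p) = (e2 (+) ey) && ~~ (e2 (+) e3).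
Proof.
move=> e3 e2 ey; rewrite sigma_wlongE.
pose h1 := slmul (wsimple false) (lmat p).
pose h2 := slmul (wsimple true) h1.
pose h3 := slmul (wsimple false) h2.
have nz a b : first_nonzero a b 1 != 0 :> R by rewrite first_nonzero_neq0 ?oner_eq0.
have X3l : X3 (slmx (lmat p)) = first_nonzero p.2 (- p.1.1) 1.
  by rewrite /X3 /A1' /B1' /C1' !opprK lmatE !mx3E.
have X2l : X2 (slmx (lmat p)) = first_nonzero (p.1.1 * p.1.2 - p.2) (- p.1.2) 1.
  rewrite /X2 /A2' /B2' /C2' !opprK lmatE !mx3E; congr first_nonzero; ring.
have E1 : slmx h1 = mx3 (p.1.2) (-1) 0 1 0 0 p.2 (- p.1.1) 1.
  by rewrite slmulE lmatE mulmx3; congr mx3; ring.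
have E2 : slmx h2 = mx3 (p.1.2) (-1) 0 (- p.2) (p.1.1) (-1) 1 0 0.
  by rewrite slmulE E1 mulmx3; congr mx3; ring.
have E3 : slmx h3 = mx3 p.2 (- p.1.1) 1 (p.1.2) (-1) 0 1 0 0.
  by rewrite slmulE E2 mulmx3; congr mx3; ring.
have X31 : X3 (slmx h1) = first_nonzero p.2 (- p.1.1) 1.
  by rewrite /X3 /A1' /B1' /C1' !opprK E1 !mx3E.
(* The third argument is never reached, since the second is nonzero; it is taken to be $1$ so that
   [nz] applies. *)
have X21 : X2 (slmx h1) = first_nonzero (- p.1.1) 1 1.
  rewrite /X2 /A2' /B2' /C2' !opprK E1 !mx3E /first_nonzero.
  by rewrite !mul0r !mul1r !subr0 oner_eq0.
have X32 : X3 (slmx h2) = 1.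
  by rewrite /X3 /A1' /B1' /C1' !opprK E2 !mx3E /first_nonzero oner_eq0.
have X22 : X2 (slmx h2) = first_nonzero (- p.1.1) 1 1.
  rewrite /X2 /A2' /B2' /C2' !opprK E2 !mx3E /first_nonzero.
  by rewrite !mulr0 !mulr1 !sub0r opprK oner_eq0.
have X33 : X3 (slmx h3) = 1.
  by rewrite /X3 /A1' /B1' /C1' !opprK E3 !mx3E /first_nonzero oner_eq0.
have X23 : X2 (slmx h3) = 1.
  rewrite /X2 /A2' /B2' /C2' !opprK E3 !mx3E /first_nonzero.
  by rewrite !mulr0 !mulr1 !sub0r opprK oner_eq0.
rewrite -/h1 -/h2 !sigma_simple_sign -/h1 -/h2 -/h3;
  rewrite ?X3l ?X2l ?X31 ?X21 ?X32 ?X22 ?X33 ?X23 ?nz ?oner_eq0//.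
rewrite -/e3 -/e2 -/ey ltr10.
by case: e2; case: e3; case: ey.
Qed.

End DeltaUnipotent.


(** * Coordinates on the open cell *)

Section Cell.
Context {R : realType} (sigma : SL3 R -> SL3 R -> bool).
Hypothesis Hs : BLS_cocycle sigma.
Local Notation gm := (gmul sigma).
Local Notation gi := (ginv sigma).
Local Notation nm := (nminus sigma).
Local Notation wl := (emb (wlong : SL3 R)).
Local Notation mt := (@mtilde R).
Implicit Types (g : Gt R) (p x : R * R * R) (q : R * R).

(** Conjugation by the torus lifts to the cover without a sign: [sigma] of a diagonal element sees
    its second argument only through $\Delta$, which is trivial on $N$. *)
Lemma nmat_diag (d : SL3 R) e a b c p : slmx d = mx3 a 0 0 0 b 0 0 0 c ->
  a != 0 -> b != 0 ->
  gm (emb (nmat p)) (d, e) =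
  gm (d, e) (emb (nmat (a^-1 * b * p.1.1, b^-1 * c * p.1.2, a^-1 * c * p.2))).
Proof.
move=> E a0 b0; rewrite /gmul /= (sigma_nmat Hs) !addbF; congr (_, _).
  apply: slmx_inj; rewrite 2!slmulE E !mulmx3 /=; congr mx3; field;
  by rewrite ?a0 ?b0.
rewrite (BLS_diag Hs _ (Diag_mx3 E)) -[nmat _]slmul1g Delta_nmat.
by rewrite -(BLS_diag Hs _ (Diag_mx3 E)) (sigmag1 Hs) addbF.
Qed.

Lemma nminusM p p' : gm (nm p) (nm p') = nm (nprod p p').
Proof.
rewrite /nminus /conj_wlong -(emb_nmatM Hs) !(gmulA Hs); congr (gm (gm _ _) _).
by rewrite (gmulgK Hs).
Qed.

Lemma nminus0 : nm (0, 0, 0) = emb sl1.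
Proof. by rewrite /nminus /conj_wlong nmat0 (gmulg1 Hs) (gmulVg Hs). Qed.

Lemma ginv_nminus p : gi (nm p) = nm (ninv p).
Proof.
by apply: (@gmul_injl _ sigma Hs (nm p)); rewrite gmulgV nminusM ninvr nminus0.
Qed.

Lemma wlong_nminus p : gm wl (nm p) = gm (emb (nmat p)) wl.
Proof. by rewrite /nminus /conj_wlong !(gmulA Hs) gmulgV (gmul1g Hs). Qed.

Lemma slinv_wlong : slinv wlong = wlong :> SL3 R.
Proof.
by rewrite -[LHS]slmulg1 -wlongK slmulA slmulVg slmul1g.
Qed.

Lemma nminus_mx p : (nm p).1 = lmat p.
Proof. by rewrite /nminus /conj_wlong /= slinv_wlong. Qed.

(** Conjugation by [wl] turns this into [nmat_diag] for the diagonal element [D]. The sign of [D] in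
    the cover need not be computed, as [D] stands on both sides. *)
Lemma nminus_diag (d : SL3 R) e a b c p : slmx d = mx3 a 0 0 0 b 0 0 0 c ->
  b != 0 -> c != 0 ->
  gm (nm p) (d, e) =
  gm (d, e) (nm (c^-1 * b * p.1.1, b^-1 * a * p.1.2, c^-1 * a * p.2)).
Proof.
move=> E b0 c0; apply: (@gmul_injl _ sigma Hs wl).
pose D := gm (gm wl (d, e)) (gi wl).
have DE : slmx D.1 = mx3 c 0 0 0 b 0 0 0 a.
  rewrite -[D.1]/(slmul (slmul wlong d) (slinv wlong)) slinv_wlong.
  by rewrite 2!slmulE E wlong_mx !mulmx3; congr mx3; ring.
rewrite (gmulA Hs wl (nm p)) wlong_nminus -(gmulA Hs _ wl) (gmulA Hs wl (d, e)).
have -> : gm wl (d, e) = gm D wl by rewrite /D (gmulgKV Hs).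
rewrite (gmulA Hs) [D]surjective_pairing (nmat_diag _ _ DE)//.
by rewrite -2!(gmulA Hs D) wlong_nminus (gmulA Hs).
Qed.

Lemma mmat_mx e1 e2 : slmx (mmat e1 e2 : SL3 R) =
  mx3 ((-1) ^+ e1) 0 0 0 ((-1) ^+ e2) 0 0 0 ((-1) ^+ (e1 (+) e2)).
Proof. by []. Qed.

Lemma amat_mx q : slmx (amat q) =
  mx3 (expR q.1) 0 0 0 (expR q.2) 0 0 0 (expR (- q.1 - q.2)).
Proof. by []. Qed.

Lemma sign_lt0 (e : bool) : ((-1) ^+ e < 0 :> R) = e.
Proof. by case: e; rewrite ?expr0 ?expr1 ?ltrN10 ?ltr10. Qed.

(** On $\widetilde M$ the symbols $(a_1,b_2)(a_1,b_3)$ combine to $(a_1,b_1)$, because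
    $b_1b_2b_3=1$; this gives the term [e1 && f1]. *)
Lemma mtildeM e1 e2 e f1 f2 f : gm (mt e1 e2 e) (mt f1 f2 f) =
  mt (e1 (+) f1) (e2 (+) f2) (e (+) f (+) (e1 && f1 (+) e2 && (f1 (+) f2))).
Proof.
rewrite /mtilde /gmul /=; congr (_, _).
  apply: slmx_inj; rewrite slmulE !mmat_mx mulmx3.
  by congr mx3; case: e1 e2 f1 f2 => [] [] [] [] /=; ring.
rewrite (BLS_diag_diag Hs (Diag_mx3 (mmat_mx _ _)) (Diag_mx3 (mmat_mx _ _))).
rewrite /sigma_diag /hilbert !(diag_ofE (mmat_mx _ _)) !sign_lt0.
by case: e1 e2 f1 f2 e f => [] [] [] [] [] [].
Qed.

Lemma mtilde0 : mt false false false = emb sl1.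
Proof. by congr (_, _); apply: slmx_inj; rewrite mmat_mx slmx1. Qed.

Lemma ginv_mtilde e1 e2 e : gi (mt e1 e2 e) = mt e1 e2 (e (+) (e1 (+) e2 && (e1 (+) e2))).
Proof.
apply: (@gmul_injl _ sigma Hs (mt e1 e2 e)); rewrite gmulgV mtildeM -mtilde0.
by case: e1 e2 e => [] [] [].
Qed.

Lemma mtilde_amat e1 e2 e q : gm (mt e1 e2 e) (emb (amat q)) = gm (emb (amat q)) (mt e1 e2 e).
Proof.
rewrite /mtilde /gmul /= (sigma_amat Hs) !addbF /=; congr (_, _).
  by apply: slmx_inj; rewrite 2!slmulE mmat_mx amat_mx !mulmx3; congr mx3; ring.
rewrite (BLS_diag_diag Hs (Diag_mx3 (mmat_mx _ _)) (Diag_mx3 (amat_mx _))).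
by rewrite /sigma_diag !(diag_ofE (amat_mx _)) !hilbertpr ?expR_gt0//; case: e.
Qed.

(** The action of $M$ and $A$ on $N_-$ by conjugation, for moving [nm p] to the right past a
    diagonal element. The three factors are values of the roots; [nm_sign] and [aconj] below play
    this role for $N$. *)
Definition lconj (e1 e2 : bool) q p : R * R * R :=
  ((-1) ^+ e1 * expR (q.1 + q.2 + q.2) * p.1.1,
   (-1) ^+ (e1 (+) e2) * expR (q.1 - q.2) * p.1.2,
   (-1) ^+ e2 * expR (q.1 + q.1 + q.2) * p.2).

Lemma nminus_mtilde e1 e2 e p :
  gm (nm p) (mt e1 e2 e) = gm (mt e1 e2 e) (nm (lconj e1 e2 (0, 0) p)).
Proof.
rewrite (nminus_diag _ _ (mmat_mx e1 e2)) ?signr_eq0// /lconj /=.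
do 2 congr (_ _); congr (_, _, _); rewrite !(addr0, subr0) expR0 mulr1;
by case: e1; case: e2; rewrite /= ?expr0 ?expr1 ?invrN1 ?invr1; ring.
Qed.

Lemma nminus_amat q p :
  gm (nm p) (emb (amat q)) = gm (emb (amat q)) (nm (lconj false false q p)).
Proof.
rewrite (nminus_diag _ _ (amat_mx q)) ?gt_eqF ?expR_gt0// /lconj /= expr0 -!expRN.
do 2 congr (_ _); congr (_, _, _); rewrite -?expRD mul1r; congr (expR _ * _); ring.
Qed.

Definition nm_sign (e1 e2 : bool) p : R * R * R :=
  ((-1) ^+ (e1 (+) e2) * p.1.1, (-1) ^+ e1 * p.1.2, (-1) ^+ e2 * p.2).

Lemma nmat_mtilde e1 e2 e p :
  gm (emb (nmat p)) (mt e1 e2 e) = gm (mt e1 e2 e) (emb (nmat (nm_sign e1 e2 p))).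
Proof.
rewrite (nmat_diag _ _ (mmat_mx e1 e2)) ?signr_eq0// /nm_sign /=.
do 3 congr (_ _); congr (_, _, _);
by case: e1; case: e2; rewrite /= ?expr0 ?expr1 ?invrN1 ?invr1; ring.
Qed.

Lemma nm_signK e1 e2 p : nm_sign e1 e2 (nm_sign e1 e2 p) = p.
Proof. by case: p => [[x y] z]; rewrite /nm_sign /= !signrMK. Qed.

Definition aconj q p : R * R * R :=
  (expR (q.2 - q.1) * p.1.1, expR (- q.1 - q.2 - q.2) * p.1.2,
   expR (- q.1 - q.1 - q.2) * p.2).

Lemma nmat_amat q p :
  gm (emb (nmat p)) (emb (amat q)) = gm (emb (amat q)) (emb (nmat (aconj q p))).
Proof.
rewrite (nmat_diag _ _ (amat_mx q)) ?gt_eqF ?expR_gt0// /aconj /= -!expRN.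
do 3 congr (_ _); congr (_, _, _); rewrite -?expRD; congr (expR _ * _); ring.
Qed.

Lemma aconjK q p : aconj q (aconj (- q.1, - q.2) p) = p.
Proof.
case: p => [[x y] z]; rewrite /aconj /= !mulrA -!expRD.
by congr (_, _, _); rewrite -[RHS]mul1r -expR0; congr (expR _ * _); ring.
Qed.

Definition cell x e1 e2 e q p : Gt R :=
  gm (gm (gm (gm wl (emb (nmat x))) (mt e1 e2 e)) (emb (amat q))) (nm p).

Lemma cell_nminus x e1 e2 e q p r : gm (cell x e1 e2 e q p) (nm r) = cell x e1 e2 e q (nprod p r).
Proof. by rewrite /cell -(gmulA Hs) nminusM. Qed.

Lemma cell_amat x e1 e2 e q p r : gm (cell x e1 e2 e q p) (emb (amat r)) =
  cell x e1 e2 e (q.1 + r.1, q.2 + r.2) (lconj false false r p).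
Proof.
by rewrite /cell -(gmulA Hs) nminus_amat (gmulA Hs) -(gmulA Hs _ _ (emb (amat r))) (emb_amatM Hs).
Qed.

Lemma cell_mtilde x e1 e2 e q p f1 f2 f : gm (cell x e1 e2 e q p) (mt f1 f2 f) =
  cell x (e1 (+) f1) (e2 (+) f2) (e (+) f (+) (e1 && f1 (+) e2 && (f1 (+) f2))) q
    (lconj f1 f2 (0, 0) p).
Proof.
rewrite /cell -(gmulA Hs) nminus_mtilde (gmulA Hs); congr (gm _ _).
by rewrite -(gmulA Hs) -mtilde_amat (gmulA Hs) -(gmulA Hs _ _ (mt f1 f2 f)) mtildeM.
Qed.

(** The product $w_\ell\, n(x)\,\mathrm t(d_1,d_2,d_3)\, n_-(p)$ multiplied out. *)
Definition cellmx (d1 d2 d3 : R) x p : 'M[R]_3 :=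
  mx3 (d3 * p.2) (- d3 * p.1.1) d3
      (d2 * p.1.2 - x.1.2 * d3 * p.2) (x.1.2 * d3 * p.1.1 - d2) (- x.1.2 * d3)
      (d1 - x.1.1 * d2 * p.1.2 + x.2 * d3 * p.2) (x.1.1 * d2 - x.2 * d3 * p.1.1) (x.2 * d3).

Lemma cell_mx x e1 e2 e q p : slmx (cell x e1 e2 e q p).1 =
  cellmx ((-1) ^+ e1 * expR q.1) ((-1) ^+ e2 * expR q.2)
         ((-1) ^+ (e1 (+) e2) * expR (- q.1 - q.2)) x p.
Proof.
rewrite -[(cell _ _ _ _ _ _).1]/(slmul (slmul (slmul (slmul wlong (nmat x))
  (mmat e1 e2)) (amat q)) (nm p).1) nminus_mx.
rewrite 4!slmulE wlong_mx mmat_mx lmatE amat_mx !mulmx3 /cellmx /=; congr mx3; ring.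
Qed.

Implicit Type G : SL3 R.
(** The minors at the upper right corner, of size $1$ and $2$. On the cell they equal $d_3$ and
    $d_2d_3=1/d_1$, and their vanishing cuts out its complement; the remaining coordinates are
    quotients by them. *)
Definition cD3 G : R := slmx G 0 2.
Definition cD2 G : R := slmx G 0 1 * slmx G 1 2 - slmx G 0 2 * slmx G 1 1.
Definition cx G : R * R * R :=
  ((slmx G 2 1 * slmx G 0 2 - slmx G 2 2 * slmx G 0 1) * (cD2 G)^-1,
   - slmx G 1 2 * (cD3 G)^-1, slmx G 2 2 * (cD3 G)^-1).
Definition cp G : R * R * R :=
  (- slmx G 0 1 * (cD3 G)^-1,
   (slmx G 1 0 * slmx G 0 2 - slmx G 1 2 * slmx G 0 0) * (cD2 G)^-1,
   slmx G 0 0 * (cD3 G)^-1).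
Definition ce1 G : bool := cD2 G < 0.
Definition ce2 G : bool := (cD2 G < 0) (+) (cD3 G < 0).
Definition cq G : R * R := (- ln `|cD2 G|, ln `|cD2 G| - ln `|cD3 G|).
(** The sign that remains after comparison with the point of the cell that has the same coordinates
    and sign [false]. *)
Definition ceps g : bool :=
  g.2 (+) (cell (cx g.1) (ce1 g.1) (ce2 g.1) false (cq g.1) (cp g.1)).2.
Definition incell G : bool := (cD3 G != 0) && (cD2 G != 0).

Lemma sign_abs (t : R) : (-1) ^+ (t < 0)%R * `|t| = t.
Proof. by rewrite -realEsign ?num_real. Qed.

Lemma cell_eps x e1 e2 e q p : cell x e1 e2 e q p =
  ((cell x e1 e2 false q p).1, e (+) (cell x e1 e2 false q p).2).
Proof.
rewrite /cell /mtilde /gmul /=; congr (_, _).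
by case: e => /=; do ?[case: (sigma _ _) => //=].
Qed.

Lemma det_entries G :
  slmx G 0 0 * (slmx G 1 1 * slmx G 2 2 - slmx G 1 2 * slmx G 2 1)
  - slmx G 0 1 * (slmx G 1 0 * slmx G 2 2 - slmx G 1 2 * slmx G 2 0)
  + slmx G 0 2 * (slmx G 1 0 * slmx G 2 1 - slmx G 1 1 * slmx G 2 0) = 1.
Proof. by rewrite -det_mx3 -slmx_mx3; exact/eqP/(svalP G). Qed.

Lemma cell_coords g : incell g.1 ->
  g = cell (cx g.1) (ce1 g.1) (ce2 g.1) (ceps g) (cq g.1) (cp g.1).
Proof.
case: g => G e; rewrite [(G, e).1]/= cell_eps => /andP[h3 h2].
congr (_, _); last by rewrite /ceps /= -addbA addbb addbF.
apply: slmx_inj; rewrite (cell_mx _ _ _ false).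
have p2 : 0 < `|cD2 G| by rewrite normr_gt0.
have p3 : 0 < `|cD3 G| by rewrite normr_gt0.
have E1 : (-1) ^+ ce1 G * expR (cq G).1 = (cD2 G)^-1.
  rewrite /ce1 /cq /= expRN lnK ?posrE// -{3}(sign_abs (cD2 G)) invfM.
  by rewrite -exprVn invrN1.
have E3 : (-1) ^+ (ce1 G (+) ce2 G) * expR (- (cq G).1 - (cq G).2) = cD3 G.
  rewrite /ce1 /ce2 addbA addbb addFb /cq /=.
  rewrite (_ : - - _ - _ = ln `|cD3 G|); last by ring.
  by rewrite lnK ?posrE// sign_abs.
have E2 : (-1) ^+ ce2 G * expR (cq G).2 = cD2 G / cD3 G.
  rewrite /ce2 /cq /= expRD expRN !lnK ?posrE// signr_addb.
  rewrite mulrACA sign_abs; congr (_ * _).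
  by rewrite -{3}(sign_abs (cD3 G)) invfM -exprVn invrN1.
rewrite E1 E2 E3 /cellmx [LHS]slmx_mx3 /cx /cp /=.
(* This entry occurs in none of the coordinates; it is recovered from the determinant. *)
have dt : slmx G 2 0 = ((cD2 G)^-1 * (1 - (slmx G 0 0 * (slmx G 1 1 * slmx G 2 2
    - slmx G 1 2 * slmx G 2 1) - slmx G 1 0 * (slmx G 0 1 * slmx G 2 2 - slmx G 0 2 * slmx G 2 1)))).
  by rewrite -(det_entries G) /cD2; field; exact: h2.
rewrite /cD3 in h3 *.
congr mx3; try rewrite dt; rewrite /cD2; field; by rewrite ?h3 // h2.
Qed.

Lemma coords_cellmx G d1 d2 d3 x p : slmx G = cellmx d1 d2 d3 x p ->
  d2 != 0 -> d3 != 0 ->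
  [/\ cD3 G = d3, cD2 G = d2 * d3, cx G = x & cp G = p].
Proof.
move=> E n2 n3.
have E3 : cD3 G = d3 by rewrite /cD3 E mx3E.
have E2 : cD2 G = d2 * d3 by rewrite /cD2 E !mx3E; ring.
case: x p E => [[x y] z] [[a b] c] E.
split=> //; rewrite /cx /cp E2 E3 E !mx3E /=; congr (_, _, _); field; by rewrite ?n2 ?n3.
Qed.

Lemma coords_cell x e1 e2 e q p : let g := cell x e1 e2 e q p in
  [/\ incell g.1, cx g.1 = x, cq g.1 = q & cp g.1 = p] /\
  [/\ ce1 g.1 = e1, ce2 g.1 = e2 & ceps g = e].
Proof.
move=> g; have sn (b : bool) : (-1) ^+ b != 0 :> R by rewrite signr_eq0.
have en t : expR t != 0 :> R by rewrite gt_eqF ?expR_gt0.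
have [E3 E2 Ex Ep] := coords_cellmx (cell_mx x e1 e2 e q p) (mulf_neq0 (sn _) (en _))
  (mulf_neq0 (sn _) (en _)).
have E2' : cD2 g.1 = (-1) ^+ e1 * expR (- q.1).
  rewrite E2; rewrite mulrACA -signr_addb addbC -addbA addbb addbF -expRD.
  by congr (_ * expR _); ring.
have Eq : cq g.1 = q.
  rewrite /cq E2' E3 !normrM !normrX normrN1 !expr1n !mul1r !ger0_norm ?expR_ge0//.
  by rewrite !expRK; case: (q) => s t /=; congr (_, _); ring.
have Ee1 : ce1 g.1 = e1.
  by rewrite /ce1 E2' pmulr_llt0 ?expR_gt0// sign_lt0.
have Ee2 : ce2 g.1 = e2.
  rewrite /ce2 -/(ce1 _) Ee1 E3 pmulr_llt0 ?expR_gt0// sign_lt0.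
  by rewrite addbA addbb addFb.
split; split=> //.
  by rewrite /incell E3 E2' !mulf_neq0.
rewrite /ceps Ex Ep Eq Ee1 Ee2 /g cell_eps /= -addbA addbb addbF.
by [].
Qed.

End Cell.


(** * Continuity by the shape of an expression *)

Section Continuity.
Context {R : realType} {X : topologicalType}.
Implicit Types f g : X -> R.

Lemma cts_cst {Y : topologicalType} (c : Y) : continuous (fun _ : X => c).
Proof. by move=> x; exact: cvg_cst. Qed.

Lemma cts_id : continuous (fun x : X => x).
Proof. by move=> x; exact: cvg_id. Qed.

Lemma cts_eq {Y : topologicalType} (f g : X -> Y) :
  (forall x, f x = g x) -> continuous g -> continuous f.
Proof. by move=> fg; rewrite (_ : f = g)//; exact/funext. Qed.

Lemma ctsD f g : continuous f -> continuous g -> continuous (fun x => f x + g x).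
Proof. by move=> cf cg x; apply: cvgD; [exact: cf|exact: cg]. Qed.

Lemma ctsN f : continuous f -> continuous (fun x => - f x).
Proof. by move=> cf x; apply: cvgN; exact: cf. Qed.

Lemma ctsM f g : continuous f -> continuous g -> continuous (fun x => f x * g x).
Proof. by move=> cf cg x; apply: cvgM; [exact: cf|exact: cg]. Qed.

Lemma cts_comp {Y Z : topologicalType} (f : X -> Y) (g : Y -> Z) :
  continuous f -> continuous g -> continuous (fun x => g (f x)).
Proof. by move=> cf cg x; apply: continuous_comp; [exact: cf|exact: cg]. Qed.

Lemma cts_exp f : continuous f -> continuous (fun x => expR (f x)).
Proof. by move=> cf; apply: (cts_comp cf); exact: continuous_expR. Qed.

Lemma cts_fst {Y Z : topologicalType} (f : X -> Y * Z) :
  continuous f -> continuous (fun x => (f x).1).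
Proof. by move=> cf; apply: (cts_comp cf) => y; exact: cvg_fst. Qed.

Lemma cts_snd {Y Z : topologicalType} (f : X -> Y * Z) :
  continuous f -> continuous (fun x => (f x).2).
Proof. by move=> cf; apply: (cts_comp cf) => y; exact: cvg_snd. Qed.

Lemma cts_pair {Y Z : topologicalType} (f : X -> Y) (g : X -> Z) :
  continuous f -> continuous g -> continuous (fun x => (f x, g x)).
Proof. by move=> cf cg x; apply: cvg_pair; [exact: cf|exact: cg]. Qed.

Lemma cts_coord n (f : X -> 'rV[R]_n) (j : 'I_n) :
  continuous f -> continuous (fun x => f x 0 j).
Proof.
by move=> cf; apply: (@cts_comp _ _ f (fun v => v 0 j) cf); exact: coord_continuous.
Qed.

Lemma near_gt0 f (t0 : X) :
  continuous f -> 0 < f t0 -> \forall t \near t0, 0 < f t.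
Proof.
by move=> cf f0; exact: (@cvgr_gt _ _ (nbhs t0) _ f (f t0) (cf t0) 0 f0).
Qed.

End Continuity.

Ltac cts := repeat lazymatch goal with
  | |- forall x, continuous_at x ?f => 
    first [ assumption | lazymatch f with
    | fun _ => ?c => exact: (@cts_cst _ _ c)
    | fun x => x => exact: cts_id
    | id => exact: cts_id
    | fun x => (@?a x + @?b x)%R => refine (@ctsD _ _ a b _ _)
    | fun x => (- @?a x)%R => refine (@ctsN _ _ a _)
    | fun x => (@?a x * @?b x)%R => refine (@ctsM _ _ a b _ _)
    | fun x => expR (@?a x) => refine (@cts_exp _ _ a _)
    | fun x => (@?a x, @?b x) => refine (@cts_pair _ _ _ a b _ _)
    | fun x => fst (@?a x) => refine (@cts_fst _ _ _ a _)
    | fun x => snd (@?a x) => refine (@cts_snd _ _ _ a _)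
    | fun x => fun_of_matrix (@?a x) _ ?j => refine (@cts_coord _ _ _ a j _)
    end ] end.

(** * Local constancy of the component in $\widetilde M$ *)

Section LocallyConstant.
Context {R : realType} (sigma : SL3 R -> SL3 R -> bool).
Hypothesis Hs : BLS_cocycle sigma.
Local Notation gm := (gmul sigma).
Local Notation nm := (nminus sigma).
Local Notation wl := (emb (wlong : SL3 R)).
Local Notation mt := (@mtilde R).
Local Notation cell := (cell sigma).
Implicit Types (g h : Gt R) (p x t : R * R * R) (q : R * R).

Let q0 : R * R * R := (0, 0, 0).

Lemma gmul_sign g h : (gm g h).2 = g.2 (+) h.2 (+) sigma g.1 h.1.
Proof. by []. Qed.

Lemma gmul_mx g h : (gm g h).1 = slmul g.1 h.1.
Proof. by []. Qed.

Lemma mmat0 : mmat false false = sl1 :> SL3 R.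
Proof. by apply: slmx_inj; rewrite mmat_mx slmx1. Qed.

Lemma lmat_nmat (r t : R * R * R) : slmx (slmul wlong (slmul (lmat r) (nmat t))) =
  mx3 r.2 (r.2 * t.1.1 - r.1.1) (r.2 * t.2 - r.1.1 * t.1.2 + 1)
      (r.1.2) (r.1.2 * t.1.1 - 1) (r.1.2 * t.2 - t.1.2)
      1 t.1.1 t.2.
Proof.
rewrite 2!slmulE lmatE wlong_mx !mulmx3; congr mx3; ring.
Qed.

(** Comparing signs in the cover gives [e] as the sum of the cocycle at $w_\ell$ on [lmat p] and on
    [lmat r]. These two share the signs of $X_2$ and $X_3$ and can differ only through [ey]. In the
    second alternative $X_2$ and $X_3$ have opposite signs, so that [ey] has no influence. *)
Lemma swap_eps r x e q p t :
  gm wl (gm (nm r) (emb (nmat t))) = cell x false false e q p ->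
  (first_nonzero (- r.1.1) 1 1 < 0) = (first_nonzero (- p.1.1) 1 1 < 0) \/
     (r.1.1 = 0 /\ r.2 != 0) ->
  e = false.
Proof.
move=> E sgn.
have mxE : slmul (lmat r) (nmat t) = slmul (slmul (nmat x) (amat q)) (lmat p).
  have : slmul wlong (slmul (nm r).1 (nmat t)) =
    slmul (slmul (slmul (slmul wlong (nmat x)) (mmat false false)) (amat q)) (nm p).1.
    by have := f_equal fst E.
  rewrite !nminus_mx mmat0 slmulg1 -(slmulA (slmul wlong _)) -(slmulA wlong).
  rewrite (slmulA (nmat x)) => /(congr1 (slmul (slinv wlong))).
  by rewrite 2!(slmulA (slinv wlong) wlong) slmulVg 2!slmul1g.
(* Read off from $w_\ell n_-(s)=n(s)w_\ell$, where the right side has sign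
   $\sigma(n(s),w_\ell)=1$. *)
have sp s : (nm s).2 = sigma wlong (lmat s).
  have : (gm wl (nm s)).2 = (gm (emb (nmat s)) wl).2 by rewrite wlong_nminus.
  rewrite 2!gmul_sign nminus_mx (sigma_nmat Hs) addFb.
  by case: (nm s).2; case: (sigma _ _).
have L : (gm wl (gm (nm r) (emb (nmat t)))).2 = false.
  rewrite (gmulA Hs) wlong_nminus // -(gmulA Hs) /gmul /= (sigma_nmat Hs).
  by rewrite -[nmat t]slmul1g (sigma_wlong_nmat Hs) (sigmag1 Hs).
have M : (cell x false false e q p).2 = e (+) sigma wlong (lmat p) (+) sigma wlong (lmat r).
  rewrite /(cell _ _ _ _ _ _) -3!(gmulA Hs wl) 4!gmul_sign 6!gmul_mx nminus_mx sp.
  rewrite [(mt _ _ _).1]mmat0 [(mt _ _ _).2]/= [(emb (nmat x)).1]/= [(emb (amat q)).1]/=.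
  rewrite slmulg1 -mxE (sigma_wlong_nmat Hs) /= (sigmag1 Hs) ?addbF ?addFb.
  rewrite (sigma_nmat Hs) addbF.
  have -> : sigma (slmul (nmat x) (amat q)) (lmat p) = false.
    have := BLS_cocycleP Hs (nmat x) (amat q) (lmat p).
    by rewrite !(sigma_nmat Hs) (sigma_amat Hs).
  by rewrite addbF.
move: L; rewrite E M.
(* $X_2$ and $X_3$ are invariant under $N$ on the right and scale by positive factors under $NA$ on
   the left. *)
have E3 : (X3 (slmx (lmat r)) < 0) = (X3 (slmx (lmat p)) < 0).
  by rewrite -(X3_nmat _ t) mxE X3_na pmulr_rlt0 ?expR_gt0.
have E2 : (X2 (slmx (lmat r)) < 0) = (X2 (slmx (lmat p)) < 0).
  by rewrite -(X2_nmat _ t) mxE X2_na pmulr_rlt0 ?expR_gt0.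
have X3l s : X3 (slmx (lmat s)) = first_nonzero s.2 (- s.1.1) 1.
  by rewrite /X3 /A1' /B1' /C1' !opprK lmatE !mx3E.
have X2l s : X2 (slmx (lmat s)) = first_nonzero (s.1.1 * s.1.2 - s.2) (- s.1.2) 1.
  rewrite /X2 /A2' /B2' /C2' !opprK lmatE !mx3E; congr first_nonzero; ring.
rewrite !X3l in E3; rewrite !X2l in E2.
rewrite !(sigma_wlong_lmat Hs) -E3 -E2.
case: sgn => [<-|[a0 c0]]; first by rewrite -addbA addbb addbF.
(* Here $X_3$ is $r_3$ and $X_2$ is $-r_3$, so both cocycle values vanish. *)
have -> : first_nonzero r.2 (- r.1.1) 1 = r.2 by rewrite /first_nonzero c0.
have -> : first_nonzero (r.1.1 * r.1.2 - r.2) (- r.1.2) 1 = - r.2.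
  by rewrite /first_nonzero a0 mul0r sub0r oppr_eq0 c0.
by rewrite oppr_lt0b//; case: (r.2 < 0); rewrite /= !andbF !addbF.
Qed.

(* Although sigma jumps, the lift of n_- n(t) has trivial component in M for
   small t: the signs that enter the cocycle either do not change or cancel. *)
Lemma swap_near r : \forall t \near q0, exists x q p,
  gm (nm r) (emb (nmat t)) = gm (gm (emb (nmat x)) (emb (amat q))) (nm p).
Proof.
(* [f3] and [f2] are [cD3] and [cD2] at $w_\ell n_-(r)n(t)$; both are $1$ at $t=0$. Their positivity
   puts the point in the cell with [ce1] and [ce2] false. Positivity of [fy] says that the numerator
   of $-p_1$ keeps its sign at $t=0$; if that value is $0$, nothing is required. *)
pose f3 t := r.2 * t.2 - r.1.1 * t.1.2 + 1.
pose f2 t := (r.2 * t.1.1 - r.1.1) * (r.1.2 * t.2 - t.1.2) -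
  (r.2 * t.2 - r.1.1 * t.1.2 + 1) * (r.1.2 * t.1.1 - 1).
pose fy t := if r.1.1 == 0 then 1 else (r.2 * t.1.1 - r.1.1) * (- r.1.1).
have c3 : continuous f3 by rewrite /f3; cts.
have c2 : continuous f2 by rewrite /f2; cts.
have cy : continuous fy by rewrite /fy; case: (r.1.1 == 0); cts.
have g3 : 0 < f3 q0 by rewrite /f3 /= !mulr0 subr0 add0r.
have g2 : 0 < f2 q0 by rewrite /f2 /= !mulr0 !subr0 !add0r mulr0 sub0r mul1r opprK.
have gy : 0 < fy q0.
  rewrite /fy /=; case: eqP => // /eqP h; rewrite mulr0 sub0r.
  by rewrite -expr2 exprn_even_gt0 // oppr_eq0.
near=> t.
have p3 : 0 < f3 t by near: t; exact: (near_gt0 c3 g3).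
have p2 : 0 < f2 t by near: t; exact: (near_gt0 c2 g2).
have py : 0 < fy t by near: t; exact: (near_gt0 cy gy).
pose g := gm wl (gm (nm r) (emb (nmat t))).
have gE : slmx g.1 = mx3 r.2 (r.2 * t.1.1 - r.1.1) (f3 t)
    (r.1.2) (r.1.2 * t.1.1 - 1) (r.1.2 * t.2 - t.1.2) 1 t.1.1 t.2.
  by rewrite -lmat_nmat /g 2!gmul_mx nminus_mx.
have D3 : cD3 g.1 = f3 t by rewrite /cD3 gE mx3E.
have D2 : cD2 g.1 = f2 t by rewrite /cD2 gE !mx3E.
have ic : incell g.1 by rewrite /incell D3 D2 !gt_eqF.
have := cell_coords sigma ic; rewrite /ce1 /ce2 D3 D2 !ltNge !ltW//=.
set x := cx _; set q := cq _; set p := cp _; set e := ceps _ _ => gc.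
have pE : - p.1.1 = (r.2 * t.1.1 - r.1.1) / f3 t.
  by rewrite /p /cp D3 gE !mx3E /= mulNr opprK.
have e0 : e = false.
  apply: (swap_eps gc); rewrite pE /first_nonzero.
  (* For $r_1=0$ the sign of $-p_1$ may jump. If $r_3\neq0$, this is the second alternative of
     [swap_eps]; if $r_3=0$, then $p_1=0$ as well. *)
  case: (eqVneq r.1.1 0) => [r0|r0]; last first.
    left; rewrite oppr_eq0 (negbTE r0).
    move: py; rewrite /fy (negbTE r0).
    case: (ltrgt0P (- r.1.1)) => hr; last by rewrite hr mulr0 ltxx.
      rewrite pmulr_lgt0// => h; rewrite mulf_eq0 invr_eq0 !gt_eqF//=.
      by apply/esym/negbTE; rewrite -leNgt ltW// divr_gt0.
    rewrite nmulr_lgt0// => h; rewrite mulf_eq0 invr_eq0 (gt_eqF p3) lt_eqF//=.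
    by rewrite pmulr_llt0 ?invr_gt0// h.
  case: (eqVneq r.2 0) => [r20|r20]; last by right.
  by left; rewrite r0 r20 mul0r subr0 oppr0 mul0r.
exists x, q, p; apply: (@gmul_injl _ sigma Hs wl).
rewrite -/g gc e0 /(cell _ _ _ _ _ _) mtilde0 -!(gmulA Hs) (gmul1g Hs).
by rewrite !(gmulA Hs).
Unshelve. all: by end_near.
Qed.

End LocallyConstant.


Section NearCell.
Context {R : realType} (sigma : SL3 R -> SL3 R -> bool).
Hypothesis Hs : BLS_cocycle sigma.
Local Notation gm := (gmul sigma).
Local Notation gi := (ginv sigma).
Local Notation nm := (nminus sigma).
Local Notation wl := (emb (wlong : SL3 R)).
Local Notation mt := (@mtilde R).
Local Notation cell := (cell sigma).
Implicit Types (g : Gt R) (p x t : R * R * R) (q : R * R).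

(** [swap_near] moves the small element across $N_-$ with no component in $\widetilde M$. What it
    leaves in $N$ and $A$ is then conjugated past $A$ and $\widetilde M$, which alters only [x] and
    [q]. *)
Lemma cell_nmat_near x e1 e2 e q p : \forall t \near ((0, 0, 0) : R * R * R),
  exists x' q' p', gm (cell x e1 e2 e q p) (emb (nmat t)) = cell x' e1 e2 e q' p'.
Proof.
apply: filterS (swap_near Hs p) => t [x' [q' [p' E]]].
exists (nprod x (nm_sign e1 e2 (aconj (- q.1, - q.2) x'))), (q.1 + q'.1, q.2 + q'.2), p'.
rewrite /(cell _ _ _ _ _ _) -(gmulA Hs _ (nm p)) E.
rewrite (gmulA Hs _ _ (nm p')); congr (gm _ _).
rewrite (gmulA Hs) -(gmulA Hs _ (emb (amat q))).
rewrite -[X in gm (emb (amat q)) (emb (nmat X))](aconjK q) -(nmat_amat Hs).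
rewrite (gmulA Hs _ _ (emb (amat q))) -(gmulA Hs _ (emb (amat q))) (emb_amatM Hs).
congr (gm _ _); rewrite -(gmulA Hs _ (mt _ _ _)).
rewrite -[X in gm (mt _ _ _) (emb (nmat X))](nm_signK e1 e2) -(nmat_mtilde Hs).
by rewrite (gmulA Hs _ _ (mt _ _ _)) -(gmulA Hs wl) (emb_nmatM Hs).
Qed.

Lemma nmat_cell_near g t0 x e1 e2 e q p :
  gm g (emb (nmat t0)) = cell x e1 e2 e q p ->
  \forall t \near t0, exists x' q' p', gm g (emb (nmat t)) = cell x' e1 e2 e q' p'.
Proof.
move=> E.
have cf : continuous (fun t => nprod (ninv t0) t).
  by rewrite /nprod /ninv /=; cts.
have N : \forall t \near nprod (ninv t0) t0,
    exists x' q' p', gm (cell x e1 e2 e q p) (emb (nmat t)) = cell x' e1 e2 e q' p'.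
  by rewrite ninvl; exact: cell_nmat_near.
have M : \forall t \near t0, exists x' q' p',
    gm (cell x e1 e2 e q p) (emb (nmat (nprod (ninv t0) t))) = cell x' e1 e2 e q' p'.
  exact: cf t0 _ N.
apply: filterS M => t [x' [q' [p' E']]]; exists x', q', p'; rewrite -E' -E.
by rewrite -(gmulA Hs) (emb_nmatM Hs) nprodA ninvr nprod0l.
Qed.

Definition chart3 (P : 'rV[R]_8) : R * R * R := (P 0 0, P 0 1, P 0 2).

(** The factors of the chart in $A$ and $N_-$ act on the right without changing the component in
    $\widetilde M$, so only the three coordinates in $N$ matter. *)
Lemma chart_cell_near g (P0 : 'rV[R]_8) x e1 e2 e q p :
  gm g (chart sigma P0) = cell x e1 e2 e q p ->
  \forall P \near P0, exists x' q' p', gm g (chart sigma P) = cell x' e1 e2 e q' p'.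
Proof.
move=> E.
have [q' [p' E1]] : exists q' p', gm g (emb (nmat (chart3 P0))) = cell x e1 e2 e q' p'.
  have : gm (gm (cell x e1 e2 e q p) (gi (nm (P0 0 5, P0 0 6, P0 0 7))))
     (gi (emb (amat (P0 0 3, P0 0 4)))) = gm g (emb (nmat (chart3 P0))).
    by rewrite -E /chart (gmulA Hs) (gmulgK Hs) (gmulA Hs) (gmulgK Hs).
  rewrite (ginv_nminus Hs) (ginv_amat Hs) (cell_nminus Hs) (cell_amat Hs) => <-.
  by do 2 eexists.
have cf : continuous chart3 by rewrite /chart3; cts.
have M : \forall P \near P0, exists x' q' p',
    gm g (emb (nmat (chart3 P))) = cell x' e1 e2 e q' p'.
  exact: cf P0 _ (nmat_cell_near E1).
apply: filterS M => P [x1 [q1 [p1 E2]]].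
exists x1; rewrite /chart !(gmulA Hs g) E2 (cell_amat Hs) (cell_nminus Hs).
by do 2 eexists.
Qed.

Lemma chart_near g (P0 : 'rV[R]_8) : incell (gm g (chart sigma P0)).1 ->
  exists e1 e2 e, \forall P \near P0,
    [/\ incell (gm g (chart sigma P)).1, ce1 (gm g (chart sigma P)).1 = e1,
        ce2 (gm g (chart sigma P)).1 = e2 & ceps sigma (gm g (chart sigma P)) = e].
Proof.
move=> /(cell_coords sigma) /chart_cell_near near_P0.
do 3 eexists; apply: filterS near_P0 => P [x [q [p ->]]].
have [[-> _ _ _] [-> -> ->]] := coords_cell sigma x (ce1 (gm g (chart sigma P0)).1)
  (ce2 (gm g (chart sigma P0)).1) (ceps sigma (gm g (chart sigma P0))) q p.
by [].
Qed.

End NearCell.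


(** * Smooth functions *)

Section SmoothClass.
Context {R : realType}.
Local Notation V := 'rV[R]_8.
Implicit Types f g : V -> R.

Lemma is_derive_add (W : normedModType R) (f g : W -> R) (p v : W) (a b : R) :
  is_derive p v f a -> is_derive p v g b -> is_derive p v (fun q => f q + g q) (a + b).
Proof. by move=> df dg; exact: (is_deriveD df dg). Qed.

Lemma is_derive_mul (W : normedModType R) (f g : W -> R) (p v : W) (a b : R) :
  is_derive p v f a -> is_derive p v g b ->
  is_derive p v (fun q => f q * g q) (f p * b + g p * a).
Proof. by move=> df dg; exact: (is_deriveM df dg). Qed.

Lemma is_derive_opp (W : normedModType R) (f : W -> R) (p v : W) (a : R) :
  is_derive p v f a -> is_derive p v (fun q => - f q) (- a).
Proof. by move=> df; exact: (is_deriveN df). Qed.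

Lemma is_derive_inv (t : R) : t != 0 -> is_derive t 1 (fun t : R => t^-1) (- t ^- 2).
Proof.
move=> t0; have := @is_deriveV _ id t 1 1 t0 (is_derive_id _ _).
by rewrite /GRing.scale /= mulr1.
Qed.

(** A directional derivative is a derivative in one variable along a line, which makes the
    one-variable chain rule available. *)
Lemma is_derive_line f (p v : V) (d : R) :
  is_derive p v f d <-> is_derive (0 : R) 1 (fun h : R => f (h *: v + p)) d.
Proof.
have E : (fun h : R => h^-1 *: (((fun h : R => f (h *: v + p)) \o shift 0) (h *: 1) - f (0 *: v + p)))
  = (fun h => h^-1 *: ((f \o shift p) (h *: v) - f p)).
  by apply/funext => h /=; rewrite addr0 scale0r add0r [_%:A]mulr1.
split=> -[df <-]; apply: DeriveDef.
- by apply/(derivable1P f p v); exact: df.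
- by rewrite /derive E.
- by apply/(derivable1P f p v); exact: df.
- by rewrite /derive E.
Qed.

Lemma is_derive_comp1 f (p v : V) (g : R -> R) (a b : R) :
  is_derive p v f a -> is_derive (f p) 1 g b ->
  is_derive p v (fun p => g (f p)) (b * a).
Proof.
move=> /is_derive_line df dg; apply/is_derive_line.
apply: (@is_derive1_comp _ g (fun h : R => f (h *: v + p))) => //.
by rewrite scale0r add0r.
Qed.

Lemma is_derive_coord j (p v : V) : is_derive p v (fun p : V => p 0 j) (v 0 j).
Proof.
apply/is_derive_line.
have -> : (fun h : R => (h *: v + p) 0 j) = (fun h : R => h * v 0 j + p 0 j).
  by apply/funext => h; rewrite !mxE.
have := is_derive_add (is_derive_mul (is_derive_id (0 : R) 1) (is_derive_cst (v 0 j) (0 : R) 1))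
  (is_derive_cst (p 0 j) (0 : R) 1).
by rewrite mulr0 add0r mulr1 addr0.
Qed.

(** A class of functions of one variable that is closed under differentiation on [D], so that
    derivatives of all orders come at once, without naming them. *)
Definition deriv_class (D : set R) (G : set (R -> R)) :=
  forall g : R -> R, G g -> exists2 g' : R -> R, G g' & forall t, D t -> is_derive t 1 g (g' t).

(* Closed under partial derivatives, so that continuity of the members already
   gives smoothness. *)
Inductive Sm (U : set V) : (V -> R) -> Prop :=
| Sm_cst c : Sm U (fun _ => c)
| Sm_coord j : Sm U (fun p => p 0 j)
| SmD f g : Sm U f -> Sm U g -> Sm U (fun p => f p + g p)
| SmM f g : Sm U f -> Sm U g -> Sm U (fun p => f p * g p)
| Sm_comp D G (g : R -> R) f : deriv_class D G -> G g -> (forall p, U p -> D (f p)) ->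
    Sm U f -> Sm U (fun p => g (f p))
| Sm_ext f g : (forall p, U p -> f p = g p) -> Sm U f -> Sm U g.

Lemma Sm_diff (U : set V) f j : open U -> Sm U f ->
  exists2 f', Sm U f' & forall p, U p ->
    {for p, continuous f} /\ is_derive p (delta_mx 0 j) f (f' p).
Proof.
move=> oU; elim=> {f}.
- move=> c; exists (fun _ => 0); first exact: Sm_cst.
  by move=> p _; split; [exact: cst_continuous|exact: is_derive_cst].
- move=> i; exists (fun _ => (delta_mx 0 j : V) 0 i); first exact: Sm_cst.
  by move=> p _; split; [exact: coord_continuous|exact: is_derive_coord].
- move=> f g _ [f' Sf' Hf] _ [g' Sg' Hg]; exists (fun p => f' p + g' p); first exact: SmD.
  move=> p Up; have [cf df] := Hf _ Up; have [cg dg] := Hg _ Up.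
  by split; [exact: (continuousD cf cg)|exact: (is_derive_add df dg)].
- move=> f g Sf [f' Sf' Hf] Sg [g' Sg' Hg].
  exists (fun p => f p * g' p + g p * f' p); first by apply: SmD; exact: SmM.
  move=> p Up; have [cf df] := Hf _ Up; have [cg dg] := Hg _ Up.
  by split; [exact: (continuousM cf cg)|exact: (is_derive_mul df dg)].
- move=> D G g f HG Gg UD Sf [f' Sf' Hf]; have [g' Gg' Hg] := HG _ Gg.
  exists (fun p => g' (f p) * f' p); first by apply: SmM => //; exact: (Sm_comp HG Gg' UD Sf).
  move=> p Up; have [cf df] := Hf _ Up; have dg := Hg _ (UD _ Up).
  split; last exact: is_derive_comp1.
  have [] := dg; move=> /derivable1_diffP/differentiable_continuous cg _.
  exact: continuous_comp.
- move=> f g fg _ [f' Sf' Hf]; exists f' => // p Up; have [cf df] := Hf _ Up.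
  have nfg : \forall q \near p, f q = g q.
    by apply: filterS (open_nbhs_nbhs (conj oU Up)) => q; exact: fg.
  split; last exact: near_eq_is_derive df.
  rewrite /prop_for /continuous_at -fg//.
  exact: cvg_trans (near_eq_cvg nfg) cf.
Qed.

Definition locSm f := forall p, exists U, [/\ open U, U p & Sm U f].

Lemma locSm_Cinfty f : locSm f -> Cinfty f.
Proof.
move=> lf k; elim: k f lf => [|k IH] f lf /=.
  split=> // p; have [U [oU Up SU]] := lf p.
  by have [f' _ /(_ _ Up)[]] := Sm_diff ord0 oU SU.
split.
  move=> p; have [U [oU Up SU]] := lf p.
  by have [f' _ /(_ _ Up)[]] := Sm_diff ord0 oU SU.
move=> j; split.
  move=> p; have [U [oU Up SU]] := lf p.
  by have [f' _ /(_ _ Up)[_ []]] := Sm_diff j oU SU.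
apply: IH => p; have [U [oU Up SU]] := lf p; exists U; split=> //.
have [f' Sf' H] := Sm_diff j oU SU.
by apply: Sm_ext Sf' => q Uq; have [_ [_ ->]] := H _ Uq.
Qed.

Lemma SmN U f : Sm U f -> Sm U (fun p => - f p).
Proof.
move=> Sf; apply: (@Sm_ext _ (fun p => -1 * f p)); last by apply: SmM => //; exact: Sm_cst.
by move=> p _; rewrite mulN1r.
Qed.

Lemma SmB U f g : Sm U f -> Sm U g -> Sm U (fun p => f p - g p).
Proof. by move=> Sf Sg; apply: SmD => //; exact: SmN. Qed.

Lemma Sm_expR U f : Sm U f -> Sm U (fun p => expR (f p)).
Proof.
apply: (@Sm_comp _ setT [set expR]) => // g /= ->; exists expR => // t _.
exact: is_derive_expR.
Qed.

Lemma is_derive_negcos (t : R) : is_derive t 1 (fun t => - cos t) (sin t).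
Proof. by rewrite -[sin t]opprK; apply: is_derive_opp. Qed.

Let trig : set (R -> R) := [set g | [\/ g = sin, g = cos, g = (fun t => - sin t)
  | g = (fun t => - cos t)]].

Lemma deriv_trig : deriv_class setT trig.
Proof.
move=> g [] ->.
- by exists cos => [|t _]; [exact: Or42|exact: is_derive_sin].
- by exists (fun t => - sin t) => [|t _]; [exact: Or43|exact: is_derive_cos].
- by exists (fun t => - cos t) => [|t _]; [exact: Or44|exact: is_derive_opp].
- by exists sin => [|t _]; [exact: Or41|exact: is_derive_negcos].
Qed.

Lemma Sm_sin U f : Sm U f -> Sm U (fun p => sin (f p)).
Proof. by apply: (Sm_comp deriv_trig) => //; exact: Or41. Qed.

Lemma Sm_cos U f : Sm U f -> Sm U (fun p => cos (f p)).
Proof. by apply: (Sm_comp deriv_trig) => //; exact: Or42. Qed.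

Let invpow : set (R -> R) := [set g | exists c n, g = (fun t => c * (t^-1) ^+ n)].

Lemma deriv_invpow : deriv_class [set t | t != 0] invpow.
Proof.
move=> g [c [n ->]]; exists (fun t => - (c * n%:R) * t^-1 ^+ n.+1).
  by exists (- (c * n%:R)), n.+1.
move=> t /= t0; have di := is_derive_inv t0.
have := is_derive_mul (is_derive_cst c t 1) (@is_deriveX _ _ _ n t 1 _ di).
have -> : (fun t : R => t^-1) ^+ n = (fun t : R => t^-1 ^+ n) by rewrite exprfctE.
rewrite mulr0 addr0 /GRing.scale /= => H; apply: (is_derive_eq H).
case: n {H} => [|n]; first by rewrite !(mul0r, mulr0) oppr0 mul0r.
rewrite !exprS expr0 mulr1 invfM /=; ring.
Qed.

Lemma Sm_inv U f : (forall p, U p -> f p != 0) -> Sm U f -> Sm U (fun p => (f p)^-1).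
Proof.
move=> f0 Sf; apply: (Sm_comp deriv_invpow) => //.
by exists 1, 1%N; apply/funext => t; rewrite mul1r expr1.
Qed.

Lemma Sm_ln U f : (forall p, U p -> 0 < f p) -> Sm U f -> Sm U (fun p => ln (f p)).
Proof.
move=> f0 Sf; have dc : deriv_class [set t : R | 0 < t] ((@ln R) |` invpow); last first.
  by apply: (Sm_comp dc) => //; left.
move=> g /= [->|ig].
  exists (fun t => t^-1) => [|t /= t0]; last exact: is_derive1_ln.
  by right; exists 1, 1%N; apply/funext => t; rewrite mul1r expr1.
have [g' ig' H] := deriv_invpow ig; exists g'; first by right.
by move=> t /= t0; apply: H; rewrite /= gt_eqF.
Qed.

Lemma Sm_ln_norm U f : (forall p, U p -> f p != 0) -> Sm U f ->
  Sm U (fun p => ln `|f p|).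
Proof.
(* Writing $\ln|f|$ as $\tfrac12\ln f^2$ avoids a distinction by the sign of $f$. *)
move=> f0 Sf; apply: (@Sm_ext _ (fun p => 2^-1 * ln (f p * f p))).
  move=> p Up; have n0 : 0 < `|f p| by rewrite normr_gt0 f0.
  rewrite -expr2 -real_normK ?num_real// expr2 lnM ?posrE//.
  by field.
apply: SmM; first exact: Sm_cst.
by apply: Sm_ln; [move=> p Up; rewrite -expr2 exprn_even_gt0//= f0|exact: SmM].
Qed.

(** The classical function that is flat at $0$. The polynomial factor makes the family closed under
    differentiation, which sends $p$ to $X^2(p-p')$. *)
Definition flat (p : {poly R}) (t : R) : R :=
  if 0 < t then p.[t^-1] * expR (- t^-1) else 0.

(** With $s=1/t$, each monomial is controlled by $s^{i+1}\le (i+1)!\,e^s$, a term of the exponential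
    series. One power of $s$ is spent to gain the factor $t$. *)
Lemma flat_bound p : exists C : R, forall t, `|flat p t| <= C * `|t|.
Proof.
exists (\sum_(i < size p) `|p`_i| * i.+1`!%:R) => t; rewrite /flat.
case: ltP => [t0|_]; last first.
  by rewrite normr0 mulr_ge0// sumr_ge0// => i _; rewrite mulr_ge0.
rewrite horner_coef big_distrl /= (le_trans (ler_norm_sum _ _ _))//.
rewrite big_distrl /=; apply: ler_sum => i _.
rewrite !normrM -!mulrA ler_wpM2l// !gtr0_norm ?exprn_gt0 ?invr_gt0 ?expR_gt0//.
have s0 : 0 < t^-1 by rewrite invr_gt0.
have := expR_ge1Dxn i (ltW s0) => h.
rewrite expRN ler_pdivrMr ?expR_gt0//.
have f0 : 0 < i.+1`!%:R :> R by rewrite ltr0n fact_gt0.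
have {}h : t^-1 ^+ i.+1 <= i.+1`!%:R * expR t^-1.
  by rewrite -ler_pdivrMl// mulrC (le_trans _ h)// lerDr.
have -> : t^-1 ^+ i = t * t^-1 ^+ i.+1.
  by rewrite exprS mulrA mulfV ?mul1r// gt_eqF.
by rewrite -mulrA mulrCA ler_pM2l// mulrC mulrC (le_trans h)// mulrC.
Qed.

Lemma is_derive_flat (p : {poly R}) (t : R) :
  is_derive t 1 (flat p) (flat ('X^2 * (p - p^`())) t).
Proof.
have [t0|t0|t0] := ltgtP t 0.
- have -> : flat ('X^2 * (p - p^`())) t = 0 by rewrite /flat ltNge ltW.
  apply: (@near_eq_is_derive _ _ _ (cst 0)).
  near=> s; rewrite /flat ifN// -leNgt ltW//; near: s; exact: lt_nbhsl.
- have -> : flat ('X^2 * (p - p^`())) t =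
      p.[t^-1] * (expR (- t^-1) * t ^- 2) + expR (- t^-1) * (p^`().[t^-1] * (- t ^- 2)).
    by rewrite /flat t0 hornerM hornerXn hornerD hornerN exprVn; ring.
  have di : is_derive t 1 (fun t : R => t^-1) (- t ^- 2) by apply: is_derive_inv; rewrite gt_eqF.
  have dp : is_derive t 1 (fun t : R => p.[t^-1]) (p^`().[t^-1] * (- t ^- 2)).
    exact: is_derive1_comp.
  have de : is_derive t 1 (fun t : R => expR (- t^-1)) (expR (- t^-1) * t ^- 2).
    apply: (@is_derive1_comp _ expR (fun t => - t^-1)).
    by rewrite -[t ^- 2]opprK; apply: is_derive_opp.
  apply: near_eq_is_derive (is_derive_mul dp de).
  near=> s; rewrite /flat ifT//; near: s; exact: lt_nbhsr.
- rewrite t0 {2}/flat ltxx.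
  (* At $0$ the difference quotient of [flat p] is [flat ('X * p)], which is $O(h)$. *)
  have [C hC] := flat_bound ('X * p).
  have H : (fun h : R => h^-1 *: ((flat p \o shift 0) (h *: 1) - flat p 0)) @ 0^' --> (0 : R).
    have E h : h^-1 *: ((flat p \o shift 0) (h *: 1) - flat p 0) = flat ('X * p) h.
      rewrite /= addr0 /flat ltxx subr0 [_%:A]mulr1 /GRing.scale /=.
      by case: ifP => _; rewrite ?mulr0// hornerM hornerX mulrA.
    under eq_fun do rewrite E.
    apply/cvgrPdist_le => e e0; near=> h.
    rewrite sub0r normrN (le_trans (hC h))//.
    have C1 : 0 < `|C| + 1 by rewrite ltr_wpDl.
    apply: (@le_trans _ _ ((`|C| + 1) * `|h|)).
      by rewrite ler_wpM2r// (le_trans (ler_norm C))// lerDl.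
    rewrite -ler_pdivlMl//; near: h; apply: dnbhs0_le.
    by rewrite mulr_gt0 ?invr_gt0.
  apply: DeriveDef; first by apply/cvg_ex; exists 0.
  exact: cvg_lim H.
Unshelve. all: by end_near.
Qed.

Lemma Sm_flat U p f : Sm U f -> Sm U (fun q => flat p (f q)).
Proof.
have dc : deriv_class setT (range flat).
  move=> g [q _ <-]; exists (flat ('X^2 * (q - q^`()))); first by exists ('X^2 * (q - q^`())).
  by move=> t _; exact: is_derive_flat.
by apply: (Sm_comp dc) => //; exists p.
Qed.

End SmoothClass.


(** * Functions given in cell coordinates and extended by zero *)

Section CellFun.
Context {R : realType} (sigma : SL3 R -> SL3 R -> bool).
Hypothesis Hs : BLS_cocycle sigma.
Local Notation C := R[i].
Local Notation V := 'rV[R]_8.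
Local Notation gm := (gmul sigma).
Implicit Types (U : set V) (A B : V -> SL3 R).

Definition SmMx U A := forall i j, Sm U (fun P => slmx (A P) i j).

Lemma SmMx_mul U A B : SmMx U A -> SmMx U B -> SmMx U (fun P => slmul (A P) (B P)).
Proof.
move=> SA SB i j; apply: (@Sm_ext _ _ (fun P => slmx (A P) i 0 * slmx (B P) 0 j +
  slmx (A P) i 1 * slmx (B P) 1 j + slmx (A P) i 2 * slmx (B P) 2 j)).
  by move=> P _; rewrite slmul_entry.
by repeat apply: SmD; apply: SmM.
Qed.

Lemma SmMx_mx3 U A (a b c d e f g h i : V -> R) :
  (forall P, slmx (A P) = mx3 (a P) (b P) (c P) (d P) (e P) (f P) (g P) (h P) (i P)) ->
  Sm U a -> Sm U b -> Sm U c -> Sm U d -> Sm U e -> Sm U f -> Sm U g -> Sm U h -> Sm U i ->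
  SmMx U A.
Proof.
move=> E *; case=> [[|[|[|//]]] hi]; case=> [[|[|[|//]]] hj];
  (eapply Sm_ext; first (by move=> P _; rewrite E !mxE /=; reflexivity)); assumption.
Qed.

Lemma SmMx_chart U g : SmMx U (fun P => (gm g (chart sigma P)).1).
Proof.
have -> : (fun P => (gm g (chart sigma P)).1) = (fun P : V => slmul g.1 (slmul (slmul
   (nmat (P 0 0, P 0 1, P 0 2)) (amat (P 0 3, P 0 4))) (lmat (P 0 5, P 0 6, P 0 7)))).
  by apply/funext => P; rewrite /chart 3!gmul_mx nminus_mx.
apply: SmMx_mul; first by move=> i j; exact: Sm_cst.
apply: SmMx_mul; first apply: SmMx_mul.
- by apply: SmMx_mx3 => [P| | | | | | | | |]; first reflexivity;
  rewrite /=; try exact: Sm_cst; exact: Sm_coord.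
- apply: SmMx_mx3 => [P| | | | | | | | |]; first reflexivity;
  rewrite /=; try exact: Sm_cst; apply: Sm_expR; try exact: Sm_coord.
  by apply: SmB; [apply: SmN|]; exact: Sm_coord.
- apply: SmMx_mx3 => [P| | | | | | | | |]; first exact: lmatE;
  rewrite /=; try exact: Sm_cst; try exact: Sm_coord; by apply: SmN; exact: Sm_coord.
Qed.

Lemma Sm_continuous (f : V -> R) : Sm setT f -> continuous f.
Proof.
move=> Sf p; have [f' _ /(_ p I)[]] := Sm_diff ord0 openT Sf.
by [].
Qed.

Definition cellfun (H : bool -> bool -> bool -> R * R * R -> R * R -> R * R * R -> 'cV[C]_2)
    (g : Gt R) : 'cV[C]_2 :=
  if incell g.1
  then H (ce1 g.1) (ce2 g.1) (ceps sigma g) (cx g.1) (cq g.1) (cp g.1) else 0.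

Lemma cellfun_cell H x e1 e2 e q p :
  cellfun H (cell sigma x e1 e2 e q p) = H e1 e2 e x q p.
Proof.
by rewrite /cellfun; have [[-> -> -> ->] [-> -> ->]] := coords_cell sigma x e1 e2 e q p.
Qed.

(** Smoothness on each component of the cell, expressed through substitution, so that it applies
    directly to the coordinates of a moving chart point. *)
Definition SmH (H : bool -> bool -> bool -> R * R * R -> R * R -> R * R * R -> 'cV[C]_2) :=
  forall U e1 e2 e i (x1 x2 x3 q1 q2 p1 p2 p3 : V -> R),
    Sm U x1 -> Sm U x2 -> Sm U x3 -> Sm U q1 -> Sm U q2 ->
    Sm U p1 -> Sm U p2 -> Sm U p3 ->
    let F P := H e1 e2 e (x1 P, x2 P, x3 P) (q1 P, q2 P) (p1 P, p2 P, p3 P) i 0 in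
    Sm U (fun P => complex.Re (F P)) /\ Sm U (fun P => complex.Im (F P)).

Lemma div_sq_ge (r a d : R) : d != 0 -> 0 < a - r * (d * d) -> r <= a * d^-1 ^+ 2.
Proof.
move=> d0; rewrite subr_gt0 => h; rewrite exprVn ler_pdivlMr ?ltW//.
by rewrite exprn_even_gt0.
Qed.

(** Inside the cell the component in $\widetilde M$ is locally constant and the coordinates are
    smooth. At a point outside, $x$ is unbounded nearby: the numerators of $x$ belonging to a
    vanishing denominator are not all zero. Hence $|x|^2\ge r$ holds at nearby points of the cell,
    and the function vanishes near that point. *)
Lemma cellfun_smooth H (r : R) : SmH H ->
  (forall e1 e2 e x q p, r <= x.1.1 ^+ 2 + x.1.2 ^+ 2 + x.2 ^+ 2 -> H e1 e2 e x q p = 0) ->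
  smooth sigma (cellfun H).
Proof.
move=> SH H0 g i.
pose A P := (gm g (chart sigma P)).1.
have SA U : SmMx U A by exact: SmMx_chart.
have S3 U : Sm U (fun P => cD3 (A P)) by exact: SA.
have S2 U : Sm U (fun P => cD2 (A P)) by apply: SmB; apply: SmM; exact: SA.
suff L P0 : exists U, [/\ open U, U P0 &
   Sm U (fun P => complex.Re (cellfun H (gm g (chart sigma P)) i 0)) /\
   Sm U (fun P => complex.Im (cellfun H (gm g (chart sigma P)) i 0))].
  by split; apply: locSm_Cinfty => P0; have [U [oU UP [SU SU']]] := L P0; exists U.
(* Vanishing near [P0] is certified by a continuous function that is positive at [P0]. *)
have Z (f : V -> R) : continuous f -> 0 < f P0 ->
   (forall P, 0 < f P -> cellfun H (gm g (chart sigma P)) = 0) ->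
   exists U, [/\ open U, U P0 &
   Sm U (fun P => complex.Re (cellfun H (gm g (chart sigma P)) i 0)) /\
   Sm U (fun P => complex.Im (cellfun H (gm g (chart sigma P)) i 0))].
  move=> cf f0 fz; exists (f @^-1` [set t | 0 < t]); split=> //.
    by apply: open_comp; [move=> P _; exact: cf|exact: open_gt].
  by split; apply: (@Sm_ext _ _ (fun _ => 0));
    try (by move=> P /= fP; rewrite fz// !mxE); exact: Sm_cst.
have [ic|] := boolP (incell (A P0)).
  have [e1 [e2 [e near_P0]]] := chart_near Hs ic.
  pose Q := [set P | [/\ incell (A P), ce1 (A P) = e1,
     ce2 (A P) = e2 & ceps sigma (gm g (chart sigma P)) = e]].
  have QU P : Q° P -> Q P by exact: interior_subset.
  exists (Q°); split; [exact: open_interior|exact: near_P0|].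
  have n3 P : Q° P -> cD3 (A P) != 0 by move=> /QU[/andP[]].
  have n2 P : Q° P -> cD2 (A P) != 0 by move=> /QU[/andP[]].
  have I3 : Sm Q° (fun P => (cD3 (A P))^-1) by exact: Sm_inv.
  have I2 : Sm Q° (fun P => (cD2 (A P))^-1) by exact: Sm_inv.
  have Sx1 : Sm Q° (fun P => (cx (A P)).1.1).
    by apply: SmM => //; apply: SmB; apply: SmM; exact: SA.
  have Sx2 : Sm Q° (fun P => (cx (A P)).1.2).
    by apply: SmM => //; apply: SmN; exact: SA.
  have Sx3 : Sm Q° (fun P => (cx (A P)).2) by apply: SmM => //; exact: SA.
  have Sp1 : Sm Q° (fun P => (cp (A P)).1.1).
    by apply: SmM => //; apply: SmN; exact: SA.
  have Sp2 : Sm Q° (fun P => (cp (A P)).1.2).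
    by apply: SmM => //; apply: SmB; apply: SmM; exact: SA.
  have Sp3 : Sm Q° (fun P => (cp (A P)).2) by apply: SmM => //; exact: SA.
  have Sq1 : Sm Q° (fun P => (cq (A P)).1) by apply: SmN; exact: Sm_ln_norm.
  have Sq2 : Sm Q° (fun P => (cq (A P)).2) by apply: SmB; exact: Sm_ln_norm.
  have [SR SI] := SH _ e1 e2 e i _ _ _ _ _ _ _ _ Sx1 Sx2 Sx3 Sq1 Sq2 Sp1 Sp2 Sp3.
  by split; [apply: Sm_ext SR|apply: Sm_ext SI] => P /QU[iP E1 E2 E];
    rewrite /cellfun -/(A P) iP E1 E2 E -!surjective_pairing.
rewrite negb_and !negbK; have [z3 _|n3 /= z2] := eqVneq (cD3 (A P0)) 0.
  (* On the cell, positivity of this expression implies $x_2^2+x_3^2\ge r$. At [P0] it is positive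
     because the last column of an invertible matrix is nonzero. *)
  apply: (Z (fun P => slmx (A P) 1 2 * slmx (A P) 1 2 + slmx (A P) 2 2 * slmx (A P) 2 2
     - r * (cD3 (A P) * cD3 (A P)))).
  - apply: Sm_continuous; apply: SmB; [apply: SmD|apply: SmM; [exact: Sm_cst|]];
      by apply: SmM => //; exact: SA.
  - rewrite z3 !mulr0 subr0 lt_neqAle addr_ge0 -?expr2 ?sqr_ge0// andbT eq_sym.
    rewrite paddr_eq0 ?sqr_ge0// !sqrf_eq0; apply/negP => /andP[/eqP h1 /eqP h2].
    have := det_entries (A P0); rewrite -/(cD3 _) z3 h1 h2.
    by rewrite !(mulr0, mul0r, subr0, addr0) => /esym/eqP; rewrite oner_eq0.
  - move=> P hP; rewrite /cellfun -/(A P); case: ifP => // /andP[h3 _].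
    rewrite H0// -addrA (le_trans (div_sq_ge h3 hP))// [leRHS]addrC -lerBlDl.
    by rewrite (_ : _ - _ = 0) ?sqr_ge0// /cx /=; ring.
(* The same for $x_1^2\ge r$, with [cD2] as denominator. *)
apply: (Z (fun P => (slmx (A P) 2 1 * slmx (A P) 0 2 - slmx (A P) 2 2 * slmx (A P) 0 1) *
  (slmx (A P) 2 1 * slmx (A P) 0 2 - slmx (A P) 2 2 * slmx (A P) 0 1)
   - r * (cD2 (A P) * cD2 (A P)))).
- apply: Sm_continuous; apply: SmB; [|apply: SmM; [exact: Sm_cst|]].
    by apply: SmM; apply: SmB; apply: SmM; exact: SA.
  by apply: SmM; exact: S2.
- rewrite (eqP z2) !mulr0 subr0 -expr2 lt_neqAle sqr_ge0 andbT eq_sym sqrf_eq0.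
  apply/negP => /eqP num0; have /eqP D2 := z2; have d3 := n3; rewrite /cD2 /cD3 in D2 d3.
  set G := A P0 in num0 D2 d3.
  (* If the numerator vanished, so would all $2\times2$ minors of the last two columns: two of them
     imply the third because $d_3\ne0$. Expansion along the first column would then give determinant
     $0$. *)
  have m23 : slmx G 1 1 * slmx G 2 2 - slmx G 1 2 * slmx G 2 1 = 0.
    apply: (mulfI d3); rewrite mulr0.
    transitivity (- (slmx G 1 2) * (slmx G 2 1 * slmx G 0 2 - slmx G 2 2 * slmx G 0 1)
      - slmx G 2 2 * (slmx G 0 1 * slmx G 1 2 - slmx G 0 2 * slmx G 1 1)); first by ring.
    by rewrite num0 D2 !mulr0 subr0.
  have := det_entries G.
  rewrite (_ : _ + _ = slmx G 0 0 * (slmx G 1 1 * slmx G 2 2 - slmx G 1 2 * slmx G 2 1)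
    + slmx G 1 0 * (slmx G 2 1 * slmx G 0 2 - slmx G 2 2 * slmx G 0 1)
    + slmx G 2 0 * (slmx G 0 1 * slmx G 1 2 - slmx G 0 2 * slmx G 1 1)); last by ring.
  by rewrite m23 num0 D2 !mulr0 !addr0 => /esym/eqP; rewrite oner_eq0.
- move=> P hP; rewrite /cellfun -/(A P); case: ifP => // /andP[_ h2].
  rewrite H0// -addrA (le_trans (div_sq_ge h2 hP))// -lerBlDl.
  rewrite (_ : _ - _ = 0) ?addr_ge0 ?sqr_ge0// /cx /=; ring.
Qed.

End CellFun.


(** * Integration *)

Section Scaling.
Local Open Scope ereal_scope.
Context {R : realType}.

(** The map multiplies the measure by [k] under preimages: a change of variables formulated on sets,
    with Jacobian $1/k$. *)
Definition scaling d (T : measurableType d) (mu : {measure set T -> \bar R})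
    (phi : T -> T) (k : R) :=
  [/\ measurable_fun setT phi, (0 < k)%R &
      forall A, measurable A -> mu (phi @^-1` A) = k%:E * mu A].

Lemma scaling_integral_meas d (T : measurableType d) (mu : {measure set T -> \bar R})
    phi k (f : T -> \bar R) : scaling mu phi k ->
  measurable_fun setT f -> (forall x, 0 <= f x) ->
  \int[mu]_x f (phi x) = k%:E * \int[mu]_x f x.
Proof.
move=> [mphi k0 mk] mf f0.
transitivity (\int[pushforward mu phi]_x f x).
  by rewrite ge0_integral_pushforward// preimage_setT.
have kn : (0 <= k)%R by rewrite ltW.
transitivity (\int[mscale (NngNum kn) mu]_x f x); last first.
  by rewrite ge0_integral_mscale.
by apply: eq_measure_integral => A mA _; have := mk _ mA.
Qed.

Lemma le_integral_ge0 d (T : measurableType d) (mu : {measure set T -> \bar R})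
    (f g : T -> \bar R) : (forall x, 0 <= f x) -> (forall x, f x <= g x) ->
  \int[mu]_x f x <= \int[mu]_x g x.
Proof.
move=> f0 fg; rewrite !ge0_integralTE//; last by move=> x; exact: le_trans (fg x).
apply: le_ereal_sup => _ [h /= hf <-]; exists h => // x; exact: le_trans (fg x).
Qed.

Import HBNNSimple.

Lemma scaling_integral_ge d (T : measurableType d) (mu : {measure set T -> \bar R})
    phi k (f : T -> \bar R) : scaling mu phi k -> (forall x, 0 <= f x) ->
  k%:E * \int[mu]_x f x <= \int[mu]_x f (phi x).
Proof.
move=> sk f0; have [_ k0 _] := sk.
rewrite [X in _ * X]ge0_integralTE// -lee_pdivlMl//.
apply: ge_ereal_sup => _ [h /= hf <-].
rewrite lee_pdivlMl// -integralT_nnsfun -(scaling_integral_meas sk).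
- apply: le_integral_ge0 => x; first by rewrite lee_fin.
  exact: hf.
- exact/measurable_EFinP.
- by move=> x; rewrite lee_fin.
Qed.

(** No measurability of [f] is required. The integral is a supremum over simple functions below [f],
    whose pullbacks give one inequality; the inverse map gives the other. *)
Lemma scaling_integral d (T : measurableType d) (mu : {measure set T -> \bar R})
    phi psi k (f : T -> \bar R) : scaling mu phi k -> scaling mu psi k^-1 ->
  cancel psi phi -> (forall x, 0 <= f x) ->
  \int[mu]_x f (phi x) = k%:E * \int[mu]_x f x.
Proof.
move=> s1 s2 K' f0; apply/eqP; rewrite eq_le scaling_integral_ge// andbT.
have [_ k0 _] := s1.
have := scaling_integral_ge (f := f \o phi) s2 (fun x => f0 (phi x)).
rewrite -(lee_pmul2l (isT : k%:E \is a fin_num)) ?lte_fin//.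
rewrite muleA -EFinM mulfV ?gt_eqF// mul1e.
by rewrite (_ : (fun x => (f \o phi) (psi x)) = f) //; apply/funext => x /=; rewrite K'.
Qed.

(** Holds for infinite values too, since a positive finite factor preserves infinities. It allows
    positive and negative parts to be treated separately without integrability. *)
Lemma gt0_muleBr (k : R) (x y : \bar R) : (0 < k)%R ->
  k%:E * x - k%:E * y = k%:E * (x - y).
Proof.
move=> k0; case: x => [x| |]; case: y => [y| |] //=;
  rewrite ?(gt0_muley, gt0_muleNy) ?lte_fin//= ?(gt0_muley, gt0_muleNy) ?lte_fin//.
by congr EFin; rewrite mulrBr.
Qed.

Lemma scaling_Rintegral d (T : measurableType d) (mu : {measure set T -> \bar R})
    phi psi k (f : T -> R) : scaling mu phi k -> scaling mu psi k^-1 ->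
  cancel psi phi ->
  (\int[mu]_x f (phi x) = k * \int[mu]_x f x)%R.
Proof.
move=> s1 s2 K'; have [_ k0 _] := s1.
have E : \int[mu]_x (f (phi x))%:E = k%:E * \int[mu]_x (f x)%:E.
  rewrite integralE [in RHS]integralE.
  have -> : \int[mu]_x (fun x => (f (phi x))%:E)^\+ x = k%:E * \int[mu]_x (fun x => (f x)%:E)^\+ x.
    rewrite -(scaling_integral s1 s2 K' (fun x => funepos_ge0 _ x)).
    by apply: eq_integral => x _; rewrite !funeposE.
  have -> : \int[mu]_x (fun x => (f (phi x))%:E)^\- x = k%:E * \int[mu]_x (fun x => (f x)%:E)^\- x.
    rewrite -(scaling_integral s1 s2 K' (fun x => funeneg_ge0 _ x)).
    by apply: eq_integral => x _; rewrite !funenegE.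
  exact: gt0_muleBr.
rewrite /Rintegral E; case: (\int[mu]_x (f x)%:E) => [r| |] //=;
by rewrite ?(gt0_muley, gt0_muleNy) ?lte_fin//= mulr0.
Qed.

Lemma scaling_affine (a b : R) : a != 0%R ->
  scaling (@lebesgue_measure R) (fun x : measurableTypeR R => a * x + b)%R `|a|^-1%R.
Proof.
move=> a0; have an : (0 < `|a|)%R by rewrite normr_gt0.
have mphi : measurable_fun setT (fun x : measurableTypeR R => (a * x + b)%R : measurableTypeR R).
  by apply: measurable_funD => //; exact: measurable_funM.
split=> //; first by rewrite invr_gt0.
move=> A mA; have kn : (0 <= `|a|)%R by [].
pose phi := fun x : measurableTypeR R => (a * x + b)%R : measurableTypeR R.
have [P PE] : exists P : {measure set (measurableTypeR R) -> \bar R},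
    forall A, P A = lebesgue_measure (phi @^-1` A).
  by unshelve eexists (pushforward (@lebesgue_measure R) phi : measure _ _).
(* Lebesgue measure is determined by half-open intervals, so [P] multiplied by $|a|$ only has to be
   compared on those. For $a<0$ the preimage is closed on the other side, which does not change its
   length. *)
have : lebesgue_measure A = mscale (NngNum kn) P A.
  apply: lebesgue_measure_unique => // _ [[u v] _ <-].
  rewrite /= /mscale PE /phi /=.
  have [ap|an'|//] := ltgtP 0%R a; last by move=> a00; rewrite a00 eqxx in a0.
    have -> : (fun x : R => (a * x + b)%R) @^-1` `]u, v] = `]((u - b) / a)%R, ((v - b) / a)%R]%classic.
      apply/seteqP; split => x /=; rewrite !in_itv /= ltr_pdivrMr// ler_pdivlMr//;
      by rewrite ltrBlDr lerBrDr [(x * a)%R]mulrC.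
    rewrite !lebesgue_measure_itv /= !lte_fin ltr_pM2r ?invr_gt0// ltrD2r.
    case: ifP => _; last by rewrite mule0.
    by rewrite -!EFinB -EFinM gtr0_norm//; congr EFin; field; rewrite gt_eqF.
  have -> : (fun x : R => (a * x + b)%R) @^-1` `]u, v] = `[((v - b) / a)%R, ((u - b) / a)%R[%classic.
    apply/seteqP; split => x /=; rewrite !in_itv /= ltr_ndivlMr// ler_ndivrMr//;
    by rewrite ltrBlDr lerBrDr [(x * a)%R]mulrC andbC.
  rewrite !lebesgue_measure_itv /= !lte_fin ltr_nM2r ?invr_lt0// ltrD2r.
  case: ifP => _; last by rewrite mule0.
  by rewrite -!EFinB -EFinM ltr0_norm//; congr EFin; field; rewrite lt_eqF.
move=> E; apply/esym; apply: etrans (congr1 (fun y => (`|a|^-1)%:E * y) E) _.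
by rewrite /= /mscale PE /= muleA -EFinM mulVf ?gt_eqF// mul1e.
Qed.

(** The product measure integrates the measures of sections. A fibre map that scales every section
    by the same [t] can therefore depend arbitrarily on the base point, as long as it is jointly
    measurable. This is what shears need. *)
Lemma scaling_skew d1 d2 (X : measurableType d1) (Y : measurableType d2)
    (mu : {measure set X -> \bar R}) (nu : {sigma_finite_measure set Y -> \bar R})
    (S : X -> X) (tau : X -> Y -> Y) (s t : R) :
  (0 < t)%R -> scaling mu S s -> (forall x, scaling nu (tau x) t) ->
  measurable_fun setT (fun z : X * Y => tau z.1 z.2) ->
  scaling (mu \x nu) (fun z => (S z.1, tau z.1 z.2)) (s * t)%R.
Proof.
move=> t0 sS st mt; have [mS s0 _] := sS.
have mphi : measurable_fun setT (fun z : X * Y => (S z.1, tau z.1 z.2)).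
  by apply/measurable_fun_pairP; split => //=; exact: (measurableT_comp mS measurable_fst).
split=> //; first exact: mulr_gt0.
move=> A mA /=; rewrite /product_measure1 /=.
transitivity (\int[mu]_x (t%:E * nu (xsection A (S x)))).
  apply: eq_integral => x _ /=; have [_ _ <-] := st x; last exact: measurable_xsection.
  by congr (nu _); apply/seteqP; split => y; rewrite /xsection /= !inE.
have mx : measurable_fun setT (fun x => nu (xsection A x)).
  exact: measurable_fun_xsection.
rewrite ge0_integralZl_EFin//=; [|exact: (measurableT_comp mx mS)|exact: ltW].
rewrite (scaling_integral_meas sS (f := fun x => nu (xsection A x)))//.
by rewrite muleA -EFinM mulrC.
Qed.

End Scaling.


Section BoundedIntegrals.
Context {R : realType} d (T : measurableType d) (mu : {measure set T -> \bar R}).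
Variable K : set T.
Hypothesis mK : measurable K.
Hypothesis muK : (mu K < +oo)%E.
Implicit Type f : T -> R.

Definition bounded_on (B : R) f := forall p, `|f p| <= (B * \1_K p).

Lemma bounded_on_integrable B f : measurable_fun setT f -> bounded_on B f ->
  mu.-integrable setT (EFin \o f).
Proof.
move=> mf bf; apply: (@le_integrable _ _ _ mu setT measurableT _ (EFin \o (fun p => B * \1_K p))).
- exact/measurable_EFinP.
- move=> p _ /=; rewrite lee_fin (le_trans (bf p))//; exact: ler_norm.
- have -> : EFin \o (fun p => B * \1_K p) = (fun p => B%:E * (\1_K p)%:E)%E by [].
  apply: integrableZl => //; apply/integrableP; split; first exact/measurable_EFinP.
  rewrite (eq_integral (fun x => (\1_K x)%:E)); last first.
    by move=> t _; rewrite gee0_abs// lee_fin.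
  by rewrite integral_indic// setIT.
Qed.

Lemma bounded_on_Rintegral B f : measurable_fun setT f -> bounded_on B f ->
  `|\int[mu]_p f p| <= B * fine (mu K).
Proof.
move=> mf bf; have If := bounded_on_integrable mf bf.
apply: le_trans (le_normr_Rintegral measurableT If) _.
have B1 : \int[mu]_p (B * \1_K p) = B * fine (mu K).
  have I1 : mu.-integrable setT (EFin \o \1_K).
    apply: (@bounded_on_integrable 1) => // p; rewrite mul1r ger0_norm//.
  by rewrite RintegralZl// /Rintegral integral_indic// setIT.
rewrite -B1; apply: le_Rintegral => //.
- apply: (@bounded_on_integrable B) => [|p]; first exact: (measurableT_comp (@normr_measurable R setT) mf).
  by rewrite normr_id.
- apply: (@bounded_on_integrable `|B|) => [|p]; last by rewrite normrM [`|\1_K p|]ger0_norm.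
  exact: measurable_funM.
Qed.

End BoundedIntegrals.

Section ParametricIntegrals.
Context {R : realType} d (T : measurableType d) (mu : {measure set T -> \bar R}).

(** Uniform convergence on a set of finite measure that contains all supports. *)
Lemma param_integral_continuous (X : topologicalType) (K : set T) (F : X -> T -> R) (x0 : X) :
  measurable K -> (mu K < +oo)%E ->
  (forall x, measurable_fun setT (F x)) ->
  (\forall x \near x0, exists B, bounded_on K B (F x)) ->
  (forall e, 0 < e -> \forall x \near x0, bounded_on K e (fun p => F x p - F x0 p)) ->
  {for x0, continuous (fun x => \int[mu]_p F x p)}.
Proof.
move=> mK muK mF bF cF; apply/cvgrPdist_le => e e0.
(* The summand $1$ keeps the divisor positive when [K] is a null set. *)
set c := fine (mu K) + 1.
have c0 : 0 < c by rewrite ltr_wpDl// fine_ge0.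
have [B0 hB0] := nbhs_singleton bF.
have := cF (e / c) (divr_gt0 e0 c0); apply: filterS2 bF => x [B hB] hx.
rewrite distrC -RintegralB//; last 2 first.
- exact: (bounded_on_integrable mK muK (mF x) hB).
- exact: (bounded_on_integrable mK muK (mF x0) hB0).
apply: le_trans (bounded_on_Rintegral mK muK _ hx) _.
  exact: measurable_funB.
by rewrite mulrAC ler_pdivrMr// ler_pM2l// lerDl.
Qed.

End ParametricIntegrals.

(** * Measurability of continuous functions on products *)

Section ProductMeasurability.
Context {R : realType}.

(** Bridges the product topology and the product $\sigma$-algebra: with a countable base of
    measurable sets, the preimage of an open interval under a continuous function is a countable
    union of them. *)
Definition countable_base d (T : measurableType d) (N : T -> set_system T) :=
  exists b : nat -> set T, (forall n, measurable (b n)) /\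
    forall x O, N x O -> exists n, b n x /\ b n `<=` O.

Lemma countable_base_real : countable_base (fun x : R => nbhs x).
Proof.
(* Intervals with rational endpoints, numbered by the code of the pair; numbers that are no code
   give the empty set. *)
pose b n := if unpickle n is Some (p, q) then `]ratr p, ratr q[%classic else set0 : set R.
exists b; split.
  by move=> n; rewrite /b; case: unpickle => // -[p q]; exact: measurable_itv.
move=> x O /nbhs_ballP[e /= e0 xO].
have xe : x - e < x by rewrite ltrBlDr ltrDl.
have xe' : x < x + e by rewrite ltrDl.
have [p] := rat_in_itvoo xe; have [q] := rat_in_itvoo xe'.
rewrite !in_itv /= => /andP[q1 q2] /andP[p1 p2].
exists (pickle (p, q)); rewrite /b pickleK; split; first by rewrite /= in_itv /= p2 q1.
move=> y /=; rewrite in_itv /= => /andP[y1 y2]; apply: xO.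
by rewrite /ball /= ltr_norml; apply/andP; split; lra.
Qed.

Lemma countable_base_prod d1 d2 (T1 : measurableType d1) (T2 : measurableType d2)
    (N1 : T1 -> set_system T1) (N2 : T2 -> set_system T2) :
  countable_base N1 -> countable_base N2 ->
  countable_base (fun z : T1 * T2 => filter_prod (N1 z.1) (N2 z.2)).
Proof.
move=> [b1 [m1 h1]] [b2 [m2 h2]].
exists (fun n => if unpickle n is Some (p, q) then b1 p `*` b2 q else set0); split.
  by move=> n; case: unpickle => // -[p q]; exact: measurableX.
move=> [x y] O [[U V] /= [/h1[p [p1 p2]] /h2[q [q1 q2]]] UV].
exists (pickle (p, q)); rewrite pickleK; split => // -[u v] [/= hu hv].
by apply: UV; split; [exact: p2|exact: q2].
Qed.

Lemma countable_base_measurable d (T : measurableType d) (N : T -> set_system T) (f : T -> R) :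
  countable_base N -> (forall x O, nbhs (f x) O -> N x (f @^-1` O)) -> measurable_fun setT f.
Proof.
move=> [b [mb hb]] cf; apply: (measurability _ (RGenOpens.measurableE R)).
move=> _ [_ [u [v ->] <-]]; rewrite setTI.
have -> : f @^-1` `]u, v[ = \bigcup_(n in [set n | b n `<=` f @^-1` `]u, v[]) b n.
  apply/seteqP; split => x /=; last by move=> [n /= h] /h.
  move=> fx; have [n [bx bn]] := hb _ _ (cf x _ (near_in_itvoo fx)).
  by exists n.
exact: bigcup_measurable.
Qed.

Lemma continuous_measurable2 (f : R * R -> R) : continuous f -> measurable_fun setT f.
Proof.
move=> cf; apply: (countable_base_measurable (countable_base_prod countable_base_real countable_base_real)).
by move=> x O; exact: cf.
Qed.

Lemma continuous_measurable3 (f : R * R * R -> R) : continuous f -> measurable_fun setT f.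
Proof.
move=> cf; apply: (countable_base_measurable (countable_base_prod
  (countable_base_prod countable_base_real countable_base_real) countable_base_real)).
by move=> x O; exact: cf.
Qed.

End ProductMeasurability.


Section ComplexContinuity.
Context {R : realType}.
Local Notation C := R[i].

Lemma Re_add (a b : C) : complex.Re (a + b) = complex.Re a + complex.Re b.
Proof. by case: a; case: b. Qed.
Lemma Im_add (a b : C) : complex.Im (a + b) = complex.Im a + complex.Im b.
Proof. by case: a; case: b. Qed.
Lemma Re_mul (a b : C) : complex.Re (a * b) =
  complex.Re a * complex.Re b - complex.Im a * complex.Im b.
Proof. by case: a; case: b. Qed.
Lemma Im_mul (a b : C) : complex.Im (a * b) =
  complex.Re a * complex.Im b + complex.Im a * complex.Re b.
Proof. by case: a; case: b. Qed.
Lemma complex_eq (a b : C) : complex.Re a = complex.Re b -> complex.Im a = complex.Im b -> a = b.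
Proof. by case: a; case: b => /= ? ? ? ? -> ->. Qed.

Definition ccts {X : topologicalType} (F : X -> C) :=
  continuous (fun x => complex.Re (F x)) /\ continuous (fun x => complex.Im (F x)).

Lemma ccts_cst {X : topologicalType} (c : C) : ccts (fun _ : X => c).
Proof. by split; exact: cts_cst. Qed.

Lemma cctsD {X : topologicalType} (F G : X -> C) : ccts F -> ccts G -> ccts (fun x => F x + G x).
Proof.
move=> [F1 F2] [G1 G2]; split.
  by apply: (cts_eq (fun x => Re_add (F x) (G x))); cts.
by apply: (cts_eq (fun x => Im_add (F x) (G x))); cts.
Qed.

Lemma cctsM {X : topologicalType} (F G : X -> C) : ccts F -> ccts G -> ccts (fun x => F x * G x).
Proof.
move=> [F1 F2] [G1 G2]; split.
  by apply: (cts_eq (fun x => Re_mul (F x) (G x))); cts.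
by apply: (cts_eq (fun x => Im_mul (F x) (G x))); cts.
Qed.

Lemma ccts_comp {X Y : topologicalType} (f : X -> Y) (F : Y -> C) :
  continuous f -> ccts F -> ccts (fun x => F (f x)).
Proof.
by move=> cf [F1 F2]; split;
  [exact: (cts_comp cf F1)|exact: (cts_comp cf F2)].
Qed.

Lemma ccts_sum {X : topologicalType} (I : finType) (F : I -> X -> C) :
  (forall i, ccts (F i)) -> ccts (fun x => \sum_i F i x).
Proof.
move=> cF; have E x : \sum_i F i x = (\sum_i (F i : X -> C)) x.
  by rewrite fct_sumE.
under eq_fun do rewrite E.
elim/big_ind : _ => [|G H cG cH|i _]; [exact: ccts_cst|exact: cctsD|exact: cF].
Qed.

End ComplexContinuity.

Section ComplexIntegral.
Context {R : realType} d (T : measurableType d) (mu : {measure set T -> \bar R}).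
Local Notation C := R[i].
Implicit Types F G : T -> C.

Definition cintegrable (D : set T) F :=
  mu.-integrable D (EFin \o (fun x => complex.Re (F x))) /\
  mu.-integrable D (EFin \o (fun x => complex.Im (F x))).

Lemma integrable_scale D (a : R) (f : T -> R) : measurable D ->
  mu.-integrable D (EFin \o f) -> mu.-integrable D (EFin \o (fun x => a * f x)).
Proof.
move=> mD If; rewrite (_ : _ \o _ = (fun x => a%:E * (EFin \o f) x))%E//.
exact: integrableZl.
Qed.

Lemma Rintegral_lin D (a b : R) (f g : T -> R) : measurable D ->
  mu.-integrable D (EFin \o f) -> mu.-integrable D (EFin \o g) ->
  \int[mu]_(x in D) (a * f x + b * g x) = a * \int[mu]_(x in D) f x + b * \int[mu]_(x in D) g x.
Proof.
move=> mD If Ig; rewrite RintegralD//; [|exact: integrable_scale|exact: integrable_scale].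
by rewrite !RintegralZl.
Qed.

Lemma cintD D F G : measurable D -> cintegrable D F -> cintegrable D G ->
  cint mu D (fun x => F x + G x) = cint mu D F + cint mu D G.
Proof.
move=> mD [F1 F2] [G1 G2]; apply: complex_eq; rewrite /= -RintegralD//;
by apply: eq_Rintegral => x _; rewrite ?Re_add ?Im_add.
Qed.

Lemma cintZ D (c : C) F : measurable D -> cintegrable D F ->
  cint mu D (fun x => c * F x) = c * cint mu D F.
Proof.
move=> mD [F1 F2]; apply: complex_eq; rewrite ?Re_mul ?Im_mul /=.
  rewrite -mulNr -Rintegral_lin//; apply: eq_Rintegral => x _.
  by rewrite Re_mul mulNr.
by rewrite -Rintegral_lin//; apply: eq_Rintegral => x _; rewrite Im_mul.
Qed.

Lemma cint_scaling (phi psi : T -> T) k F : scaling mu phi k -> scaling mu psi k^-1 ->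
  cancel psi phi -> cint mu setT (fun x => F (phi x)) = k%:C * cint mu setT F.
Proof.
move=> s1 s2 K; apply: complex_eq; rewrite ?Re_mul ?Im_mul /= mul0r ?subr0 ?addr0.
  exact: (scaling_Rintegral (fun x => complex.Re (F x)) s1 s2 K).
exact: (scaling_Rintegral (fun x => complex.Im (F x)) s1 s2 K).
Qed.

End ComplexIntegral.

Section Boxes.
Context {R : realType}.
Local Notation mu := (@lebesgue_measure R).
Local Notation mu2 := (mu \x mu)%E.
Local Notation mu3 := ((mu \x mu) \x mu)%E.

Definition box2 (B : R) : set (R * R) := `[- B, B]%classic `*` `[- B, B]%classic.
Definition box3 (B : R) : set (R * R * R) := box2 B `*` `[- B, B]%classic.

Lemma box2P B q : box2 B q <-> `|q.1| <= B /\ `|q.2| <= B.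
Proof.
by rewrite /box2 /= !in_itv /= -!ler_norml; split.
Qed.

Lemma box3P B p : box3 B p <-> [/\ `|p.1.1| <= B, `|p.1.2| <= B & `|p.2| <= B].
Proof.
rewrite /box3 /box2 /= !in_itv /= -!ler_norml.
by split=> [[[? ?] ?]|[? ? ?]].
Qed.

Lemma compact_box2 B : compact (box2 B).
Proof. by apply: compact_setX; exact: segment_compact. Qed.

Lemma compact_box3 B : compact (box3 B).
Proof. by apply: compact_setX; [exact: compact_box2|exact: segment_compact]. Qed.

Lemma measurable_box2 B : measurable (box2 B).
Proof. by apply: measurableX; exact: measurable_itv. Qed.

Lemma measurable_box3 B : measurable (box3 B).
Proof. by apply: measurableX; [exact: measurable_box2|exact: measurable_itv]. Qed.

Let seg (B : R) := mu `[(- B)%R, B]%classic.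

Lemma lebesgue_segment_fin B : (seg B < +oo)%E.
Proof. by rewrite /seg lebesgue_measure_itv /=; case: ifP => _; rewrite ?ltry// -EFinB ltry. Qed.

Lemma mu_box2 B : mu2 (box2 B) = (seg B * seg B)%E.
Proof. by rewrite /box2 product_measure1E//; exact: measurable_itv. Qed.

Lemma mu_box3 B : mu3 (box3 B) =
  (seg B * seg B * seg B)%E.
Proof.
rewrite /box3 product_measure1E//; last exact: measurable_box2.
congr (_ * _)%E; exact: mu_box2.
Qed.

Lemma mu_box2_fin B : (mu2 (box2 B) < +oo)%E.
Proof. by rewrite mu_box2 lte_mul_pinfty// ?ge0_fin_numE// lebesgue_segment_fin. Qed.

Lemma mu_box3_fin B : (mu3 (box3 B) < +oo)%E.
Proof.
rewrite mu_box3 -mu_box2 lte_mul_pinfty ?ge0_fin_numE ?mu_box2_fin//.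
exact: lebesgue_segment_fin.
Qed.

End Boxes.

Section CompactFamilies.
Context {R : realType}.

Lemma compact_bound (T : topologicalType) (K : set T) (f : T -> R) :
  compact K -> continuous f -> exists2 B, 0 <= B & forall p, K p -> `|f p| <= B.
Proof.
move=> cK cf; have ck : compact (f @` K).
  by apply: continuous_compact => //; apply: continuous_subspaceT.
have [M [_ mrt]] := compact_bounded ck.
exists (`|M| + 1); first by rewrite addr_ge0.
by move=> p Kp; apply: (mrt _ _ (f p)); [rewrite ltr_pwDr// ler_norm|exists p].
Qed.

(** Uniformity in the compact variable comes from the near-covering form of compactness. *)
Lemma compact_uniform (X T : topologicalType) (K : set T) (f : X * T -> R) (x0 : X) (e : R) :
  compact K -> continuous f -> 0 < e ->
  \forall x \near x0, forall p, K p -> `|f (x, p) - f (x0, p)| <= e.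
Proof.
move=> cK cf e0.
have H := (compact_near_coveringP K).1 cK X (nbhs x0)
  (fun x p => `|f (x, p) - f (x0, p)| <= e) _.
apply: H => p Kp.
have c1 : continuous (fun z : T * X => f (z.2, z.1) - f (x0, z.1)).
  apply: ctsD; first by apply: (@cts_comp _ _ _ (fun z : T * X => (z.2, z.1)) f) => //; cts.
  apply: ctsN; apply: (@cts_comp _ _ _ (fun z : T * X => (x0, z.1)) f) => //; cts.
have := c1 (p, x0); rewrite /continuous_at /= subrr => /cvgrPdist_le/(_ _ e0).
by apply: filterS => -[q y] /=; rewrite sub0r normrN.
Qed.

End CompactFamilies.


Section BoxIntegrals.
Context {R : realType}.
Local Notation C := R[i].
Local Notation mu := (@lebesgue_measure R).
Local Notation mu2 := (mu \x mu)%E.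
Local Notation mu3 := ((mu \x mu) \x mu)%E.

Lemma bounded_on_box (T : Type) (K : set T) (B : R) (f : T -> R) :
  (forall p, K p -> `|f p| <= B) -> (forall p, ~ K p -> f p = 0) ->
  forall p, `|f p| <= B * \1_K p.
Proof.
move=> fB f0 p; rewrite indicE; have [/set_mem Kp|/negP nK] := boolP (p \in K).
  by rewrite mulr1; exact: fB.
by rewrite mulr0 f0 ?normr0// => Kp; apply: nK; exact/mem_set.
Qed.

Lemma compact_supp_bounded_on (T : topologicalType) (K : set T) (f : T -> R) :
  compact K -> continuous f -> (forall p, ~ K p -> f p = 0) ->
  exists B, forall p, `|f p| <= B * \1_K p.
Proof.
move=> cK cf f0; have [B _ hB] := compact_bound cK cf.
by exists B; exact: bounded_on_box.
Qed.

Lemma near_uniform_bounded_on (X T : topologicalType) (K : set T) (f : X * T -> R) (x0 : X) (e : R) :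
  compact K -> continuous f -> 0 < e ->
  (\forall x \near x0, forall p, ~ K p -> f (x, p) = 0) ->
  \forall x \near x0, forall p, `|f (x, p) - f (x0, p)| <= e * \1_K p.
Proof.
move=> cK cf e0 nf; have f0 := nbhs_singleton nf.
have := compact_uniform x0 cK cf e0; apply: filterS2 nf => x fx hx.
by apply: bounded_on_box => // p Kp; rewrite fx// f0// subrr.
Qed.

Lemma cts_slice (X T : topologicalType) (f : X * T -> R) (x : X) :
  continuous f -> continuous (fun p => f (x, p)).
Proof. by move=> cf; apply: (@cts_comp _ _ _ (fun p => (x, p)) f) => //; cts. Qed.

Lemma param3_real (X : topologicalType) (f : X * (R * R * R) -> R) (x0 : X) :
  continuous f -> (exists B, \forall x \near x0, forall p, ~ box3 B p -> f (x, p) = 0) ->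
  {for x0, continuous (fun x => \int[mu3]_p f (x, p))}.
Proof.
move=> cf [B nf].
apply: (@param_integral_continuous R _ _ ((mu \x mu) \x mu)%E X (box3 B) (fun x p => f (x, p)) x0).
- exact: measurable_box3.
- exact: mu_box3_fin.
- by move=> x; apply: continuous_measurable3; exact: cts_slice.
- apply: filterS nf => x fx.
  by apply: compact_supp_bounded_on => //; [exact: compact_box3|exact: cts_slice].
- by move=> e e0; apply: near_uniform_bounded_on => //; exact: compact_box3.
Qed.

Lemma param2_real (X : topologicalType) (f : X * (R * R) -> R) (x0 : X) :
  continuous f -> (exists B, \forall x \near x0, forall p, ~ box2 B p -> f (x, p) = 0) ->
  {for x0, continuous (fun x => \int[mu2]_p f (x, p))}.
Proof.
move=> cf [B nf]; apply: (@param_integral_continuous R _ _ (mu \x mu)%E X (box2 B) (fun x p => f (x, p)) x0).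
- exact: measurable_box2.
- exact: mu_box2_fin.
- by move=> x; apply: continuous_measurable2; exact: cts_slice.
- apply: filterS nf => x fx.
  by apply: compact_supp_bounded_on => //; [exact: compact_box2|exact: cts_slice].
- by move=> e e0; apply: near_uniform_bounded_on => //; exact: compact_box2.
Qed.

Lemma int3_param (X : topologicalType) (F : X -> R * R * R -> C) :
  ccts (fun z : X * (R * R * R) => F z.1 z.2) ->
  (forall x0 : X, exists B, \forall x \near x0, forall p, ~ box3 B p -> F x p = 0) ->
  ccts (fun x => int3 (F x)).
Proof.
move=> [F1 F2] hF; split => x0.
  apply: (@param3_real X (fun z : X * (R * R * R) => complex.Re (F z.1 z.2))) => //.
  by have [B hB] := hF x0; exists B; apply: filterS hB => x hx p /hx /= ->.
apply: (@param3_real X (fun z : X * (R * R * R) => complex.Im (F z.1 z.2))) => //.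
by have [B hB] := hF x0; exists B; apply: filterS hB => x hx p /hx /= ->.
Qed.

Lemma int2_param (X : topologicalType) (F : X -> R * R -> C) :
  ccts (fun z : X * (R * R) => F z.1 z.2) ->
  (forall x0 : X, exists B, \forall x \near x0, forall p, ~ box2 B p -> F x p = 0) ->
  ccts (fun x => int2 (F x)).
Proof.
move=> [F1 F2] hF; split => x0.
  apply: (@param2_real X (fun z : X * (R * R) => complex.Re (F z.1 z.2))) => //.
  by have [B hB] := hF x0; exists B; apply: filterS hB => x hx p /hx /= ->.
apply: (@param2_real X (fun z : X * (R * R) => complex.Im (F z.1 z.2))) => //.
by have [B hB] := hF x0; exists B; apply: filterS hB => x hx p /hx /= ->.
Qed.

Definition nice3 (F : R * R * R -> C) :=
  ccts F /\ exists B, forall p, ~ box3 B p -> F p = 0.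
Definition nice2 (F : R * R -> C) :=
  ccts F /\ exists B, forall p, ~ box2 B p -> F p = 0.

Lemma nice3_integrable F : nice3 F -> cintegrable mu3 setT F.
Proof.
move=> [[F1 F2] [B F0]]; split.
  have [M hM] := compact_supp_bounded_on (@compact_box3 R B) F1
    (fun p h => congr1 (@complex.Re R) (F0 p h)).
  exact: (@bounded_on_integrable R _ _ ((mu \x mu) \x mu)%E (box3 B) (measurable_box3 B) (mu_box3_fin B) M _ (continuous_measurable3 F1) hM).
have [M hM] := compact_supp_bounded_on (@compact_box3 R B) F2
  (fun p h => congr1 (@complex.Im R) (F0 p h)).
exact: (@bounded_on_integrable R _ _ ((mu \x mu) \x mu)%E (box3 B) (measurable_box3 B) (mu_box3_fin B) M _ (continuous_measurable3 F2) hM).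
Qed.

Lemma nice2_integrable F : nice2 F -> cintegrable mu2 setT F.
Proof.
move=> [[F1 F2] [B F0]]; split.
  have [M hM] := compact_supp_bounded_on (@compact_box2 R B) F1
    (fun p h => congr1 (@complex.Re R) (F0 p h)).
  exact: (@bounded_on_integrable R _ _ (mu \x mu)%E (box2 B) (measurable_box2 B) (mu_box2_fin B) M _ (continuous_measurable2 F1) hM).
have [M hM] := compact_supp_bounded_on (@compact_box2 R B) F2
  (fun p h => congr1 (@complex.Im R) (F0 p h)).
exact: (@bounded_on_integrable R _ _ (mu \x mu)%E (box2 B) (measurable_box2 B) (mu_box2_fin B) M _ (continuous_measurable2 F2) hM).
Qed.

Lemma int3D F G : nice3 F -> nice3 G -> int3 (fun p => F p + G p) = int3 F + int3 G.
Proof. by move=> nF nG; apply: cintD => //; exact: nice3_integrable. Qed.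
Lemma int2D F G : nice2 F -> nice2 G -> int2 (fun p => F p + G p) = int2 F + int2 G.
Proof. by move=> nF nG; apply: cintD => //; exact: nice2_integrable. Qed.
Lemma int3Z c F : nice3 F -> int3 (fun p => c * F p) = c * int3 F.
Proof. by move=> nF; apply: cintZ => //; exact: nice3_integrable. Qed.
Lemma int2Z c F : nice2 F -> int2 (fun p => c * F p) = c * int2 F.
Proof. by move=> nF; apply: cintZ => //; exact: nice2_integrable. Qed.

Definition ReIm_le (b : R) (z : C) := `|complex.Re z| <= b /\ `|complex.Im z| <= b.

Lemma int3_bound B b F : nice3 F -> (forall p, ~ box3 B p -> F p = 0) ->
  (forall p, ReIm_le b (F p)) -> ReIm_le (b * fine (mu3 (box3 B))) (int3 F).
Proof.
move=> [[F1 F2] _] F0 Fb; split.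
  apply: (@bounded_on_Rintegral R _ _ ((mu \x mu) \x mu)%E (box3 B) (measurable_box3 B) (mu_box3_fin B) b _ (continuous_measurable3 F1)).
  by apply: bounded_on_box => p h; [have [] := Fb p|rewrite F0].
apply: (@bounded_on_Rintegral R _ _ ((mu \x mu) \x mu)%E (box3 B) (measurable_box3 B) (mu_box3_fin B) b _ (continuous_measurable3 F2)).
by apply: bounded_on_box => p h; [have [] := Fb p|rewrite F0].
Qed.

Lemma int2_bound B b F : nice2 F -> (forall p, ~ box2 B p -> F p = 0) ->
  (forall p, ReIm_le b (F p)) -> ReIm_le (b * fine (mu2 (box2 B))) (int2 F).
Proof.
move=> [[F1 F2] _] F0 Fb; split.
  apply: (@bounded_on_Rintegral R _ _ (mu \x mu)%E (box2 B) (measurable_box2 B) (mu_box2_fin B) b _ (continuous_measurable2 F1)).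
  by apply: bounded_on_box => p h; [have [] := Fb p|rewrite F0].
apply: (@bounded_on_Rintegral R _ _ (mu \x mu)%E (box2 B) (measurable_box2 B) (mu_box2_fin B) b _ (continuous_measurable2 F2)).
by apply: bounded_on_box => p h; [have [] := Fb p|rewrite F0].
Qed.

End BoxIntegrals.

(** * Changes of variables on $A$, $N$ and $N_-$ *)

Section ChangeOfVariables.
Context {R : realType}.
Local Notation C := R[i].
Local Notation mu := (@lebesgue_measure R).

Lemma scaling_affine1 (a b : R) : a != 0 ->
  scaling mu (fun x : measurableTypeR R => a * x + b) `|a|^-1.
Proof. exact: scaling_affine. Qed.

Lemma scaling_affine2 (a b c d : R) : a != 0 -> c != 0 ->
  scaling (mu \x mu)%E (fun z : R * R => (a * z.1 + b, c * z.2 + d)) (`|a|^-1 * `|c|^-1).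
Proof.
move=> a0 c0; apply: (@scaling_skew R _ _ (measurableTypeR R) (measurableTypeR R) mu mu
  (fun x => a * x + b) (fun _ x => c * x + d)) => //.
- by rewrite invr_gt0 normr_gt0.
- exact: scaling_affine1.
- by move=> _; exact: scaling_affine1.
- apply: measurable_funD => //; apply: measurable_funM => //; exact: measurable_snd.
Qed.

(** General enough for the dilations by the torus as well as for left and right translations of the
    Heisenberg group. *)
Lemma scaling_shear3 (a b c d e f g h : R) : a != 0 -> c != 0 -> e != 0 ->
  scaling ((mu \x mu) \x mu)%E (fun z : R * R * R =>
    (a * z.1.1 + b, c * z.1.2 + d, e * z.2 + (f * z.1.1 + g * z.1.2 + h)))
  (`|a|^-1 * `|c|^-1 * `|e|^-1).
Proof.
move=> a0 c0 e0.
apply: (@scaling_skew R _ _ (measurableTypeR R * measurableTypeR R)%type (measurableTypeR R)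
  (mu \x mu)%E mu (fun z => (a * z.1 + b, c * z.2 + d))
  (fun z x => e * x + (f * z.1 + g * z.2 + h))) => //.
- by rewrite invr_gt0 normr_gt0.
- exact: scaling_affine2.
- by move=> z; exact: scaling_affine1.
- apply: measurable_funD => /=.
    by apply: measurable_funM => //; exact: measurable_snd.
  apply: measurable_funD => //; apply: measurable_funD; apply: measurable_funM => //.
    exact: (measurableT_comp measurable_fst measurable_fst).
  exact: (measurableT_comp measurable_snd measurable_fst).
Qed.

Lemma int2_translate (a b : R) (F : R * R -> C) :
  int2 (fun q => F (q.1 + a, q.2 + b)) = int2 F.
Proof.
have h (u v : R) : scaling (mu \x mu)%E (fun q : R * R => (q.1 + u, q.2 + v)) 1.
  have := scaling_affine2 u v (oner_neq0 R) (oner_neq0 R).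
  rewrite normr1 invr1 mulr1; congr scaling.
  by apply/funext => q; rewrite !mul1r.
have h' : scaling (mu \x mu)%E (fun q : R * R => (q.1 - a, q.2 - b)) 1^-1 by rewrite invr1.
rewrite /int2 (@cint_scaling R _ _ (mu \x mu)%E (fun q : R * R => (q.1 + a, q.2 + b)) _ 1 F (h a b) h').
  by rewrite mul1r.
by move=> [x y] /=; rewrite !subrK.
Qed.

Lemma int3_diag (a c e : R) (F : R * R * R -> C) : a != 0 -> c != 0 -> e != 0 ->
  int3 (fun p => F (a * p.1.1, c * p.1.2, e * p.2)) = (`|a|^-1 * `|c|^-1 * `|e|^-1)%:C * int3 F.
Proof.
move=> a0 c0 e0.
have h (u v w : R) : u != 0 -> v != 0 -> w != 0 -> scaling ((mu \x mu) \x mu)%E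
    (fun p : R * R * R => (u * p.1.1, v * p.1.2, w * p.2)) (`|u|^-1 * `|v|^-1 * `|w|^-1).
  move=> u0 v0 w0; have := scaling_shear3 0 0 0 0 0 u0 v0 w0.
  by congr scaling; apply/funext => p; rewrite !mul0r !addr0.
have h' : scaling ((mu \x mu) \x mu)%E (fun p : R * R * R => (a^-1 * p.1.1, c^-1 * p.1.2, e^-1 * p.2))
   (`|a|^-1 * `|c|^-1 * `|e|^-1)^-1.
  by rewrite !invfM -[`|a|^-1]normfV -[`|c|^-1]normfV -[`|e|^-1]normfV; apply: h; rewrite invr_eq0.
apply: (@cint_scaling R _ _ ((mu \x mu) \x mu)%E (fun p : R * R * R => (a * p.1.1, c * p.1.2, e * p.2))
  _ _ F (h _ _ _ a0 c0 e0) h').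
by move=> [[x y] z] /=; rewrite !mulrA !mulfV// !mul1r.
Qed.

Lemma int3_nprodr r (F : R * R * R -> C) : int3 (fun p => F (nprod p r)) = int3 F.
Proof.
have h s : scaling ((mu \x mu) \x mu)%E (fun p : R * R * R => nprod p s) 1.
  have := scaling_shear3 s.1.1 s.1.2 s.1.2 0 s.2 (oner_neq0 R) (oner_neq0 R) (oner_neq0 R).
  rewrite normr1 invr1 !mulr1; congr scaling; apply/funext => p.
  by rewrite /nprod; congr (_, _, _); ring.
have h' : scaling ((mu \x mu) \x mu)%E (fun p : R * R * R => nprod p (ninv r)) 1^-1 by rewrite invr1.
rewrite /int3 /int3_on (@cint_scaling R _ _ ((mu \x mu) \x mu)%E (fun p : R * R * R => nprod p r)
  _ 1 F (h r) h') ?mul1r//.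
by move=> p; rewrite -nprodA ninvl nprod0.
Qed.

Lemma int3_nprodl r (F : R * R * R -> C) : int3 (fun p => F (nprod r p)) = int3 F.
Proof.
have h s : scaling ((mu \x mu) \x mu)%E (fun p : R * R * R => nprod s p) 1.
  have := scaling_shear3 s.1.1 s.1.2 0 s.1.1 s.2 (oner_neq0 R) (oner_neq0 R) (oner_neq0 R).
  rewrite normr1 invr1 !mulr1; congr scaling; apply/funext => p.
  by rewrite /nprod; congr (_, _, _); ring.
have h' : scaling ((mu \x mu) \x mu)%E (fun p : R * R * R => nprod (ninv r) p) 1^-1 by rewrite invr1.
rewrite /int3 /int3_on (@cint_scaling R _ _ ((mu \x mu) \x mu)%E (fun p : R * R * R => nprod r p)
  _ 1 F (h r) h') ?mul1r//.
by move=> p; rewrite nprodA ninvr nprod0l.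
Qed.

(** The three exponents add up to $4q_1+2q_2$, so the determinant of [lconj] has absolute value
    $a^{2\rho}$. *)
Lemma int3_lconj e1 e2 q (F : R * R * R -> C) :
  int3 (fun p => F (lconj e1 e2 q p)) = (expR (- (q.1 *+ 4 + q.2 *+ 2)))%:C * int3 F.
Proof.
have n0 (e : bool) t : (-1) ^+ e * expR t != 0 :> R.
  by rewrite mulf_neq0 ?signr_eq0// gt_eqF ?expR_gt0.
rewrite (@int3_diag _ _ _ F (n0 _ _) (n0 _ _) (n0 _ _)).
rewrite !normrM !normrX normrN1 !expr1n !mul1r !gtr0_norm ?expR_gt0// -!expRN -!expRD.
by congr ((expR _)%:C * _); ring.
Qed.

End ChangeOfVariables.


(** * Characters of $A$ and the representation [phi] *)

Section Characters.
Context {R : realType}.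
Local Notation C := R[i].
Implicit Types (q : R * R) (mu : 'rV[C]_3).

Lemma cexpD (a b : C) : cexp (a + b) = cexp a * cexp b.
Proof.
apply: complex_eq; rewrite /cexp !Re_add !Im_add expRD !(Re_mul, Im_mul) /= sinD cosD; ring.
Qed.

Lemma cexp0 : cexp (0 : C) = 1.
Proof. by apply: complex_eq; rewrite /cexp /= expR0 cos0 sin0; ring. Qed.

(** The logarithm of the character: $\mu$ paired with $\log a$. *)
Definition aexpo q mu : C :=
  mu 0 0 * (q.1)%:C + mu 0 1 * (q.2)%:C + mu 0 2 * (- q.1 - q.2)%:C.

Lemma apow_amat q mu : apow (amat q) mu = cexp (aexpo q mu).
Proof.
rewrite /apow !big_ord_recl big_ord0 mulr1 /aexpo !cexpD /cpow.
have -> : lift ord0 (lift ord0 ord0) = 2 :> 'I_3 by apply/val_inj.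
have -> : lift ord0 ord0 = 1 :> 'I_3 by apply/val_inj.
have -> : ord0 = 0 :> 'I_3 by apply/val_inj.
by rewrite amat_mx !mx3E !expRK mulrA.
Qed.

Lemma apow_amatD q r mu : apow (amat (q.1 + r.1, q.2 + r.2)) mu =
  apow (amat q) mu * apow (amat r) mu.
Proof.
rewrite !apow_amat -cexpD; congr cexp; rewrite /aexpo /=.
by apply: complex_eq; rewrite !(Re_add, Im_add, Re_mul, Im_mul) /=; ring.
Qed.

Lemma apow_amat_add q mu nu : apow (amat q) (mu + nu) =
  apow (amat q) mu * apow (amat q) nu.
Proof.
rewrite !apow_amat -cexpD; congr cexp; rewrite /aexpo !mxE; ring.
Qed.

Lemma apow_amat0 mu : apow (amat (0, 0)) mu = 1.
Proof.
rewrite apow_amat -cexp0; congr cexp; rewrite /aexpo /= !oppr0 addr0.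
by rewrite !mulr0 !addr0.
Qed.

Lemma Agrp_amat (a : SL3 R) : Agrp a -> exists q, a = amat q.
Proof.
move=> [da pa]; exists (ln (slmx a 0 0), ln (slmx a 1 1)).
apply: slmx_inj; rewrite amat_mx /= expRD !expRN !lnK ?posrE ?pa//.
have od (i j : 'I_3) : i != j :> nat -> slmx a i j = 0 by move/is_diag_mxP: da; apply.
have od6 := (od 0 1 isT, od 0 2 isT, od 1 0 isT, od 1 2 isT, od 2 0 isT, od 2 1 isT).
have := det_entries a; rewrite !od6 => dt.
rewrite [LHS]slmx_mx3 !od6; congr mx3.
move: dt; rewrite !(mul0r, mulr0, subr0, addr0) => dt.
have p0 := pa 0; have p1 := pa 1.
rewrite -[LHS]mul1r -[X in X * _](mulVf (x := slmx a 0 0 * slmx a 1 1)); last first.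
  by rewrite mulf_neq0// gt_eqF.
by rewrite -mulrA [_ * slmx a 2 2](_ : _ = 1) ?mulr1 ?invfM// -dt; ring.
Qed.

Lemma ccts_cexp (X : topologicalType) (F : X -> C) : ccts F -> ccts (fun x => cexp (F x)).
Proof.
move=> [F1 F2]; have cc : continuous (fun x => cos (complex.Im (F x))).
  by apply: (cts_comp F2); exact: continuous_cos.
have cs : continuous (fun x => sin (complex.Im (F x))).
  by apply: (cts_comp F2); exact: continuous_sin.
split.
  apply: (@cts_eq _ _ _ (fun x => expR (complex.Re (F x)) * cos (complex.Im (F x)))); last by cts.
  by move=> x; rewrite /cexp Re_mul /= mul0r subr0.
apply: (@cts_eq _ _ _ (fun x => expR (complex.Re (F x)) * sin (complex.Im (F x)))); last by cts.
by move=> x; rewrite /cexp Im_mul /= mul0r addr0.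
Qed.

Lemma ccts_real (X : topologicalType) (f : X -> R) : continuous f -> ccts (fun x => (f x)%:C).
Proof. by move=> cf; split => //=; exact: cts_cst. Qed.

Lemma ccts_apow (X : topologicalType) (f : X -> R * R) mu : continuous f ->
  ccts (fun x => apow (amat (f x)) mu).
Proof.
move=> cf; under [fun x => _]eq_fun do rewrite apow_amat.
apply: ccts_cexp; rewrite /aexpo; apply: cctsD; first apply: cctsD.
- by apply: cctsM; [exact: ccts_cst|apply: ccts_real; cts].
- by apply: cctsM; [exact: ccts_cst|apply: ccts_real; cts].
- by apply: cctsM; [exact: ccts_cst|apply: ccts_real; cts].
Qed.

End Characters.

Section Phi.
Context {R : realType} (sigma : SL3 R -> SL3 R -> bool).
Hypothesis Hs : BLS_cocycle sigma.
Local Notation C := R[i].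
Local Notation gm := (gmul sigma).
Local Notation mt := (@mtilde R).

Definition mx2 (a b c d : C) : 'M[C]_2 :=
  \matrix_(k, l) nth 0 (nth [::] [:: [:: a; b]; [:: c; d]] k) l.

Lemma mulmx2 a b c d a' b' c' d' : mx2 a b c d *m mx2 a' b' c' d' =
  mx2 (a * a' + b * c') (a * b' + b * d') (c * a' + d * c') (c * b' + d * d').
Proof.
apply/matrixP => k l; rewrite !mxE !big_ord_recl big_ord0 !mxE /=.
by case: k => [[|[|//]] ?]; case: l => [[|[|//]] ?] /=; rewrite addr0.
Qed.

Lemma scalemx2 k a b c d : k *: mx2 a b c d = mx2 (k * a) (k * b) (k * c) (k * d).
Proof.
apply/matrixP => i l; rewrite !mxE.
by case: i => [[|[|//]] ?]; case: l => [[|[|//]] ?].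
Qed.

Lemma mx2_1 : (1 : 'M[C]_2) = mx2 1 0 0 1.
Proof.
apply/matrixP => i l; rewrite !mxE.
by case: i => [[|[|//]] ?]; case: l => [[|[|//]] ?].
Qed.

Lemma phi_mtilde e1 e2 e : phi (mt e1 e2 e) =
  (-1) ^+ e *: (mx2 0 (-1) 1 0 ^+ e1 * mx2 (0 -i* 1) 0 0 (0 +i* 1) ^+ e2).
Proof.
rewrite /phi /mtilde [(_, _).1]/= [(_, _).2]/= mmat_mx !mx3E !sign_lt0.
by [].
Qed.

(** The two generating matrices are anticommuting square roots of $-1$, so the image is the
    quaternion group, and its multiplication table agrees with [mtildeM]. *)
Lemma phiM e1 e2 e f1 f2 f : phi (gm (mt e1 e2 e) (mt f1 f2 f)) =
  phi (mt e1 e2 e) *m phi (mt f1 f2 f).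
Proof.
have ii : (0 +i* 1 : C) * (0 +i* 1) = -1 by apply: complex_eq; rewrite ?Re_mul ?Im_mul /=; ring.
have mi : (0 -i* 1 : C) = - (0 +i* 1) by apply: complex_eq; rewrite /= ?oppr0.
(* Only $i^2=-1$ matters, so the imaginary unit is generalized to some [w] with this property for
   the sake of [ring]. *)
rewrite (mtildeM Hs) !phi_mtilde mi; move: (0 +i* 1 : C) ii => w ww.
have E (x y : 'M[C]_2) : x * y = x *m y by [].
case: e1; case: e2; case: f1; case: f2; case: e; case: f;
rewrite /= ?expr0 ?expr1 ?mul1r ?mulr1 ?mx2_1 ?E ?mulmx2 ?scalemx2 ?mulmx2;
by congr mx2; ring: ww.
Qed.

Lemma phi1 : phi (mt false false false) = 1%:M.
Proof. by rewrite phi_mtilde expr0 scale1r expr0 expr0 mulr1. Qed.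

End Phi.

Section RowContinuity.
Context {R : realType}.

Lemma cts_row (X : topologicalType) n (f : X -> 'rV[R]_n) :
  (forall j, continuous (fun x => f x 0 j)) -> continuous f.
Proof.
move=> cf x A [P hP PA].
have N : \forall y \near x, forall j, P 0 j (f y 0 j).
  by apply: filter_forall => j; apply: cf; exact: hP.
apply: filterS N => y Py; apply: PA => i j; rewrite (ord1 i); exact: Py.
Qed.

End RowContinuity.


(** * Averages over the open cell *)

Section CellIntegral.
Context {R : realType} (sigma : SL3 R -> SL3 R -> bool).
Hypothesis Hs : BLS_cocycle sigma.
Local Notation C := R[i].
Local Notation gm := (gmul sigma).
Local Notation gi := (ginv sigma).
Local Notation nm := (nminus sigma).
Local Notation wl := (emb (wlong : SL3 R)).
Local Notation mt := (@mtilde R).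
Local Notation cell := (cell sigma).
Implicit Types (u : Gt R -> 'cV[C]_2) (x p : R * R * R) (q : R * R).

(** Coordinates in the chart translated by $w_\ell m$, where $n(x)$ has been moved past $m$. One
    translate thus covers a whole component of the cell, and smoothness on the cover gives
    continuity in cell coordinates. *)
Definition chart_pt e1 e2 x q p : 'rV[R]_8 :=
  let y := nm_sign e1 e2 x in
  \row_j nth 0 [:: y.1.1; y.1.2; y.2; q.1; q.2; p.1.1; p.1.2; p.2] j.

Lemma cell_chart x e1 e2 e q p : cell x e1 e2 e q p =
  gm (gm wl (mt e1 e2 e)) (chart sigma (chart_pt e1 e2 x q p)).
Proof.
rewrite /(cell _ _ _ _ _ _) -(gmulA Hs wl) (nmat_mtilde Hs) (gmulA Hs wl).
rewrite /chart (gmulA Hs _ _ (nm _)) (gmulA Hs _ _ (emb (amat _))) !mxE /=.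
by case: q; case: p => -[].
Qed.

Local Notation P8 := ((R * R * R) * (R * R) * (R * R * R))%type.

Lemma cts_chart_pt e1 e2 : continuous (fun z : P8 => chart_pt e1 e2 z.1.1 z.1.2 z.2).
Proof.
apply: cts_row => j; apply: (cts_eq (fun z => mxE _ _ _ _)).
case: j => [[|[|[|[|[|[|[|[|//]]]]]]]] hj] /=; rewrite /nm_sign /=; cts.
Qed.

Lemma smooth_cell_ccts u e1 e2 e i : smooth sigma u ->
  ccts (fun z : P8 => u (cell z.1.1 e1 e2 e z.1.2 z.2) i 0).
Proof.
move=> su; have [/(_ 0%N)[c1 _] /(_ 0%N)[c2 _]] := su (gm wl (mt e1 e2 e)) i.
split.
  apply: (cts_eq (fun z : P8 => congr1 (fun g => complex.Re (u g i 0))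
    (cell_chart z.1.1 e1 e2 e z.1.2 z.2))).
  exact: (@cts_comp _ _ _ (fun z : P8 => chart_pt e1 e2 z.1.1 z.1.2 z.2)
    (fun P => complex.Re (u (gm (gm wl (mt e1 e2 e)) (chart sigma P)) i 0)) (@cts_chart_pt e1 e2) c1).
apply: (cts_eq (fun z : P8 => congr1 (fun g => complex.Im (u g i 0))
  (cell_chart z.1.1 e1 e2 e z.1.2 z.2))).
exact: (@cts_comp _ _ _ (fun z : P8 => chart_pt e1 e2 z.1.1 z.1.2 z.2)
  (fun P => complex.Im (u (gm (gm wl (mt e1 e2 e)) (chart sigma P)) i 0)) (@cts_chart_pt e1 e2) c2).
Qed.

(** The entries of [cellmx] bound $d_3$, then $d_2$, then $d_1$, as well as the products of $d_2$
    and $d_3$ with coordinates of $p$, by $M'=M(1+X)^2$. Since $d_1d_2d_3=1$, upper bounds imply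
    lower ones: with $L=\ln M'$ this gives $|q_i|\le 2L$, and dividing by $d_2$ or $d_3$ bounds
    $p$. *)
Lemma cell_bound (M X : R) : 0 <= X -> exists B, forall x e1 e2 e q p,
  [/\ `|x.1.1| <= X, `|x.1.2| <= X & `|x.2| <= X] ->
  (forall i j, `|slmx (cell x e1 e2 e q p).1 i j| <= M) -> box2 B q /\ box3 B p.
Proof.
move=> X0; pose M' := M * (1 + X) * (1 + X); pose L := ln M'.
exists (2 * `|L| + `|M'| * expR (2 * `|L|)) => x e1 e2 e q p [x1 x2 x3] hM.
pose d1 : R := (-1) ^+ e1 * expR q.1; pose d2 : R := (-1) ^+ e2 * expR q.2.
pose d3 : R := (-1) ^+ (e1 (+) e2) * expR (- q.1 - q.2).
have n1 : `|d1| = expR q.1 by rewrite normrM normrX normrN1 expr1n mul1r gtr0_norm ?expR_gt0.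
have n2 : `|d2| = expR q.2 by rewrite normrM normrX normrN1 expr1n mul1r gtr0_norm ?expR_gt0.
have n3 : `|d3| = expR (- q.1 - q.2).
  by rewrite normrM normrX normrN1 expr1n mul1r gtr0_norm ?expR_gt0.
have E := cell_mx sigma x e1 e2 e q p; rewrite -/d1 -/d2 -/d3 in E.
have h i j : `|cellmx d1 d2 d3 x p i j| <= M by rewrite -E.
have m3 : `|d3| <= M by have := h 0 2; rewrite mx3E.
have M0 : 0 <= M by exact: le_trans m3.
have hp1 : `|d3 * p.1.1| <= M by have := h 0 1; rewrite mx3E mulNr normrN.
have hp3 : `|d3 * p.2| <= M by have := h 0 0; rewrite mx3E.
have lem (a b c : R) : `|a - b| <= M -> `|b| <= c -> `|a| <= M + c.
  move=> ab bc; rewrite -(subrK b a) (le_trans (ler_normD _ _))//.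
  exact: lerD.
have mulX (a b c : R) : `|a| <= X -> `|b| <= c -> `|a * b| <= X * c.
  by move=> ha hb; rewrite normrM ler_pM.
have hp2 : `|d2 * p.1.2| <= M + X * M.
  have := h 1 0; rewrite mx3E -mulrA => /lem; apply; exact: mulX.
have m2 : `|d2| <= M + X * M.
  have := h 1 1; rewrite mx3E -mulrA distrC => /lem; apply; exact: mulX.
have m1 : `|d1| <= M + (X * (M + X * M) + X * M).
  have := h 2 0; rewrite mx3E => k.
  apply: (lem _ (x.1.1 * (d2 * p.1.2) - x.2 * (d3 * p.2))).
    by rewrite (_ : _ - _ = d1 - x.1.1 * d2 * p.1.2 + x.2 * d3 * p.2)//; ring.
  rewrite (le_trans (ler_normB _ _))//.
  by apply: lerD; exact: mulX.
have EM' : M' = M + (X * (M + X * M) + X * M) by rewrite /M'; ring.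
have XM : 0 <= X * M by rewrite mulr_ge0.
have XXM : 0 <= X * (X * M) by rewrite mulr_ge0.
have le3 : M <= M' by rewrite EM' mulrDr; move: M0 XM XXM; clear; lra.
have le2 : M + X * M <= M' by rewrite EM' mulrDr; move: M0 XM XXM; clear; lra.
have M'0 : 0 < M' by apply: lt_le_trans le3; rewrite (lt_le_trans _ m3)// n3 expR_gt0.
have q1 : q.1 <= L by rewrite /L -[q.1]expRK ler_ln ?posrE ?expR_gt0// -n1 EM'.
have q2 : q.2 <= L.
  by rewrite /L -[q.2]expRK ler_ln ?posrE ?expR_gt0// -n2 (le_trans m2).
have q3 : - q.1 - q.2 <= L.
  by rewrite /L -[leLHS]expRK ler_ln ?posrE ?expR_gt0// -n3 (le_trans m3).
(* Three numbers with sum $0$ are at most $L$, so $L\ge0$. *)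
have LL : `|L| = L by rewrite ger0_norm//; move: q1 q2 q3; clear; lra.
have MM : `|M'| = M' by rewrite gtr0_norm.
rewrite LL MM.
have e0 : 0 <= M' * expR (2 * L) by rewrite mulr_ge0 ?expR_ge0// ltW.
have bq1 : `|q.1| <= 2 * L by rewrite ler_norml; apply/andP; split; move: q1 q2 q3; clear; lra.
have bq2 : `|q.2| <= 2 * L by rewrite ler_norml; apply/andP; split; move: q1 q2 q3; clear; lra.
have pb (d t s m : R) : `|d| = expR s -> - s <= 2 * L -> `|d * t| <= m -> m <= M' ->
    `|t| <= M' * expR (2 * L).
  move=> ds sL; rewrite normrM ds => dt mM.
  have -> : `|t| = (expR s * `|t|) * expR (- s).
    by rewrite mulrAC -expRD subrr expR0 mul1r.
  by rewrite ler_pM ?mulr_ge0 ?expR_ge0 ?ler_expR// (le_trans dt).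
have L0 : 0 <= 2 * L by rewrite -LL mulr_ge0.
split; first by apply/box2P; split; move: bq1 bq2 e0; clear; lra.
apply/box3P; split.
- by rewrite (le_trans (pb _ _ _ _ n3 _ hp1 le3)) ?lerDr//; move: q1 q2 q3 L0; clear; lra.
- by rewrite (le_trans (pb _ _ _ _ n2 _ hp2 le2)) ?lerDr//; move: q1 q2 q3 L0; clear; lra.
- by rewrite (le_trans (pb _ _ _ _ n3 _ hp3 le3)) ?lerDr//; move: q1 q2 q3 L0; clear; lra.
Qed.

Variable lambda : 'rV[C]_3.

(** Only the first component is kept, the one that [delta_e1] evaluates. *)
Definition cell_integrand u x q p : C :=
  \sum_(e1 : bool) \sum_(e2 : bool) \sum_(e : bool)
    apow (amat q) (- (lambda - rho)) *
    ((phi (gi (mt e1 e2 e)))^T *m u (cell x e1 e2 e q p)) 0 0 * apow (amat q) (- (rho *+ 2)).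

Lemma cell_averageE u x : cell_average sigma lambda (@phi R) u x 0 0 =
  int2 (fun q => int3 (cell_integrand u x q)).
Proof. by rewrite mxE. Qed.

Lemma mulmx_col2 (A : 'M[C]_2) (v : 'cV[C]_2) i : (A *m v) i 0 = A i 0 * v 0 0 + A i 1 * v 1 0.
Proof.
rewrite !mxE !big_ord_recl big_ord0 addr0; congr (_ * _ + A _ _ * v _ _); exact/val_inj.
Qed.

Lemma cell_integrand_ccts u : smooth sigma u ->
  ccts (fun z : P8 => cell_integrand u z.1.1 z.1.2 z.2).
Proof.
move=> su; rewrite /cell_integrand; do 3 (apply: ccts_sum => ?).
apply: cctsM; last by apply: ccts_apow; cts.
apply: cctsM; first by apply: ccts_apow; cts.
under eq_fun do rewrite mulmx_col2.
by apply: cctsD; apply: cctsM; [exact: ccts_cst|exact: smooth_cell_ccts|exact: ccts_cst|exact: smooth_cell_ccts].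
Qed.

Lemma cell_integrand_eq0 u x q p :
  (forall e1 e2 e, u (cell x e1 e2 e q p) = 0) -> cell_integrand u x q p = 0.
Proof.
move=> u0; rewrite /cell_integrand; do 3 (rewrite big1// => ? _).
by rewrite u0 mulmx0 mxE mulr0 mul0r.
Qed.

(** One box serves all [x] in a bounded set, as continuity of the parametric integrals requires. *)
Lemma cell_integrand_supp u M X : supp_in M u -> 0 <= X -> exists B, forall x q p,
  [/\ `|x.1.1| <= X, `|x.1.2| <= X & `|x.2| <= X] ->
  ~ (box2 B q /\ box3 B p) -> cell_integrand u x q p = 0.
Proof.
move=> uM X0; have [B hB] := cell_bound M X0; exists B => x q p hx nb.
apply: cell_integrand_eq0 => e1 e2 e; have [h|h] := pselect
  (exists i j, M < `|slmx (cell x e1 e2 e q p).1 i j|); first exact: uM.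
case: nb; apply: (hB x e1 e2 e) => // i j; rewrite leNgt; apply/negP => k.
by apply: h; exists i, j.
Qed.

Lemma near_box (x0 : R * R * R) : exists2 X, 0 <= X & \forall x \near x0,
  [/\ `|x.1.1| <= X, `|x.1.2| <= X & `|x.2| <= X].
Proof.
pose X := `|x0.1.1| + `|x0.1.2| + `|x0.2| + 1.
have cn (f : R * R * R -> R) : continuous f -> continuous (fun x => X - `|f x|).
  move=> cf; apply: ctsD; first exact: cts_cst.
  by apply: ctsN => x; apply: cvg_norm; exact: cf.
have c1 : continuous (fun x : R * R * R => X - `|x.1.1|) by apply: cn; cts.
have c2 : continuous (fun x : R * R * R => X - `|x.1.2|) by apply: cn; cts.
have c3 : continuous (fun x : R * R * R => X - `|x.2|) by exact: (cn _ (cts_snd (@cts_id _))).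
have a1 := normr_ge0 x0.1.1; have a2 := normr_ge0 x0.1.2; have a3 := normr_ge0 x0.2.
exists X; first by rewrite /X; lra.
near=> x; split; rewrite -subr_ge0 ltW//.
- by near: x; apply: (near_gt0 c1); rewrite /X; lra.
- by near: x; apply: (near_gt0 c2); rewrite /X; lra.
- by near: x; apply: (near_gt0 c3); rewrite /X; lra.
Unshelve. all: by end_near.
Qed.

Definition inner_integral u (z : (R * R * R) * (R * R)) : C := int3 (cell_integrand u z.1 z.2).

Lemma inner_integral_ccts u : test_fun sigma u -> ccts (inner_integral u).
Proof.
move=> [su [M uM]]; apply: int3_param; first exact: cell_integrand_ccts.
move=> z0; have [X X0 nX] := near_box z0.1; have [B hB] := cell_integrand_supp uM X0.
exists B; have : \forall z \near z0, [/\ `|z.1.1.1| <= X, `|z.1.1.2| <= X & `|z.1.2| <= X].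
  have cf : continuous (fun z : (R * R * R) * (R * R) => z.1) by exact: (cts_fst (@cts_id _)).
  exact: cf z0 _ nX.
by apply: filterS => z hz p np; apply: hB => // -[].
Qed.

Lemma inner_integral_supp u M X : supp_in M u -> 0 <= X -> exists B, forall x q,
  [/\ `|x.1.1| <= X, `|x.1.2| <= X & `|x.2| <= X] ->
  ~ box2 B q -> inner_integral u (x, q) = 0.
Proof.
move=> uM X0; have [B hB] := cell_integrand_supp uM X0; exists B => x q hx nq.
rewrite /inner_integral /= (_ : cell_integrand u x q = fun=> 0).
  by apply: complex_eq; rewrite /= /Rintegral integral0.
by apply/funext => p; apply: hB => // -[].
Qed.

Lemma cell_average_ccts u : test_fun sigma u ->
  ccts (fun x => cell_average sigma lambda (@phi R) u x 0 0).
Proof.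
move=> tu; under eq_fun do rewrite cell_averageE.
apply: (int2_param (F := fun x q => inner_integral u (x, q))).
  under eq_fun do rewrite -surjective_pairing; exact: inner_integral_ccts.
move=> x0; have [X X0 nX] := near_box x0; have [_ [M uM]] := tu.
have [B hB] := inner_integral_supp uM X0; exists B.
by apply: filterS nX => x hx q nq; exact: hB.
Qed.

Lemma nice3_integrand u x q : test_fun sigma u -> nice3 (cell_integrand u x q).
Proof.
move=> [su [M uM]]; split.
  apply: (ccts_comp (f := fun p => (x, q, p)) (F := fun z : P8 => cell_integrand u z.1.1 z.1.2 z.2)).
    by cts.
  exact: cell_integrand_ccts.
have [X X0 /nbhs_singleton hx] := near_box x; have [B hB] := cell_integrand_supp uM X0.
by exists B => p np; apply: hB => // -[].
Qed.

Lemma nice2_inner u x : test_fun sigma u -> nice2 (fun q => inner_integral u (x, q)).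
Proof.
move=> tu; split.
  by apply: (ccts_comp (f := fun q => (x, q))); [cts|exact: inner_integral_ccts].
have [_ [M uM]] := tu.
have [X X0 /nbhs_singleton hx] := near_box x; have [B hB] := inner_integral_supp uM X0.
by exists B => q nq; exact: hB.
Qed.

Lemma lin_aux (K : comNzRingType) (a b m n c s t p q : K) :
  a * (m * (c * s + p) + n * (c * t + q)) * b =
  c * (a * (m * s + n * t) * b) + a * (m * p + n * q) * b.
Proof. ring. Qed.

Lemma cell_integrandD (c : C) u v x q p : cell_integrand (fun g => c *: u g + v g) x q p =
  c * cell_integrand u x q p + cell_integrand v x q p.
Proof.
rewrite /cell_integrand; do 3 (rewrite mulr_sumr -big_split /=; apply: eq_bigr => ? _).
have E (a b : 'cV[C]_2) i : (c *: a + b) i 0 = c * a i 0 + b i 0 by rewrite !mxE.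
rewrite !mulmx_col2 !E.
exact: lin_aux.
Qed.

Lemma cell_average_lin c u v x : test_fun sigma u -> test_fun sigma v ->
  cell_average sigma lambda (@phi R) (fun g => c *: u g + v g) x 0 0 =
  c * cell_average sigma lambda (@phi R) u x 0 0 + cell_average sigma lambda (@phi R) v x 0 0.
Proof.
move=> tu tv; rewrite [LHS]cell_averageE.
rewrite [X in _ = c * X + _]cell_averageE [X in _ = _ + X]cell_averageE.
have E q : int3 (cell_integrand (fun g => c *: u g + v g) x q) =
    c * inner_integral u (x, q) + inner_integral v (x, q).
  have nu := nice3_integrand x q tu; have nv := nice3_integrand x q tv.
  rewrite /inner_integral /= -int3Z// -int3D//.
    by congr int3; apply/funext => p; rewrite cell_integrandD.
  have [[cu su] [B hB]] := (nu.1, nu.2); split.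
    by apply: cctsM; [exact: ccts_cst|].
  by exists B => p np; rewrite hB// mulr0.
have -> : (fun q => int3 (cell_integrand (fun g => c *: u g + v g) x q)) =
    (fun q => c * inner_integral u (x, q) + inner_integral v (x, q)).
  exact/funext.
have nu := nice2_inner x tu; have nv := nice2_inner x tv.
rewrite int2D//; last first.
  have [[cu su] [B hB]] := (nu.1, nu.2); split.
    by apply: cctsM; [exact: ccts_cst|].
  by exists B => q nq; rewrite hB// mulr0.
by rewrite int2Z.
Qed.

End CellIntegral.


Section NiceComposition.
Context {R : realType}.
Local Notation C := R[i].

Lemma nice3_comp (phi psi : R * R * R -> R * R * R) (F : R * R * R -> C) :
  continuous phi -> continuous psi -> cancel phi psi -> nice3 F ->
  nice3 (fun p => F (phi p)).
Proof.
move=> cphi cpsi K [cF [B hB]]; split; first exact: (ccts_comp cphi cF).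
have [B1 _ h1] := compact_bound (@compact_box3 R B) (cts_fst (cts_fst cpsi)).
have [B2 _ h2] := compact_bound (@compact_box3 R B) (cts_snd (cts_fst cpsi)).
have [B3 _ h3] := compact_bound (@compact_box3 R B) (cts_snd cpsi).
exists (`|B1| + `|B2| + `|B3|) => p np; apply: hB => hp; apply: np.
have b1 := normr_ge0 B1; have b2 := normr_ge0 B2; have b3 := normr_ge0 B3.
have l1 := ler_norm B1; have l2 := ler_norm B2; have l3 := ler_norm B3.
have := h1 _ hp; have := h2 _ hp; have := h3 _ hp; rewrite K => k3 k2 k1.
by apply/box3P; split; lra.
Qed.

Lemma nice3D (F G : R * R * R -> C) : nice3 F -> nice3 G -> nice3 (fun p => F p + G p).
Proof.
move=> [cF [B hB]] [cG [B' hB']]; split; first exact: cctsD.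
exists (`|B| + `|B'|) => p np; rewrite hB ?hB' ?addr0// => /box3P[h1 h2 h3]; apply: np;
have b := normr_ge0 B; have b' := normr_ge0 B';
have l := ler_norm B; have l' := ler_norm B';
by apply/box3P; split; lra.
Qed.

Lemma nice3Z c (F : R * R * R -> C) : nice3 F -> nice3 (fun p => c * F p).
Proof.
move=> [cF [B hB]]; split; first by apply: cctsM; [exact: ccts_cst|].
by exists B => p np; rewrite hB// mulr0.
Qed.

Lemma nice3_0 : nice3 (fun _ : R * R * R => 0 : C).
Proof. by split; [exact: ccts_cst|exists 0]. Qed.

Lemma int3_0 : int3 (fun _ : R * R * R => 0 : C) = 0.
Proof. by apply: complex_eq; rewrite /= /Rintegral integral0. Qed.

Lemma nice3_sum (I : finType) (F : I -> R * R * R -> C) : (forall i, nice3 (F i)) ->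
  nice3 (fun p => \sum_i F i p) /\ int3 (fun p => \sum_i F i p) = \sum_i int3 (F i).
Proof.
move=> nF; elim: (index_enum I) => [|i r [n1 e1]].
  have -> : (fun p => \sum_(i <- [::]) F i p) = (fun=> 0) by apply/funext => p; rewrite big_nil.
  by rewrite big_nil int3_0; split => //; exact: nice3_0.
have -> : (fun p => \sum_(i <- i :: r) F i p) = (fun p => F i p + \sum_(j <- r) F j p).
  by apply/funext => p; rewrite big_cons.
by rewrite big_cons int3D// e1; split => //; exact: nice3D.
Qed.

End NiceComposition.

(** * Invariance of [tau] under $N$ and equivariance under $\widetilde M A N_-$ *)

Section Tau.
Context {R : realType} (sigma : SL3 R -> SL3 R -> bool).
Hypothesis Hs : BLS_cocycle sigma.
Local Notation C := R[i].
Local Notation gm := (gmul sigma).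
Local Notation gi := (ginv sigma).
Local Notation nm := (nminus sigma).
Local Notation wl := (emb (wlong : SL3 R)).
Local Notation mt := (@mtilde R).
Local Notation cell := (cell sigma).
Variable lambda : 'rV[C]_3.
Local Notation tau := (tau sigma lambda).
Local Notation cell_integrand := (cell_integrand sigma lambda).
Implicit Types (u v : Gt R -> 'cV[C]_2) (x p r : R * R * R) (q : R * R).

(* Weaker than being a test function, and visibly stable under the translations
   by which tau is transformed. *)
Definition cellnice u := forall e1 e2 e q i, nice3 (fun p => u (cell (0, 0, 0) e1 e2 e q p) i 0).

Lemma tauE u : tau u = int2 (fun q => int3 (cell_integrand u (0, 0, 0) q)).
Proof. exact: cell_averageE. Qed.

Definition cell_coef e1 e2 e q i : C :=
  apow (amat q) (- (lambda - rho)) * phi (gi (mt e1 e2 e)) i 0 * apow (amat q) (- (rho *+ 2)).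

Lemma cell_integrandE u x q p : cell_integrand u x q p =
  \sum_(e1 : bool) \sum_(e2 : bool) \sum_(e : bool)
   (cell_coef e1 e2 e q 0 * u (cell x e1 e2 e q p) 0 0 +
    cell_coef e1 e2 e q 1 * u (cell x e1 e2 e q p) 1 0).
Proof.
rewrite /(cell_integrand _ _ _ _); do 3 (apply: eq_bigr => ? _).
rewrite mulmx_col2 mulrDr mulrDl /cell_coef ![_^T 0 _]mxE.
by congr (_ + _); rewrite -!mulrA; congr (_ * (_ * _)); rewrite mulrC.
Qed.

Lemma int3_integrand u q : cellnice u -> int3 (cell_integrand u (0, 0, 0) q) =
  \sum_(e1 : bool) \sum_(e2 : bool) \sum_(e : bool)
   (cell_coef e1 e2 e q 0 * int3 (fun p => u (cell (0, 0, 0) e1 e2 e q p) 0 0) +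
    cell_coef e1 e2 e q 1 * int3 (fun p => u (cell (0, 0, 0) e1 e2 e q p) 1 0)).
Proof.
move=> nu; rewrite (_ : cell_integrand u (0, 0, 0) q = fun p => \sum_(e1 : bool) \sum_(e2 : bool) \sum_(e : bool)
   (cell_coef e1 e2 e q 0 * u (cell (0, 0, 0) e1 e2 e q p) 0 0 +
    cell_coef e1 e2 e q 1 * u (cell (0, 0, 0) e1 e2 e q p) 1 0)); last first.
  by apply/funext => p; exact: cell_integrandE.
have n3 e1 e2 e : nice3 (fun p => cell_coef e1 e2 e q 0 * u (cell (0, 0, 0) e1 e2 e q p) 0 0 +
    cell_coef e1 e2 e q 1 * u (cell (0, 0, 0) e1 e2 e q p) 1 0).
  by apply: nice3D; apply: nice3Z.
have n2 e1 e2 := nice3_sum (n3 e1 e2).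
have n1 e1 := nice3_sum (fun e2 => (n2 e1 e2).1).
rewrite (nice3_sum (fun e1 => (n1 e1).1)).2; apply: eq_bigr => e1 _.
rewrite (n1 e1).2; apply: eq_bigr => e2 _; rewrite (n2 e1 e2).2; apply: eq_bigr => e _.
by rewrite int3D ?int3Z//; exact: nice3Z.
Qed.

(** Over $x=0$ one has $n(r)w_\ell=w_\ell n_-(r)$, and $n_-(r)$ is conjugated past $\widetilde M$
    and $A$ to the last factor. *)
Lemma nmat_cell0 r e1 e2 e q p : gm (emb (nmat r)) (cell (0, 0, 0) e1 e2 e q p) =
  cell (0, 0, 0) e1 e2 e q (nprod (lconj false false q (lconj e1 e2 (0, 0) r)) p).
Proof.
rewrite /(cell _ _ _ _ _ _) /(cell _ _ _ _ _ _) nmat0 (gmulg1 Hs) !(gmulA Hs (emb (nmat r))) -(wlong_nminus Hs).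
rewrite -(gmulA Hs wl) (nminus_mtilde Hs) (gmulA Hs wl).
rewrite -(gmulA Hs _ _ (emb (amat q))) (nminus_amat Hs) (gmulA Hs _ (emb (amat q))).
by rewrite -(gmulA Hs _ _ (nm p)) (nminusM Hs).
Qed.

Lemma cellnice_nmat v r : cellnice v -> cellnice (fun g => v (gm (emb (nmat r)) g)).
Proof.
move=> nv e1 e2 e q i.
rewrite (_ : (fun p => _) = (fun p => v (cell (0, 0, 0) e1 e2 e q
  (nprod (lconj false false q (lconj e1 e2 (0, 0) r)) p)) i 0)); last first.
  by apply/funext => p; rewrite nmat_cell0.
set s := lconj _ _ _ _.
apply: (nice3_comp (phi := nprod s) (psi := nprod (ninv s)) _ _ _ (nv e1 e2 e q i)).
- by rewrite /nprod; cts.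
- by rewrite /nprod; cts.
- by move=> p; rewrite nprodA ninvl nprod0l.
Qed.

Lemma tau_nmat v r : cellnice v -> tau (fun g => v (gm (emb (nmat r)) g)) = tau v.
Proof.
move=> nv; have nv' := cellnice_nmat r nv.
apply: (etrans (tauE _)); apply: (etrans _ (esym (tauE _))).
apply: (congr1 (@int2 R)); apply/funext => q.
rewrite (int3_integrand q nv') (int3_integrand q nv).
apply: eq_bigr => e1 _; apply: eq_bigr => e2 _; apply: eq_bigr => e _.
congr (_ * _ + _ * _).
  rewrite -[RHS](int3_nprodl (lconj false false q (lconj e1 e2 (0, 0) r))).
  by apply: (congr1 (@int3 R)); apply/funext => p; rewrite nmat_cell0.
rewrite -[RHS](int3_nprodl (lconj false false q (lconj e1 e2 (0, 0) r))).
by apply: (congr1 (@int3 R)); apply/funext => p; rewrite nmat_cell0.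
Qed.

(** A translation in the finite group $\widetilde M$ permutes the summands. In these coordinates the
    cocycle lets the shift of the last sign depend on the first two. *)
Lemma sum_shift (F : bool -> bool -> bool -> C) f1 f2 (c : bool -> bool -> bool) :
  \sum_(e1 : bool) \sum_(e2 : bool) \sum_(e : bool) F (e1 (+) f1) (e2 (+) f2) (e (+) c e1 e2) =
  \sum_(e1 : bool) \sum_(e2 : bool) \sum_(e : bool) F e1 e2 e.
Proof.
have inj f : injective (fun e => e (+) f) by case: f => -[] [].
rewrite [RHS](reindex_inj (@inj f1)); apply: eq_bigr => e1 _.
rewrite [RHS](reindex_inj (@inj f2)); apply: eq_bigr => e2 _.
by rewrite [RHS](reindex_inj (@inj (c e1 e2))).
Qed.

Lemma phiM_Mt m m' : Mt m -> Mt m' -> phi (gm m m') = phi m *m phi m'.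
Proof. by move=> [e1 [e2 [e ->]]] [f1 [f2 [f ->]]]; exact: phiM. Qed.

Lemma Mt_ginv m : Mt m -> Mt (gi m).
Proof. by move=> [e1 [e2 [e ->]]]; rewrite (ginv_mtilde Hs); do 3 eexists. Qed.

Lemma lconj0K e1 e2 p : lconj e1 e2 (0, 0) (lconj e1 e2 (0, 0) p) = p.
Proof.
case: p => [[a b] c]; rewrite /lconj /= !addr0 subr0 expR0 !mulr1 !signrMK.
by [].
Qed.

Lemma lconjK q p : lconj false false (- q.1, - q.2) (lconj false false q p) = p.
Proof.
case: p => [[a b] c]; rewrite /lconj /= !mul1r !mulrA -!expRD.
by congr (_, _, _); rewrite -[RHS]mul1r -expR0; congr (expR _ * _); ring.
Qed.

Definition borel_inv f1 f2 f (r : R * R) (s : R * R * R) : Gt R :=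
  gi (gm (gm (mt f1 f2 f) (emb (amat r))) (nm s)).

(** The function [c] collects the sign of the inverse and the cocycle on $\widetilde M$. It depends
    on [e1] and [e2] alone, as [sum_shift] requires, and is the same for the cell as for $\widetilde
    M$. *)
Lemma cell_borel_inv f1 f2 f (r : R * R) s :
  exists c : bool -> bool -> bool, forall x e1 e2 e q p,
  gm (cell x e1 e2 e q p) (borel_inv f1 f2 f r s) =
  cell x (e1 (+) f1) (e2 (+) f2) (e (+) c e1 e2)
    (q.1 - r.1, q.2 - r.2)
    (lconj f1 f2 (0, 0) (lconj false false (- r.1, - r.2) (nprod p (ninv s)))) /\
  gm (mt e1 e2 e) (gi (mt f1 f2 f)) = mt (e1 (+) f1) (e2 (+) f2) (e (+) c e1 e2).
Proof.
exists (fun e1 e2 => f (+) (f1 (+) f2 && (f1 (+) f2)) (+) (e1 && f1 (+) e2 && (f1 (+) f2))).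
move=> x e1 e2 e q p.
rewrite /borel_inv 2!(ginvM Hs) (ginv_nminus Hs) (ginv_amat Hs) (ginv_mtilde Hs).
rewrite (gmulA Hs _ (nm _)) (cell_nminus Hs) (gmulA Hs _ (emb (amat _))) (cell_amat Hs).
by rewrite (cell_mtilde Hs) (mtildeM Hs) -!addbA.
Qed.

Lemma apow_rho2 (r : R * R) : apow (amat r) (- (rho *+ 2)) * (expR (r.1 *+ 4 + r.2 *+ 2))%:C = 1.
Proof.
rewrite apow_amat (_ : (expR _)%:C = cexp ((r.1 *+ 4 + r.2 *+ 2)%:C)); last first.
  by apply: complex_eq; rewrite /cexp /= ?cos0 ?sin0; ring.
rewrite -cexpD -cexp0; congr cexp; rewrite /aexpo !mxE /=.
by apply: complex_eq; rewrite !(Re_add, Im_add, Re_mul, Im_mul) /=; ring.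
Qed.

Lemma int3_borel f1 f2 (r : R * R) (s : R * R * R) (F : R * R * R -> C) :
  int3 (fun p => F (lconj f1 f2 (0, 0) (lconj false false (- r.1, - r.2) (nprod p (ninv s))))) =
  (expR (r.1 *+ 4 + r.2 *+ 2))%:C * int3 F.
Proof.
rewrite (int3_nprodr (ninv s) (fun p => F (lconj f1 f2 (0, 0) (lconj false false (- r.1, - r.2) p)))).
rewrite (int3_lconj false false (- r.1, - r.2) (fun p => F (lconj f1 f2 (0, 0) p))) int3_lconj.
have -> : - ((0 : R, 0 : R).1 *+ 4 + (0 : R, 0 : R).2 *+ 2) = 0 by rewrite /=; ring.
by rewrite expR0 mul1r; congr ((expR _)%:C * _); rewrite /=; ring.
Qed.

Lemma cellnice_borel u f1 f2 f (r : R * R) s : cellnice u ->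
  cellnice (fun g => u (gm g (borel_inv f1 f2 f r s))).
Proof.
move=> nu e1 e2 e q i; have [c hc] := cell_borel_inv f1 f2 f r s.
rewrite (_ : (fun p => _) = (fun p => u (cell (0, 0, 0) (e1 (+) f1) (e2 (+) f2) (e (+) c e1 e2)
    (q.1 - r.1, q.2 - r.2)
    (lconj f1 f2 (0, 0) (lconj false false (- r.1, - r.2) (nprod p (ninv s))))) i 0)); last first.
  by apply/funext => p; have [-> _] := hc (0, 0, 0) e1 e2 e q p.
apply: (nice3_comp
  (phi := fun p => lconj f1 f2 (0, 0) (lconj false false (- r.1, - r.2) (nprod p (ninv s))))
  (psi := fun p => nprod (lconj false false r (lconj f1 f2 (0, 0) p)) s) _ _ _ (nu _ _ _ _ i)).
- by rewrite /lconj /nprod /=; cts.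
- by rewrite /lconj /nprod /=; cts.
- move=> p; rewrite lconj0K; have := lconjK (- r.1, - r.2) (nprod p (ninv s)).
  rewrite /= !opprK -surjective_pairing => ->.
  by rewrite -nprodA ninvl nprod0.
Qed.

Lemma cellnice_mul u (A : 'M[C]_2) : cellnice u -> cellnice (fun g => A *m u g).
Proof.
move=> nu e1 e2 e q i.
rewrite (_ : (fun p => _) = fun p => A i 0 * u (cell (0, 0, 0) e1 e2 e q p) 0 0 +
   A i 1 * u (cell (0, 0, 0) e1 e2 e q p) 1 0).
  by apply: nice3D; apply: nice3Z.
by apply/funext => p; rewrite mulmx_col2.
Qed.

Lemma phi_ginv_mul e1 e2 e f1 f2 f c :
  gm (mt e1 e2 e) (gi (mt f1 f2 f)) = mt (e1 (+) f1) (e2 (+) f2) (e (+) c) ->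
  phi (gi (mt e1 e2 e)) = phi (gi (mt f1 f2 f)) *m phi (gi (mt (e1 (+) f1) (e2 (+) f2) (e (+) c))).
Proof.
move=> E; have mM a b d : Mt (mt a b d) by exists a, b, d.
rewrite -phiM_Mt; [|exact/Mt_ginv/mM|exact/Mt_ginv/mM].
by rewrite -(ginvM Hs) -E (gmulgKV Hs).
Qed.

Lemma mulmx_entry2 (A B : 'M[C]_2) i : (A *m B) i 0 = A i 0 * B 0 0 + A i 1 * B 1 0.
Proof.
rewrite !mxE !big_ord_recl big_ord0 addr0; congr (_ * _ + A _ _ * B _ _); exact/val_inj.
Qed.

(** Here [k] is the Jacobian $a^{2\rho}$ on $N_-$ and [br] the weight $a^{-2\rho}$; they cancel. The
    factor [ar] is the character that survives, and the [m] are the entries of [phi]. *)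
Lemma borel_aux (K : comNzRingType) (a b ar br k m00 m01 m10 m11 c0 c1 u0 u1 : K) :
  br * k = 1 ->
  a * ar * (m00 * c0 + m01 * c1) * (b * br) * (k * u0) +
  a * ar * (m10 * c0 + m11 * c1) * (b * br) * (k * u1) =
  ar * (a * c0 * b * (m00 * u0 + m10 * u1) + a * c1 * b * (m01 * u0 + m11 * u1)).
Proof.
move=> brk; transitivity (br * k * (ar * (a * c0 * b * (m00 * u0 + m10 * u1)
   + a * c1 * b * (m01 * u0 + m11 * u1)))); first by ring.
by rewrite brk mul1r.
Qed.

(** Change of variables in $\widetilde M$, $A$ and $N_-$ together. The first two are translations;
    the third contributes $a^{2\rho}$, which the weight absorbs. The remaining character and value
    of [phi] form the transformation law. The second hypothesis serves to take the character out of
    the integral over $A$. *)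
Lemma tau_borel u f1 f2 f (r : R * R) s : cellnice u ->
  nice2 (fun q => int3 (cell_integrand (fun g => (phi (gi (mt f1 f2 f)))^T *m u g) (0, 0, 0) q)) ->
  tau (fun g => u (gm g (borel_inv f1 f2 f r s))) =
  apow (amat r) (- (lambda - rho)) * tau (fun g => (phi (gi (mt f1 f2 f)))^T *m u g).
Proof.
move=> nu nw; have [c hc] := cell_borel_inv f1 f2 f r s.
set m0 := phi (gi (mt f1 f2 f)).
rewrite [X in _ = _ * X]tauE -int2Z// -[RHS](int2_translate (- r.1) (- r.2)).
apply: (etrans (tauE _)); apply: (congr1 (@int2 R)); apply/funext => q /=.
rewrite (int3_integrand q (cellnice_borel f1 f2 f r s nu)).
rewrite (int3_integrand _ (cellnice_mul m0^T nu)).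
rewrite -[X in _ = _ * X](sum_shift _ f1 f2 c) !mulr_sumr; apply: eq_bigr => e1 _.
rewrite mulr_sumr; apply: eq_bigr => e2 _; rewrite mulr_sumr; apply: eq_bigr => e _.
set E1 := e1 (+) f1; set E2 := e2 (+) f2; set E3 := e (+) c e1 e2.
pose q' := (q.1 - r.1, q.2 - r.2).
have I i : int3 (fun p => u (gm (cell (0, 0, 0) e1 e2 e q p) (borel_inv f1 f2 f r s)) i 0) =
    (expR (r.1 *+ 4 + r.2 *+ 2))%:C * int3 (fun p => u (cell (0, 0, 0) E1 E2 E3 q' p) i 0).
  rewrite -(int3_borel f1 f2 r s); apply: (congr1 (@int3 R)); apply/funext => p.
  by have [-> _] := hc (0, 0, 0) e1 e2 e q p.
have W i : int3 (fun p => (m0^T *m u (cell (0, 0, 0) E1 E2 E3 q' p)) i 0) =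
    m0 0 i * int3 (fun p => u (cell (0, 0, 0) E1 E2 E3 q' p) 0 0) +
    m0 1 i * int3 (fun p => u (cell (0, 0, 0) E1 E2 E3 q' p) 1 0).
  rewrite -!int3Z// -int3D; [|exact: nice3Z|exact: nice3Z].
  apply: (congr1 (@int3 R)); apply/funext => p.
  by rewrite mulmx_col2 ![_^T _ _]mxE.
rewrite !I !W /cell_coef.
have [_ E] := hc (0, 0, 0) e1 e2 e q (0, 0, 0).
rewrite (phi_ginv_mul E) -/m0 -/E1 -/E2 -/E3 !mulmx_entry2.
have Aq mu : apow (amat q) mu = apow (amat q') mu * apow (amat r) mu.
  rewrite (_ : q = (q'.1 + r.1, q'.2 + r.2)); first exact: apow_amatD.
  by rewrite /q' /= !subrK -surjective_pairing.
rewrite !Aq.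
rewrite -[(q.1 - r.1, q.2 - r.2)]/q'.
by apply: (@borel_aux C); exact: apow_rho2.
Qed.

Lemma test_cellnice u : test_fun sigma u -> cellnice u.
Proof.
move=> [su [M uM]] e1 e2 e q i; split.
  apply: (ccts_comp (f := fun p : R * R * R => ((0 : R, 0 : R, 0 : R), q, p))
    (F := fun z : (R * R * R) * (R * R) * (R * R * R) => u (cell z.1.1 e1 e2 e z.1.2 z.2) i 0)).
    by cts.
  exact: smooth_cell_ccts.
have [B hB] := cell_bound sigma M (lexx 0); exists B => p np.
have [h|h] := pselect (exists i j, M < `|slmx (cell (0, 0, 0) e1 e2 e q p).1 i j|).
  by rewrite uM// mxE.
have := hB (0, 0, 0) e1 e2 e q p; rewrite /= normr0 => /(_ (And3 (lexx _) (lexx _) (lexx _))).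
case=> // k l; rewrite leNgt; apply/negP => hk; apply: h; by exists k, l.
Qed.

End Tau.


(** * The coefficient as a multiple of tau *)

Section IdentityCell.
Context {R : realType}.

(** The unit $-1$ is excluded because $4$ does not divide $-2$. *)
Lemma int_unit_mod4 (x y : int) : x * y = 1 -> (4 %| x - 1)%Z -> x = 1.
Proof.
move=> /(congr1 absz)/eqP; rewrite abszM muln_eq1 => /andP[/eqP x1 _].
by case: x x1 => [[|[|n]]|[|n]].
Qed.

Lemma Gamma_borel : Gamma `&` Bgrp = Gamma_inf :> set (SL3 R).
Proof.
have row3 (P : 'I_3 -> Prop) : P 0 -> P 1 -> P 2 -> forall i, P i.
  move=> p0 p1 p2; case=> [[|[|[|//]]] hi]; [move: p0|move: p1|move: p2];
  by congr P; exact/val_inj.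
apply/seteqP; split => [c [[z [cz z4 z1]] cB]|c [[p _ <-] [z pz]]].
  have cE i j : slmx c i j = (z i j)%:~R by rewrite cz mxE.
  have z0 (i j : 'I_3) : (j < i)%N -> z i j = 0.
    by move=> ji; have := cB i j ji; rewrite cE => /eqP; rewrite intr_eq0 => /eqP.
  have zd : z 0 0 * (z 1 1 * z 2 2) = 1.
    apply: (@intr_inj R); rewrite !rmorphM /=.
    have := svalP c; rewrite -/(slmx c) (slmx_mx3 c) det_mx3 !cE.
    rewrite (z0 1 0)// (z0 2 0)// (z0 2 1)// !(mulr0z, mulr0, subr0, mul0r, addr0).
    by move/eqP.
  have d0 := int_unit_mod4 zd (z1 0).
  have d1 : z 1 1 = 1.
    by apply: (@int_unit_mod4 _ (z 0 0 * z 2 2)); [rewrite mulrCA|exact: z1].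
  have d2 : z 2 2 = 1.
    by apply: (@int_unit_mod4 _ (z 0 0 * z 1 1)); [rewrite -zd; ring|exact: z1].
  split; last by exists z.
  exists ((z 0 1)%:~R, (z 1 2)%:~R, (z 0 2)%:~R) => //.
  apply: slmx_inj; rewrite [RHS]slmx_mx3 !cE.
  by rewrite (z0 1 0)// (z0 2 0)// (z0 2 1)// d0 d1 d2.
have zE i j (k : int) : slmx (nmat p) i j = k%:~R -> z i j = k.
  by rewrite pz mxE => /intr_inj.
have [z00 z11 z22] : [/\ z 0 0 = 1, z 1 1 = 1 & z 2 2 = 1].
  by split; apply: zE; rewrite mx3E.
have [z10 z20 z21] : [/\ z 1 0 = 0, z 2 0 = 0 & z 2 1 = 0].
  by split; apply: zE; rewrite mx3E.
split.
  exists z; split => //; last by apply: (row3); rewrite ?z00 ?z11 ?z22.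
  by apply: (row3); apply: (row3) => //= _; rewrite ?z10 ?z20 ?z21.
by apply: (row3); apply: (row3) => //= _; rewrite mx3E.
Qed.

Lemma Gamma_inf1 : Gamma_inf (sl1 : SL3 R).
Proof.
split; first by exists (0, 0, 0) => //; rewrite nmat0.
by exists 1%:M; rewrite map_mx1.
Qed.

Lemma cosets_Gamma_inf : cosets = [set Gamma_inf] :> set (set (SL3 R)).
Proof.
have mulG (p q : R * R * R) : Gamma_inf (nmat p) -> Gamma_inf (nmat q) ->
    Gamma_inf (slmul (nmat p) (nmat q)).
  move=> [_ [z hz]] [_ [y hy]]; split; first by rewrite nmatM; exists (nprod p q).
  by exists (z *m y); rewrite /= map_mxM /= -hz -hy.
have invG (p : R * R * R) : Gamma_inf (nmat p) -> Gamma_inf (nmat (ninv p)).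
  move=> [_ [z hz]]; split; first by exists (ninv p).
  have e i j : p = p -> slmx (nmat p) i j = (z i j)%:~R by rewrite hz mxE.
  have [x y w] : [/\ p.1.1 = (z 0 1)%:~R, p.1.2 = (z 1 2)%:~R & p.2 = (z 0 2)%:~R].
    by split; rewrite -e// mx3E.
  exists (mx3 1 (- z 0 1) (z 0 1 * z 1 2 - z 0 2) 0 1 (- z 1 2) 0 0 1).
  rewrite /ninv x y w; apply/matrixP => i j; rewrite !mxE.
  case: i => [[|[|[|//]]] hi]; case: j => [[|[|[|//]]] hj] //=;
  by rewrite ?mulrNz ?intrB ?intrM.
rewrite /cosets Gamma_borel; apply/seteqP; split => [D [c hc ->]|D ->] /=.
  apply/seteqP; split => [_ [n hn <-]|g hg].
    by have [[[p _ pc] _] [[q _ qn] _]] := (hc, hn); rewrite -qn -pc; apply: mulG; rewrite ?qn ?pc.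
  have [[[p _ pc] _] [[q _ qg] _]] := (hc, hg).
  exists (slmul (nmat q) (nmat (ninv p))).
    by apply: mulG; rewrite ?qg//; apply: invG; rewrite pc.
  by rewrite -pc -slmulA nmatM ninvl nmat0 slmulg1.
exists sl1; last by apply/seteqP; split => [g hg|_ [n hn <-]]; [exists g => //|]; rewrite slmulg1.
exact: Gamma_inf1.
Qed.

Lemma Gamma_inf_xget : Gamma_inf (xget sl1 (Gamma_inf : set (SL3 R))).
Proof.
by apply: xgetPex; exists sl1; exact: Gamma_inf1.
Qed.

Definition cube : set (R * R * R) :=
  [set p | [/\ 0 <= p.1.1 < 1, 0 <= p.1.2 < 1 & 0 <= p.2 < 1]].

Lemma cubeE : cube = (`[0, 1[%classic `*` `[0, 1[%classic) `*` `[0, 1[%classic.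
Proof.
apply/seteqP; split => p; rewrite /cube /= !in_itv /=; first by case=> -> -> ->.
by move=> [[-> ->] ->].
Qed.

Lemma measurable_cube : measurable cube.
Proof.
rewrite cubeE; apply: measurableX; last exact: measurable_itv.
by apply: measurableX; exact: measurable_itv.
Qed.

Lemma cube_box3 : cube `<=` box3 1.
Proof.
have h (t : R) : 0 <= t < 1 -> `|t| <= 1 by move=> /andP[t0 t1]; rewrite ger0_norm// ltW.
by move=> p [h1 h2 h3]; apply/box3P; split; exact: h.
Qed.

Lemma psi_ccts m1 m2 : ccts (psi m1 m2 : R * R * R -> R[i]).
Proof. by apply: ccts_cexp; split => /=; cts. Qed.

Lemma cube_integrable (f : R * R * R -> R) : continuous f ->
  ((@lebesgue_measure R \x @lebesgue_measure R) \x @lebesgue_measure R)%E.-integrable cube (EFin \o f).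
Proof.
move=> cf; have [B _ hB] := compact_bound (@compact_box3 R 1) cf.
apply: measurable_bounded_integrable.
- exact: measurable_cube.
- apply: le_lt_trans (mu_box3_fin 1).
  apply: (@le_measure _ _ _ ((@lebesgue_measure R \x @lebesgue_measure R) \x @lebesgue_measure R)%E); rewrite ?inE.
  + exact: measurable_cube.
  + exact: measurable_box3.
  + exact: cube_box3.
- by apply: measurable_funTS; exact: continuous_measurable3.
- exists B; split; first exact: num_real.
  by move=> M BM p /cube_box3 hp; exact: le_trans (hB p hp) (ltW BM).
Qed.

Lemma psi_integrable m1 m2 :
  cintegrable ((@lebesgue_measure R \x @lebesgue_measure R) \x @lebesgue_measure R)%E
    cube (psi m1 m2).
Proof. by have [c1 c2] := psi_ccts m1 m2; split; exact: cube_integrable. Qed.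

Lemma int_quotientZ (c : R[i]) m1 m2 :
  int_quotient (fun p : R * R * R => c * psi m1 m2 p) = c * int_quotient (psi m1 m2).
Proof. apply: cintZ; [exact: measurable_cube|exact: psi_integrable]. Qed.

End IdentityCell.

Section Coefficient.
Context {R : realType} (sigma : SL3 R -> SL3 R -> bool).
Hypothesis Hs : BLS_cocycle sigma.
Variables (s : SL3 R -> bool) (lambda : 'rV[R[i]]_3).
Hypothesis ss : splitting sigma s.
Implicit Types (u : Gt R -> 'cV[R[i]]_2).

(** The representative that [xget] selects is unspecified, but it lies in [Gamma_inf]: its sign
    under [s] is trivial, and [tau] does not see translation by it. *)
Lemma E_id_tau u : cellnice sigma u -> E_id sigma lambda s u = tau sigma lambda u.
Proof.
move=> nu; rewrite /E_id cosets_Gamma_inf fsbig_set1.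
have := @Gamma_inf_xget R; set c := xget _ _ => hc; have [[p _ pc] _] := hc.
rewrite ss.2; last by rewrite Gamma_borel.
rewrite /pi_dist /pi_fun (ginvK Hs) -pc (ginv_nmat Hs).
exact: (tau_nmat Hs).
Qed.

Lemma E_id_coeffE u m1 m2 : cellnice sigma u ->
  E_id_coeff sigma lambda s m1 m2 u = int_quotient (@psi R m1 m2) * tau sigma lambda u.
Proof.
move=> nu; rewrite mulrC -int_quotientZ /E_id_coeff.
congr int_quotient; apply/funext => p; congr (_ * _).
rewrite /pi_dist /pi_fun (ginvK Hs) (ginv_nmat Hs) E_id_tau; first exact: (tau_nmat Hs).
exact: (cellnice_nmat Hs).
Qed.

End Coefficient.


Section SmoothLinear.
Context {R : realType} (sigma : SL3 R -> SL3 R -> bool).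
Local Notation C := R[i].

(** Concerns arbitrary functions of class [Ck], which need not belong to [Sm]; hence the induction
    on the order. *)
Lemma Ck_lin k (a b : R) (f g : 'rV[R]_8 -> R) : Ck k f -> Ck k g ->
  Ck k (fun p => a * f p + b * g p).
Proof.
elim: k f g => [|k IH] f g /= [cf df] [cg dg].
  by split=> //; cts.
split; first by cts.
move=> j; have [df1 df2] := df j; have [dg1 dg2] := dg j.
have E p : is_derive p (delta_mx 0 j) (fun p => a * f p + b * g p)
    (a * 'D_(delta_mx 0 j) f p + b * 'D_(delta_mx 0 j) g p).
  have ef := derivableP (df1 p); have eg := derivableP (dg1 p).
  exact: (is_deriveD (f := a \*: f) (g := b \*: g)).
split; first by move=> p; have := E p.
rewrite (_ : (fun p => _) = fun p => a * 'D_(delta_mx 0 j) f p + b * 'D_(delta_mx 0 j) g p).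
  exact: IH.
by apply/funext => p; have [_] := E p.
Qed.

Lemma Cinfty_lin (a b : R) (f g : 'rV[R]_8 -> R) : Cinfty f -> Cinfty g ->
  Cinfty (fun p => a * f p + b * g p).
Proof. by move=> cf cg k; exact: Ck_lin. Qed.

Lemma Cinfty_ext (f g : 'rV[R]_8 -> R) : g =1 f -> Cinfty f -> Cinfty g.
Proof. by move=> /funext ->. Qed.

Lemma test_mul (A : 'M[C]_2) u : test_fun sigma u -> test_fun sigma (fun g => A *m u g).
Proof.
move=> [su [M uM]]; split; last by exists M => g hg; rewrite uM// mulmx0.
move=> g i; have [r0 i0] := su g 0; have [r1 i1] := su g 1.
have := Cinfty_lin 1 1 (Cinfty_lin (complex.Re (A i 0)) (- complex.Im (A i 0)) r0 i0)
  (Cinfty_lin (complex.Re (A i 1)) (- complex.Im (A i 1)) r1 i1).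
have := Cinfty_lin 1 1 (Cinfty_lin (complex.Im (A i 0)) (complex.Re (A i 0)) r0 i0)
  (Cinfty_lin (complex.Im (A i 1)) (complex.Re (A i 1)) r1 i1).
move=> h2 h1; split.
  by apply: Cinfty_ext h1 => p /=; rewrite mulmx_col2 Re_add !Re_mul; ring.
by apply: Cinfty_ext h2 => p /=; rewrite mulmx_col2 Im_add !Im_mul; ring.
Qed.

End SmoothLinear.

(** * Continuity of [tau] in the supremum norm *)

Section TauBound.
Context {R : realType} (sigma : SL3 R -> SL3 R -> bool).
Hypothesis Hs : BLS_cocycle sigma.
Local Notation C := R[i].
Variable lambda : 'rV[C]_3.
Implicit Types (u : Gt R -> 'cV[C]_2) (x p r : R * R * R) (q : R * R).

Definition norm1 (z : C) : R := `|complex.Re z| + `|complex.Im z|.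

Lemma norm_le_norm1 (z : C) : `|z| <= (norm1 z)%:C.
Proof.
rewrite normc_def lecR /norm1; set a := complex.Re z; set b := complex.Im z.
have p : 0 <= `|a| + `|b| by rewrite addr_ge0.
rewrite -[leRHS]ger0_norm// -sqrtr_sqr ler_wsqrtr// -(real_normK (num_real a)) -(real_normK (num_real b)).
by rewrite sqrrD lerD2r lerDl mulrn_wge0// mulr_ge0.
Qed.

Lemma ReIm_le_norm (z : C) (K : R) : `|z| <= K%:C -> 0 <= K /\ ReIm_le K z.
Proof.
rewrite normc_def lecR => h; split; first exact: le_trans (sqrtr_ge0 _) h.
by split; apply: le_trans h; rewrite -sqrtr_sqr ler_wsqrtr// ?lerDl ?lerDr sqr_ge0.
Qed.

Lemma ReIm_leD a b (x y : C) : ReIm_le a x -> ReIm_le b y -> ReIm_le (a + b) (x + y).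
Proof.
by move=> [x1 x2] [y1 y2]; split; rewrite ?Re_add ?Im_add (le_trans (ler_normD _ _))// lerD.
Qed.

Lemma ReIm_leM a (c x : C) : ReIm_le a x -> ReIm_le (norm1 c * a) (c * x).
Proof.
by move=> [x1 x2]; split; rewrite ?Re_mul ?Im_mul mulrDl (le_trans (ler_normD _ _))// ?normrN;
  rewrite !normrM lerD// ler_wpM2l.
Qed.

Lemma ReIm_le_sum (I : finType) (a : I -> R) (F : I -> C) :
  (forall i, ReIm_le (a i) (F i)) -> ReIm_le (\sum_i a i) (\sum_i F i).
Proof.
move=> h; elim/big_ind2 : _ => //; first by split; rewrite normr0.
by move=> x1 x2 y1 y2; exact: ReIm_leD.
Qed.

Lemma ReIm_le_wk a b (x : C) : a <= b -> ReIm_le a x -> ReIm_le b x.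
Proof. by move=> ab [x1 x2]; split; exact: le_trans ab. Qed.

Definition coef_bound q : R := \sum_(e1 : bool) \sum_(e2 : bool) \sum_(e : bool)
  (norm1 (cell_coef sigma lambda e1 e2 e q 0) + norm1 (cell_coef sigma lambda e1 e2 e q 1)).

Lemma cts_sum (T : topologicalType) (I : finType) (F : I -> T -> R) :
  (forall i, continuous (F i)) -> continuous (fun t => \sum_i F i t).
Proof.
move=> cF; elim: (index_enum I) => [|i r IH].
  by apply: (cts_eq (fun t => big_nil _ _ _ _)); exact: cts_cst.
by apply: (cts_eq (fun t => big_cons _ _ _ _ _ _)); apply: ctsD.
Qed.

Lemma coef_bound_cts : continuous coef_bound.
Proof.
have cc e1 e2 e i : continuous (fun q => norm1 (cell_coef sigma lambda e1 e2 e q i)).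
  have [c1 c2] : ccts (fun q => cell_coef sigma lambda e1 e2 e q i).
    apply: cctsM; last by apply: ccts_apow; cts.
    by apply: cctsM; [apply: ccts_apow; cts|exact: ccts_cst].
  have cn (f : R * R -> R) : continuous f -> continuous (fun t => `|f t|).
    by move=> cf t; apply: cvg_norm; exact: cf.
  by rewrite /norm1; apply: ctsD; apply: cn.
by rewrite /coef_bound; do 3 (apply: cts_sum => ?); apply: ctsD.
Qed.

Lemma integrand_bound u K q p : (forall g i, ReIm_le K (u g i 0)) ->
  ReIm_le (coef_bound q * K) (cell_integrand sigma lambda u (0, 0, 0) q p).
Proof.
move=> uK; rewrite cell_integrandE /coef_bound mulr_suml.
do 3 (apply: ReIm_le_sum => ?; rewrite ?mulr_suml).
by rewrite mulrDl; apply: ReIm_leD; apply: ReIm_leM.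
Qed.

(** By [cell_bound] the integrand lives on a box that depends on [M] only. There the weights are
    bounded by compactness, so the supremum norm of [u] suffices. *)
Lemma tau_bound (M : R) : exists2 c : R, 0 <= c & forall u (K : R), test_fun sigma u -> supp_in M u ->
  (forall g i, `|u g i 0| <= K%:C) -> `|tau sigma lambda u| <= (c * K)%:C.
Proof.
have [B hB] := cell_bound sigma M (lexx 0).
have x0 : [/\ `|(0 : R, 0 : R, 0 : R).1.1| <= 0, `|(0 : R, 0 : R, 0 : R).1.2| <= 0 & `|(0 : R, 0 : R, 0 : R).2| <= 0].
  by rewrite /= normr0.
have supp u q p : supp_in M u -> ~ (box2 B q /\ box3 B p) -> cell_integrand sigma lambda u (0, 0, 0) q p = 0.
  move=> uM nb; apply: cell_integrand_eq0 => e1 e2 e.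
  have [h|h] := pselect (exists i j, M < `|slmx (cell sigma (0, 0, 0) e1 e2 e q p).1 i j|); first exact: uM.
  case: nb; apply: (hB (0, 0, 0) e1 e2 e) => // i j; rewrite leNgt; apply/negP => k.
  by apply: h; exists i, j.
have [c0 c00 hc0] := compact_bound (@compact_box2 R B) coef_bound_cts.
pose mu := @lebesgue_measure R.
pose V3 := fine (((mu \x mu) \x mu)%E (box3 B)); pose V2 := fine ((mu \x mu)%E (box2 B)).
(* A bound for the weights times the volumes of the two boxes, doubled because real and imaginary
   parts are estimated separately. *)
exists ((c0 * V3 * V2) *+ 2).
  by rewrite mulrn_wge0// !mulr_ge0// /V2 /V3 fine_ge0//; exact: measure_ge0.
move=> u K tu uM uK.
have [K0 _] := ReIm_le_norm (uK (emb sl1) 0).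
have b3 q p : ReIm_le (c0 * K) (cell_integrand sigma lambda u (0, 0, 0) q p).
  have [bq|nb] := pselect (box2 B q); last first.
    by rewrite supp//; [split; rewrite normr0 mulr_ge0|case].
  apply: (ReIm_le_wk (a := coef_bound q * K)).
    by rewrite ler_wpM2r// (le_trans (ler_norm _))// hc0.
  by apply: integrand_bound => g i; have [] := ReIm_le_norm (uK g i).
have b2 q : ReIm_le (c0 * K * V3) (inner_integral sigma lambda u ((0, 0, 0), q)).
  apply: int3_bound; [exact: nice3_integrand| |exact: b3].
  by move=> p np; apply: supp => // -[].
have b1 : ReIm_le (c0 * K * V3 * V2) (tau sigma lambda u).
  rewrite tauE; apply: int2_bound; [exact: nice2_inner| |exact: b2].
  move=> q nq; rewrite (_ : cell_integrand _ _ _ _ _ = fun=> 0) ?int3_0//.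
  by apply/funext => p; apply: supp => // -[].
apply: le_trans (norm_le_norm1 _) _; rewrite lecR /norm1.
have [h1 h2] := b1.
rewrite (_ : _ * K = c0 * K * V3 * V2 + c0 * K * V3 * V2); first exact: lerD.
ring.
Qed.

End TauBound.


Section CoefficientDistribution.
Context {R : realType} (sigma : SL3 R -> SL3 R -> bool).
Hypothesis Hs : BLS_cocycle sigma.
Variables (s : SL3 R -> bool) (lambda : 'rV[R[i]]_3).
Hypothesis ss : splitting sigma s.

Lemma cellnice_lin (c : R[i]) u v : test_fun sigma u -> test_fun sigma v ->
  cellnice sigma (fun g => c *: u g + v g).
Proof.
move=> tu tv e1 e2 e q i.
rewrite (_ : (fun p => _) = fun p => c * u (cell sigma (0, 0, 0) e1 e2 e q p) i 0
  + v (cell sigma (0, 0, 0) e1 e2 e q p) i 0).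
  by apply: nice3D; [apply: nice3Z|]; apply: test_cellnice.
by apply/funext => p; rewrite !mxE.
Qed.

Lemma E_id_coeff_Vdist m1 m2 : Vdist sigma lambda (@phi R) (E_id_coeff sigma lambda s m1 m2).
Proof.
have tE u : test_fun sigma u -> E_id_coeff sigma lambda s m1 m2 u =
    int_quotient (@psi R m1 m2) * tau sigma lambda u.
  by move=> tu; apply: E_id_coeffE => //; exact: test_cellnice.
split; first split.
- move=> c u v tu tv; rewrite (E_id_coeffE Hs lambda ss); last exact: cellnice_lin.
  rewrite !tE// (_ : tau sigma lambda (fun g => c *: u g + v g) =
    c * tau sigma lambda u + tau sigma lambda v); last exact: cell_average_lin.
  by rewrite mulrDr mulrCA.
- move=> M; have [c c0 hc] := tau_bound Hs lambda M.
  (* Order $0$: the condition on derivatives is used only for the empty list. *)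
  exists (norm1 (int_quotient (@psi R m1 m2)) * c), 0%N => u K tu uM hK.
  rewrite tE// normrM -mulrA rmorphM ler_pM//; first exact: norm_le_norm1.
  by apply: hc => // g i; exact: (hK [::] g i).
- move=> m a n u [f1 [f2 [f ->]]] /Agrp_amat[r ->] [_ [_ [t _ <-] <-] <-] tu.
  have nu := test_cellnice Hs tu.
  rewrite (E_id_coeffE Hs lambda ss); last exact: (cellnice_borel Hs f1 f2 f r t nu).
  rewrite (E_id_coeffE Hs lambda ss); last exact: cellnice_mul.
  rewrite mulrCA; congr (_ * _).
  by apply: tau_borel => //; apply: (@nice2_inner R sigma Hs lambda _ (0, 0, 0)); exact: test_mul.
Qed.

End CoefficientDistribution.


(** * Smooth approximations of tau *)

Section ComplexSm.
Context {R : realType}.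
Local Notation C := R[i].
Implicit Type U : set 'rV[R]_8.

Definition CSm U (F : 'rV[R]_8 -> C) :=
  Sm U (fun P => complex.Re (F P)) /\ Sm U (fun P => complex.Im (F P)).

Lemma CSm_cst U c : CSm U (fun _ => c).
Proof. by split; exact: Sm_cst. Qed.

Lemma CSm_real U f : Sm U f -> CSm U (fun P => (f P)%:C).
Proof. by move=> Sf; split => //=; exact: Sm_cst. Qed.

Lemma CSmD U F G : CSm U F -> CSm U G -> CSm U (fun P => F P + G P).
Proof.
move=> [F1 F2] [G1 G2]; split.
  by apply: (Sm_ext (fun P _ => esym (Re_add (F P) (G P)))); exact: SmD.
by apply: (Sm_ext (fun P _ => esym (Im_add (F P) (G P)))); exact: SmD.
Qed.

Lemma CSmM U F G : CSm U F -> CSm U G -> CSm U (fun P => F P * G P).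
Proof.
move=> [F1 F2] [G1 G2]; split.
  by apply: (Sm_ext (fun P _ => esym (Re_mul (F P) (G P)))); apply: SmB; exact: SmM.
by apply: (Sm_ext (fun P _ => esym (Im_mul (F P) (G P)))); apply: SmD; exact: SmM.
Qed.

Lemma CSm_apow U (q1 q2 : 'rV[R]_8 -> R) mu : Sm U q1 -> Sm U q2 ->
  CSm U (fun P => apow (amat (q1 P, q2 P)) mu).
Proof.
move=> S1 S2.
have [e1 e2] : CSm U (fun P => aexpo (q1 P, q2 P) mu).
  rewrite /aexpo; apply: CSmD; first apply: CSmD.
  - by apply: CSmM; [exact: CSm_cst|exact: CSm_real].
  - by apply: CSmM; [exact: CSm_cst|exact: CSm_real].
  - by apply: CSmM; [exact: CSm_cst|apply: CSm_real; apply: SmB => //; exact: SmN].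
have [c1 c2] : CSm U (fun P => cexp (aexpo (q1 P, q2 P) mu)).
  apply: CSmM; first by apply: CSm_real; exact: Sm_expR.
  by split; [exact: Sm_cos|exact: Sm_sin].
by split; [apply: Sm_ext c1|apply: Sm_ext c2] => P _; rewrite apow_amat.
Qed.

Definition nrm3 (x : R * R * R) : R := x.1.1 * x.1.1 + x.1.2 * x.1.2 + x.2 * x.2.

(** The parameter [r] is the square of the radius of the supporting ball. *)
Definition bump3 (r : R) (x : R * R * R) : R := flat 1 (r - nrm3 x).

Lemma flat_ge0 (t : R) : 0 <= flat 1 t.
Proof.
rewrite /flat; case: ifP => // _; rewrite hornerC mul1r; exact: expR_ge0.
Qed.

Lemma flat_gt0 (t : R) : 0 < t -> 0 < flat 1 t.
Proof. by move=> t0; rewrite /flat t0 hornerC mul1r expR_gt0. Qed.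

Lemma flat_eq0 (p : {poly R}) (t : R) : t <= 0 -> flat p t = 0.
Proof. by move=> t0; rewrite /flat ltNge t0. Qed.

Lemma cts_flat (X : topologicalType) (f : X -> R) : continuous f ->
  continuous (fun x => flat 1 (f x)).
Proof.
move=> cf; apply: (cts_comp cf) => t.
by have [/derivable1_diffP/differentiable_continuous cg _] := is_derive_flat 1 t.
Qed.

Lemma cts_bump3 r : continuous (bump3 r).
Proof. by apply: cts_flat; rewrite /nrm3; cts. Qed.

Lemma Sm_bump3 U r x1 x2 x3 : Sm U x1 -> Sm U x2 -> Sm U x3 ->
  Sm U (fun P => bump3 r (x1 P, x2 P, x3 P)).
Proof.
move=> S1 S2 S3; apply: Sm_flat; apply: SmB; first exact: Sm_cst.
by rewrite /nrm3 /=; do !apply: SmD => //; exact: SmM.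
Qed.

End ComplexSm.

Section CellSection.
Context {R : realType} (sigma : SL3 R -> SL3 R -> bool).
Hypothesis Hs : BLS_cocycle sigma.
Local Notation C := R[i].
Local Notation gm := (gmul sigma).
Local Notation gi := (ginv sigma).
Local Notation wl := (emb (wlong : SL3 R)).
Local Notation mt := (@mtilde R).
Local Notation cell := (cell sigma).
Variable lambda : 'rV[C]_3.
Implicit Types (chi : R * R * R -> C) (u f : Gt R -> 'cV[C]_2).

(** The first column of $\phi(m^{-1})$ is $\phi(m^{-1})e_1$. The formula is forced by the
    transformation law and the values $\chi(x)e_1$ on $w_\ell N$. *)
Definition cell_section chi := cellfun sigma (fun e1 e2 e x q _ =>
  chi x *: (apow (amat q) (- (lambda - rho)) *: col 0 (phi (gi (mt e1 e2 e))))).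

Lemma scale_col_mulmx (x a b : C) (A B : 'M[C]_2) :
  x *: ((a * b) *: col 0 (A *m B)) = b *: (A *m (x *: (a *: col 0 B))).
Proof.
rewrite !colE -mulmxA -!scalemxAr !scalerA; congr (_ *: _); ring.
Qed.

Lemma incell_cell x e1 e2 e q p : incell (cell x e1 e2 e q p).1.
Proof. by have [[]] := coords_cell sigma x e1 e2 e q p. Qed.

Lemma incell_borel g m a n : Mt m -> Agrp a -> Nmt sigma n ->
  incell (gm (gm (gm g m) (emb a)) n).1 = incell g.1.
Proof.
move=> [f1 [f2 [f ->]]] /Agrp_amat[r ->] [_ [_ [t _ <-] <-] <-].
apply/idP/idP => /(cell_coords sigma); last first.
  move=> ->; rewrite (cell_mtilde Hs) (cell_amat Hs) (cell_nminus Hs).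
  exact: incell_cell.
set h := gm _ _; have [c hc] := cell_borel_inv Hs f1 f2 f r t.
have -> : g = gm h (borel_inv sigma f1 f2 f r t).
  by rewrite /h /borel_inv -!(gmulA Hs g) (gmulgV sigma) (gmulg1 Hs).
move: (cx _) (ce1 _) => x e1; move=> ->.
have [-> _] := hc x e1 (ce2 h.1) (ceps sigma h) (cq h.1) (cp h.1).
exact: incell_cell.
Qed.

Lemma cell_section_equivariant chi g m a n : Mt m -> Agrp a -> Nmt sigma n ->
  cell_section chi (gm (gm (gm g m) (emb a)) n) =
  apow a (- (lambda - rho)) *: (phi (gi m) *m cell_section chi g).
Proof.
move=> hm ha hn; have [gc|ngc] := boolP (incell g.1); last first.
  by rewrite /cell_section /cellfun incell_borel// (negPf ngc) mulmx0 scaler0.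
have := cell_coords sigma gc.
move: (cx _) (ce1 _) (ce2 _) (ceps _ _) (cq _) (cp _) => x e1 e2 e q p -> {gc g}.
case: hm => [f1 [f2 [f ->]]]; case/Agrp_amat: ha => r ->; case: hn => _ [_ [t _ <-] <-] <-.
rewrite (cell_mtilde Hs) (cell_amat Hs) (cell_nminus Hs) /cell_section !cellfun_cell.
rewrite -(mtildeM Hs) (ginvM Hs) phiM_Mt//; last 2 first.
- by apply: Mt_ginv => //; exists f1, f2, f.
- by apply: Mt_ginv => //; exists e1, e2, e.
rewrite apow_amatD; exact: scale_col_mulmx.
Qed.

Lemma cell_section_Vsmooth (c : C) r :
  Vsmooth sigma lambda (@phi R) (cell_section (fun x => c * (bump3 r x)%:C)).
Proof.
split; last by move=> g m a n hm ha hn; exact: cell_section_equivariant.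
apply: (cellfun_smooth Hs (r := r)); last first.
  move=> e1 e2 e x q p hx.
  by rewrite /bump3 flat_eq0 ?mulr0 ?scale0r// subr_le0.
move=> U e1 e2 e i x1 x2 x3 q1 q2 p1 p2 p3 S1 S2 S3 T1 T2 _ _ _ F.
have : CSm U (fun P => (c * (bump3 r (x1 P, x2 P, x3 P))%:C) *
    (apow (amat (q1 P, q2 P)) (- (lambda - rho)) * phi (gi (mt e1 e2 e)) i 0)).
  apply: CSmM; apply: CSmM.
  - exact: CSm_cst.
  - by apply: CSm_real; exact: Sm_bump3.
  - exact: CSm_apow.
  - exact: CSm_cst.
move=> [h1 h2]; rewrite {}/F.
by split; [apply: Sm_ext h1|apply: Sm_ext h2] => P _; rewrite !mxE.
Qed.

Lemma cell_section_cell chi x e1 e2 e q p i : cell_section chi (cell x e1 e2 e q p) i 0 =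
  chi x * (apow (amat q) (- (lambda - rho)) * phi (gi (mt e1 e2 e)) i 0).
Proof. by rewrite /cell_section cellfun_cell !mxE. Qed.

(** On each fibre $x$ the section is $\chi(x)$ times the factor built into [cell_average]. The
    integrals over $N_-$ and $A$ may be interchanged with multiplication by $\chi(x)$ because [u]
    has compact support there. *)
Lemma dist_of_cell_section chi u : test_fun sigma u ->
  dist_of sigma (cell_section chi) u =
  int3 (fun x => chi x * cell_average sigma lambda (@phi R) u x 0 0).
Proof.
move=> tu; apply: (congr1 (@int3 R)); apply/funext => x.
rewrite cell_averageE -int2Z; last exact: nice2_inner.
apply: (congr1 (@int2 R)); apply/funext => q.
rewrite -int3Z; last exact: nice3_integrand.
apply: (congr1 (@int3 R)); apply/funext => p.
rewrite mulr_sumr; apply: eq_bigr => e1 _; rewrite mulr_sumr; apply: eq_bigr => e2 _.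
rewrite mulr_sumr; apply: eq_bigr => e _.
rewrite mulmx_col2 ![_^T 0 _]mxE /dot.
transitivity ((u (cell x e1 e2 e q p) 0 0 * cell_section chi (cell x e1 e2 e q p) 0 0 +
  u (cell x e1 e2 e q p) 1 0 * cell_section chi (cell x e1 e2 e q p) 1 0) * apow (amat q) (- (rho *+ 2))) => //.
rewrite !cell_section_cell.
move: (chi x) (apow _ _) (apow _ _) (u _ 0 0) (u _ 1 0) (phi _ 0 0) (phi _ 1 0) => a1 a2 a3 a4 a5 a6 a7.
ring.
Qed.

Lemma cell_base x : cell x false false false (0, 0) (0, 0, 0) = gm wl (emb (nmat x)).
Proof.
by rewrite /(cell _ _ _ _ _ _) mtilde0 amat0 (nminus0 Hs) !(gmulg1 Hs).
Qed.

Lemma pairing_int_cell_section f chi :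
  pairing_int sigma [:: false; true; false] f (cell_section chi) =
  int3 (fun x => chi x * f (gm wl (emb (nmat x))) 0 0).
Proof.
apply: (congr1 (@int3 R)); apply/funext => x.
transitivity (dot (f (gm wl (emb (nmat x)))) (cell_section chi (gm wl (emb (nmat x))))) => //.
rewrite /dot -cell_base !cell_section_cell.
rewrite (_ : gi (mt false false false) = mt false false false).
  by rewrite apow_amat0 phi1 !mxE /= mulr1n mulr0n; ring.
by rewrite mtilde0 (ginv1 Hs).
Qed.

End CellSection.


Section Positivity.
Context {R : realType} d (T : measurableType d) (mu : {measure set T -> \bar R}).

Lemma Rintegral_gt0 (K : set T) (m : R) (g : T -> R) : measurable K ->
  (0 < mu K)%E -> (mu K < +oo)%E -> 0 < m -> mu.-integrable setT (EFin \o g) ->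
  (forall p, m * \1_K p <= g p) -> 0 < \int[mu]_p g p.
Proof.
move=> mK K0 Koo m0 Ig hg.
have I1 : mu.-integrable setT (EFin \o \1_K).
  by apply: (@bounded_on_integrable R _ _ mu K mK Koo 1) => // p; rewrite mul1r ger0_norm//.
apply: (@lt_le_trans _ _ (\int[mu]_p (m * \1_K p))).
  rewrite RintegralZl// /Rintegral integral_indic// setIT mulr_gt0// fine_gt0//.
  by rewrite K0.
apply: le_Rintegral => //.
exact: integrable_scale.
Qed.

End Positivity.

(** * An approximate identity on $N$ *)

Section ApproximateIdentity.
Context {R : realType}.
Local Notation C := R[i].
Local Notation mu := (@lebesgue_measure R).
Local Notation mu2 := (mu \x mu)%E.
Local Notation mu3 := ((mu \x mu) \x mu)%E.

Lemma lebesgue_segment_gt0 (e : R) : 0 < e -> (0 < mu `[(- e)%R, e]%classic)%E.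
Proof.
move=> e0; rewrite lebesgue_measure_itv /= lte_fin ifT; last by lra.
by rewrite -EFinB lte_fin; lra.
Qed.

Lemma mu_box2_gt0 (e : R) : 0 < e -> (0 < mu2 (box2 e))%E.
Proof. by move=> e0; rewrite mu_box2 mule_gt0// lebesgue_segment_gt0. Qed.

Lemma mu_box3_gt0 (e : R) : 0 < e -> (0 < mu3 (box3 e))%E.
Proof. by move=> e0; rewrite mu_box3 !mule_gt0// lebesgue_segment_gt0. Qed.

Lemma flat_le (s t : R) : 0 < s -> s <= t -> flat 1 s <= flat 1 t.
Proof.
move=> s0 st; have t0 := lt_le_trans s0 st.
by rewrite /flat s0 t0 !hornerC !mul1r ler_expR lerN2 lef_pV2.
Qed.

Lemma bump3_ge (r : R) : 0 < r -> exists e m : R,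
  [/\ 0 < e, 0 < m & forall x, [/\ `|x.1.1| <= e, `|x.1.2| <= e & `|x.2| <= e] -> m <= bump3 r x].
Proof.
move=> r0; pose e := Num.min 1 (r / 6).
have e0 : 0 < e by rewrite lt_min ltr01 divr_gt0.
exists e, (flat 1 (r / 2)); split => //; first by apply: flat_gt0; rewrite divr_gt0.
have sq (t : R) : `|t| <= e -> t * t <= r / 6.
  move=> te; rewrite -(ger0_norm (sqr_ge0 t : 0 <= t * t)) normrM.
  apply: (@le_trans _ _ (1 * (r / 6))); last by rewrite mul1r.
  by apply: ler_pM => //; apply: le_trans te _; rewrite /e ge_min lexx ?orbT.
move=> x [/sq h1 /sq h2 /sq h3]; apply: flat_le; first by rewrite divr_gt0.
by rewrite /nrm3; lra.
Qed.

Lemma bump3_supp (r : R) x : bump3 r x != 0 ->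
  [/\ `|x.1.1| ^+ 2 < r, `|x.1.2| ^+ 2 < r & `|x.2| ^+ 2 < r].
Proof.
rewrite /bump3 => h; have n : nrm3 x < r.
  by rewrite ltNge; apply: contra h => h; rewrite flat_eq0// subr_le0.
rewrite !real_normK ?num_real//; move: n; rewrite /nrm3 -!expr2.
have := sqr_ge0 x.1.1; have := sqr_ge0 x.1.2; have := sqr_ge0 x.2.
by split; lra.
Qed.

Lemma bump3_box (r : R) x : r <= 1 -> ~ box3 1 x -> bump3 r x = 0.
Proof.
move=> r1 nb; apply/eqP; apply: contra_notT nb => /bump3_supp[h1 h2 h3].
have sq (t : R) : `|t| ^+ 2 < r -> `|t| <= 1.
  move=> h; rewrite -(@ler_pXn2r _ 2) ?nnegrE// expr1n.
  by rewrite ltW// (lt_le_trans h).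
by apply/box3P; split; exact: sq.
Qed.

Lemma compact_supp_integrable3 (f : R * R * R -> R) B : continuous f ->
  (forall p, ~ box3 B p -> f p = 0) -> mu3.-integrable setT (EFin \o f).
Proof.
move=> cf f0; have [] // : cintegrable mu3 setT (fun p => (f p)%:C).
apply: nice3_integrable; split; first exact: ccts_real.
by exists B => p /f0 ->.
Qed.

Lemma bump3M_integrable (r : R) (g : R * R * R -> R) : r <= 1 -> continuous g ->
  mu3.-integrable setT (EFin \o (fun x => bump3 r x * g x)).
Proof.
move=> r1 cg; apply: (@compact_supp_integrable3 _ 1).
  by apply: ctsM => //; exact: cts_bump3.
by move=> p np; rewrite bump3_box// mul0r.
Qed.

Lemma bump3_integrable (r : R) : r <= 1 -> mu3.-integrable setT (EFin \o bump3 r).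
Proof.
move=> r1; apply: (@compact_supp_integrable3 _ 1); first exact: cts_bump3.
by move=> p np; rewrite bump3_box.
Qed.

Definition mass (r : R) : R := \int[mu3]_x bump3 r x.

Lemma mass_gt0 (r : R) : 0 < r -> r <= 1 -> 0 < mass r.
Proof.
move=> r0 r1; have [e [m [e0 m0 hm]]] := bump3_ge r0.
apply: (@Rintegral_gt0 R _ _ ((mu \x mu) \x mu)%E (box3 e) m) => //.
- exact: measurable_box3.
- exact: mu_box3_gt0.
- exact: mu_box3_fin.
- exact: bump3_integrable.
- move=> x; rewrite indicE; have [/set_mem/box3P/hm|_] := boolP (x \in _).
    by rewrite mulr1.
  by rewrite mulr0 /bump3 flat_ge0.
Qed.

(** The error is the average of $g-g(0)$ against a nonnegative weight, and only points of the
    support contribute. *)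
Lemma mass_average (r e : R) (g : R * R * R -> R) : 0 < r -> r <= 1 -> continuous g ->
  (forall x, [/\ `|x.1.1| ^+ 2 < r, `|x.1.2| ^+ 2 < r & `|x.2| ^+ 2 < r] ->
     `|g x - g (0, 0, 0)| <= e) ->
  `|(\int[mu3]_x (bump3 r x * g x)) / mass r - g (0, 0, 0)| <= e.
Proof.
move=> r0 r1 cg ge; have m0 := mass_gt0 r0 r1.
have -> : (\int[mu3]_x (bump3 r x * g x)) / mass r - g (0, 0, 0) =
    (\int[mu3]_x (bump3 r x * (g x - g (0, 0, 0)))) / mass r.
  rewrite -[g (0, 0, 0) in LHS](mulfK (lt0r_neq0 m0)) -mulrBl; congr (_ / _).
  rewrite /mass -RintegralZl//; last exact: bump3_integrable.
  rewrite -RintegralB//.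
  - by apply: eq_Rintegral => x _; ring.
  - exact: bump3M_integrable.
  - by apply: integrable_scale => //; exact: bump3_integrable.
rewrite normrM [`|_^-1|]gtr0_norm ?invr_gt0// ler_pdivrMr//.
have I : mu3.-integrable setT (EFin \o (fun x => bump3 r x * (g x - g (0, 0, 0)))).
  by apply: bump3M_integrable => //; apply: ctsD => //; exact: cts_cst.
apply: le_trans (le_normr_Rintegral measurableT I) _.
rewrite /mass -RintegralZl//; last exact: bump3_integrable.
apply: le_Rintegral => //.
- apply: (@compact_supp_integrable3 _ 1).
    have c : continuous (fun x => bump3 r x * (g x - g (0, 0, 0))).
      by apply: ctsM; [exact: cts_bump3|apply: ctsD => //; exact: cts_cst].
    by move=> x; apply: cvg_norm; exact: c.
  by move=> p np; rewrite bump3_box// mul0r normr0.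
- by apply: integrable_scale => //; exact: bump3_integrable.
move=> x _; rewrite normrM ger0_norm ?flat_ge0// mulrC.
have [->|/bump3_supp/ge h] := eqVneq (bump3 r x) 0; first by rewrite !mulr0.
by rewrite ler_wpM2r// flat_ge0.
Qed.

Definition rk (k : nat) : R := k.+1%:R^-1.

Lemma rk_gt0 k : 0 < rk k.
Proof. by rewrite invr_gt0. Qed.

Lemma rk_le1 k : rk k <= 1.
Proof. by rewrite invf_le1// ler1n. Qed.

Lemma approximate_identity_real (g : R * R * R -> R) : continuous g ->
  (fun k => (\int[mu3]_x (bump3 (rk k) x * g x)) / mass (rk k)) @ \oo --> g (0, 0, 0).
Proof.
move=> cg; apply/cvgrPdist_le => e e0.
have [d /= d0 hd] : exists2 d : R, 0 < d & forall x,
    [/\ `|x.1.1| < d, `|x.1.2| < d & `|x.2| < d] -> `|g x - g (0, 0, 0)| <= e.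
  have h : \forall x \near ((0, 0, 0) : R * R * R), `|g (0, 0, 0) - g x| <= e.
    by move/cvgrPdist_le: (cg (0, 0, 0)) => /(_ e e0).
  have [d /= d0 hd] := (nbhs_ballP _ _).1 h; exists d => // -[[x y] z] [h1 h2 h3].
  rewrite distrC; apply: hd; split; first split; rewrite /ball /= sub0r normrN//.
(* [rk k] is a squared radius, hence the comparison with $d^2$. *)
have d2 : 0 < d ^+ 2 by rewrite exprn_gt0.
near=> k; rewrite distrC; apply: mass_average => //; [exact: rk_gt0|exact: rk_le1|].
have kd : rk k < d ^+ 2.
  by near: k; exact: (near_infty_natSinv_lt (PosNum d2)).
have sq (t : R) : `|t| ^+ 2 < rk k -> `|t| < d.
  by move=> h; rewrite -(@ltr_pXn2r _ 2) ?nnegrE ?(ltW d0)// (lt_trans h).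
by move=> x [h1 h2 h3]; apply: hd; split; exact: sq.
Unshelve. all: by end_near.
Qed.

Lemma Re_realM (a : R) (z : C) : complex.Re (a%:C * z) = a * complex.Re z.
Proof. by case: z => x y; rewrite /= mul0r subr0. Qed.

Lemma Im_realM (a : R) (z : C) : complex.Im (a%:C * z) = a * complex.Im z.
Proof. by case: z => x y; rewrite /= mul0r addr0. Qed.

Lemma approximate_identity (c : C) (F : R * R * R -> C) : ccts F ->
  ccvg (fun k => int3 (fun x => c * ((mass (rk k))^-1)%:C * (bump3 (rk k) x)%:C * F x))
    (c * F (0, 0, 0)).
Proof.
move=> cF; have [c1 c2] := cctsM (ccts_cst c) cF.
have h1 := approximate_identity_real c1; have h2 := approximate_identity_real c2.
have E k x : c * ((mass (rk k))^-1)%:C * (bump3 (rk k) x)%:C * F x =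
    ((mass (rk k))^-1 * bump3 (rk k) x)%:C * (c * F x).
  by rewrite rmorphM; ring.
split.
  rewrite (_ : (fun k => _) = (fun k => (\int[mu3]_x (bump3 (rk k) x * complex.Re (c * F x))) / mass (rk k))) //.
  apply/funext => k; rewrite [RHS]mulrC -RintegralZl//; last exact: (bump3M_integrable (rk_le1 k)).
  by apply: eq_Rintegral => x _; rewrite E Re_realM mulrA.
rewrite (_ : (fun k => _) = (fun k => (\int[mu3]_x (bump3 (rk k) x * complex.Im (c * F x))) / mass (rk k))) //.
apply/funext => k; rewrite [RHS]mulrC -RintegralZl//; last exact: (bump3M_integrable (rk_le1 k)).
by apply: eq_Rintegral => x _; rewrite E Im_realM mulrA.
Qed.

End ApproximateIdentity.


(** * The pairing formula *)

Section PairingFormula.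
Context {R : realType} (sigma : SL3 R -> SL3 R -> bool).
Hypothesis Hs : BLS_cocycle sigma.
Variables (s : SL3 R -> bool) (lambda : 'rV[R[i]]_3).
Hypothesis ss : splitting sigma s.
Local Notation C := R[i].

Lemma ccvg_unique (v : nat -> C) (a b : C) : ccvg v a -> ccvg v b -> a = b.
Proof.
move=> [a1 a2] [b1 b2]; apply: complex_eq.
  exact: (cvg_unique _ a1 b1).
exact: (cvg_unique _ a2 b2).
Qed.

Lemma ccvg_ext (v w : nat -> C) (a : C) : v =1 w -> ccvg v a -> ccvg w a.
Proof. by move=> /funext ->. Qed.

(** The numbers [pair f (dist_of (h k))] have two limits: one by weak continuity of the pairing, one
    by direct evaluation as integrals over $w_\ell N$. *)
Lemma pairing_E_id_coeff pair m1 m2 f : is_pairing sigma lambda pair ->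
  Vsmooth sigma (- lambda) (@tphi_inv R) f ->
  pair f (E_id_coeff sigma lambda s m1 m2) =
  int_quotient (psi m1 m2) * f (emb wlong) 0 0.
Proof.
move=> P Vf; set c := int_quotient _.
pose h k := cell_section sigma lambda
  (fun x => c * ((mass (rk k))^-1)%:C * (bump3 (rk k) x)%:C).
have Vh k : Vsmooth sigma lambda (@phi R) (h k) by exact: cell_section_Vsmooth.
have cvu u : test_fun sigma u ->
    ccvg (fun k => dist_of sigma (h k) u) (E_id_coeff sigma lambda s m1 m2 u).
  move=> tu; rewrite (E_id_coeffE Hs lambda ss); last exact: test_cellnice.
  have := approximate_identity c (cell_average_ccts Hs lambda tu).
  by apply: ccvg_ext => k; rewrite dist_of_cell_section.
have := pairing_continuous P Vf Vh (E_id_coeff_Vdist Hs lambda ss m1 m2) cvu.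
move/ccvg_unique; apply.
have cf : ccts (fun x => f (gmul sigma (emb wlong) (emb (nmat x))) 0 0).
  have := smooth_cell_ccts Hs false false false 0 Vf.1.
  move=> /(ccts_comp (f := fun x : R * R * R => (x, (0, 0) : R * R, (0, 0, 0) : R * R * R))) H.
  have := H ltac:(by cts).
  by under eq_fun do rewrite cell_base//.
have := approximate_identity c cf; rewrite nmat0 (gmulg1 Hs).
apply: ccvg_ext => k; rewrite -(pairing_int_cell_section Hs lambda).
(* The Weyl representative in the pairing may be chosen; for $w_\ell$ the section is explicit on all
   of $w_\ell N$. *)
by apply: esym; exact: (pairing_smooth P (w := [:: false; true; false])).
Qed.

End PairingFormula.

(** * A test function on which [tau] does not vanish *)

Section Nonzero.
Context {R : realType} (sigma : SL3 R -> SL3 R -> bool).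
Hypothesis Hs : BLS_cocycle sigma.
Variable lambda : 'rV[R[i]]_3.
Local Notation C := R[i].
Local Notation mu := (@lebesgue_measure R).

(** Supported on a single component of the cell. The exponent $\lambda-\rho+2\rho$ cancels both
    characters in [tau], so that the integrand becomes a product of bumps, real and nonnegative. *)
Definition tau_test : Gt R -> 'cV[C]_2 := cellfun sigma (fun e1 e2 e x q p =>
  if e1 || e2 || e then 0 else
  (apow (amat q) (lambda - rho + rho *+ 2) *
    (bump3 1 x * bump3 1 (q.1, q.2, 0) * bump3 1 p)%:C) *: delta_mx 0 0).

Lemma tau_test_smooth : smooth sigma tau_test.
Proof.
apply: (cellfun_smooth Hs (r := 1)); last first.
  move=> e1 e2 e x q p hx; case: ifP => // _.
  by rewrite (_ : bump3 1 x = 0) ?mul0r ?mulr0 ?scale0r// /bump3 flat_eq0// subr_le0.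
move=> U e1 e2 e i x1 x2 x3 q1 q2 p1 p2 p3 S1 S2 S3 T1 T2 U1 U2 U3 F.
rewrite {}/F; case: (e1 || e2 || e).
  by split; apply: (Sm_ext (f := fun=> 0)); [move=> P _; rewrite mxE|exact: Sm_cst|move=> P _; rewrite mxE|exact: Sm_cst].
have : CSm U (fun P => apow (amat (q1 P, q2 P)) (lambda - rho + rho *+ 2) *
    (bump3 1 (x1 P, x2 P, x3 P) * bump3 1 (q1 P, q2 P, 0) * bump3 1 (p1 P, p2 P, p3 P))%:C *
    (delta_mx 0 0 : 'cV[C]_2) i 0).
  apply: CSmM; last exact: CSm_cst.
  apply: CSmM; first exact: CSm_apow.
  by apply: CSm_real; apply: SmM; [apply: SmM|]; apply: Sm_bump3 => //; exact: Sm_cst.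
move=> [h1 h2].
by split; [apply: Sm_ext h1|apply: Sm_ext h2] => P _ /=; rewrite [RHS]/= ?mxE.
Qed.

(** The support lies in the image of a compact box under the continuous matrix entries. The sum of
    the nine bounds dominates each of them. *)
Lemma tau_test_supp : exists M, supp_in M tau_test.
Proof.
pose E := (((R * R * R) * (R * R)) * (R * R * R))%type.
pose K : set E := (box3 1 `*` box2 1) `*` box3 1.
have cK : compact K by apply: compact_setX; [apply: compact_setX|]; [exact: compact_box3|exact: compact_box2|exact: compact_box3].
have ce (i j : 'I_3) : continuous (fun z : E => slmx (cell sigma z.1.1 false false false z.1.2 z.2).1 i j).
  apply: (cts_eq (fun z => congr1 (fun A : 'M[R]_3 => A i j) (cell_mx sigma _ _ _ _ _ _))).
  apply: (cts_eq (fun z => mxE _ _ _ _)).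
  by case: i => [[|[|[|//]]] hi]; case: j => [[|[|[|//]]] hj] /=; cts.
have hb (ij : 'I_3 * 'I_3) : exists B : R, 0 <= B /\ forall z, K z -> `|slmx (cell sigma z.1.1 false false false z.1.2 z.2).1 ij.1 ij.2| <= B.
  by have [B B0 hB] := compact_bound cK (ce ij.1 ij.2); exists B.
have /choice[B hB] := hb.
exists (\sum_(ij : 'I_3 * 'I_3) B ij) => g [i [j]]; apply: contraPP => /eqP ug; apply/negP; rewrite -leNgt.
move: ug; rewrite /tau_test /cellfun; case: ifP => [/(cell_coords sigma)|_]; last by rewrite eqxx.
move: (cx _) (ce1 _) (ce2 _) (ceps _ _) (cq _) (cp _) => x e1 e2 e q p ->.
case: e1 => /=; first by rewrite eqxx. case: e2 => /=; first by rewrite eqxx.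
case: e => /=; first by rewrite eqxx.
rewrite scaler_eq0 negb_or mulf_eq0 negb_or => /andP[/andP[_ b0] _].
have {}b0 : bump3 1 x * bump3 1 (q.1, q.2, 0) * bump3 1 p != 0.
  by apply: contra b0 => /eqP ->.
move: b0; rewrite !mulf_eq0 !negb_or => /andP[/andP[bx bq] bp].
have bb (y : R * R * R) : bump3 1 y != 0 -> box3 1 y.
  by apply: contra_neqP; apply: bump3_box.
have Kz : K (x, q, p).
  split; last exact: bb.
  split; first exact: bb.
  by have /box3P[/= h1 h2 _] := bb (q.1, q.2, 0) bq; apply/box2P.
have [_ /(_ _ Kz) /= h] := hB (i, j).
apply: le_trans h _; rewrite (bigD1 (i, j))//= lerDl sumr_ge0// => ij _.
by have [] := hB ij.
Qed.

Lemma int3_real (f : R * R * R -> R) :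
  int3 (fun p => (f p)%:C) = (\int[((mu \x mu) \x mu)%E]_p f p)%:C.
Proof. by apply: complex_eq => //=; rewrite /Rintegral integral0. Qed.

Lemma int2_real (f : R * R -> R) :
  int2 (fun p => (f p)%:C) = (\int[(mu \x mu)%E]_p f p)%:C.
Proof. by apply: complex_eq => //=; rewrite /Rintegral integral0. Qed.

Lemma tau_test_integrand q p : cell_integrand sigma lambda tau_test (0, 0, 0) q p =
  (bump3 1 (0, 0, 0) * bump3 1 (q.1, q.2, 0) * bump3 1 p)%:C.
Proof.
rewrite cell_integrandE.
pose w := (bump3 1 (0, 0, 0) * bump3 1 (q.1, q.2, 0) * bump3 1 p)%:C.
transitivity (\sum_(e1 : bool) \sum_(e2 : bool) \sum_(e : bool)
    (if e1 || e2 || e then 0 else w)); last first.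
  by rewrite !big_bool /= !add0r.
have T e1 e2 e i : tau_test (cell sigma (0, 0, 0) e1 e2 e q p) i 0 =
    if e1 || e2 || e then 0 else
    apow (amat q) (lambda - rho + rho *+ 2) * w * (delta_mx 0 0 : 'cV[C]_2) i 0.
  rewrite /tau_test cellfun_cell; case: (e1 || e2 || e); first by rewrite mxE.
  by rewrite [LHS]mxE.
apply: eq_bigr => e1 _; apply: eq_bigr => e2 _; apply: eq_bigr => e _.
rewrite (T e1 e2 e 0) (T e1 e2 e 1); case: ifP => [|/negbT]; first by rewrite !mulr0 addr0.
rewrite !negb_or => /andP[/andP[/negPf -> /negPf ->] /negPf ->].
rewrite /cell_coef (_ : ginv sigma (mtilde false false false) = mtilde false false false); last first.
  by rewrite mtilde0 (ginv1 Hs).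
have D0 : (delta_mx 0 0 : 'cV[C]_2) 0 0 = 1 by rewrite mxE.
have D1 : (delta_mx 0 0 : 'cV[C]_2) 1 0 = 0 by rewrite mxE.
have I0 : (1%:M : 'M[C]_2) 0 0 = 1 by rewrite mxE.
rewrite D0 D1 phi1 I0 !mulr0 addr0 !mulr1 mulrA -!apow_amat_add.
have -> : - (lambda - rho) - rho *+ 2 + (lambda - rho + rho *+ 2) = 0.
  by rewrite -opprD addNr.
have -> : apow (amat q) 0 = 1; last by rewrite mul1r.
by rewrite apow_amat -cexp0; congr cexp; rewrite /aexpo !mxE; ring.
Qed.

Lemma tau_test_neq0 : tau sigma lambda tau_test != 0.
Proof.
rewrite tauE.
have -> : (fun q => int3 (cell_integrand sigma lambda tau_test (0, 0, 0) q)) =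
    (fun q => (mass 1 * bump3 1 (0, 0, 0) * bump3 1 (q.1, q.2, 0))%:C).
  apply/funext => q.
  rewrite (_ : cell_integrand _ _ _ _ _ = fun p => (bump3 1 (0, 0, 0) * bump3 1 (q.1, q.2, 0) * bump3 1 p)%:C).
    rewrite int3_real RintegralZl//; last exact: bump3_integrable.
    by congr (_ %:C); rewrite /mass mulrC mulrA.
  by apply/funext => p; exact: tau_test_integrand.
rewrite int2_real.
have [e [m [e0 m0 hm]]] := bump3_ge (@ltr01 R).
have cb : continuous (fun q : R * R => bump3 1 (q.1, q.2, 0)).
  by apply: (@cts_comp _ _ _ (fun q : R * R => (q.1, q.2, 0))); [cts|exact: cts_bump3].
have Ib : (mu \x mu)%E.-integrable setT (EFin \o (fun q : R * R => bump3 1 (q.1, q.2, 0))).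
  have [] // : cintegrable (mu \x mu)%E setT (fun q : R * R => (bump3 1 (q.1, q.2, 0))%:C).
  apply: nice2_integrable; split; first exact: ccts_real.
  exists 1 => q nq; rewrite bump3_box// => /box3P[/= h1 h2 _]; apply: nq.
  by apply/box2P.
rewrite RintegralZl// eq_complex /= eqxx andbT gt_eqF// !mulr_gt0//.
- exact: mass_gt0.
- by apply: lt_le_trans m0 (hm _ _); rewrite /= normr0; split; exact: ltW.
apply: (@Rintegral_gt0 R _ _ (mu \x mu)%E (box2 e) m) => //.
- exact: measurable_box2.
- exact: mu_box2_gt0.
- exact: mu_box2_fin.
move=> q; rewrite indicE; have [/set_mem/box2P[h1 h2]|_] := boolP (q \in _).
  by rewrite mulr1; apply: hm; rewrite /= normr0; split => //; exact: ltW.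
by rewrite mulr0 /bump3 flat_ge0.
Qed.

End Nonzero.


(** * The integral of the character *)

Section FubiniZero.
Context d1 d2 (T1 : measurableType d1) (T2 : measurableType d2) {R : realType}.
Variables (m1 : {sigma_finite_measure set T1 -> \bar R}).
Variables (m2 : {sigma_finite_measure set T2 -> \bar R}).
Variables (A : set T1) (B : set T2) (f : T1 * T2 -> R).
Hypotheses (mA : measurable A) (mB : measurable B).
Hypothesis If : (m1 \x m2)%E.-integrable (A `*` B) (EFin \o f).

Let Ifp : (m1 \x m2)%E.-integrable setT ((EFin \o f) \_ (A `*` B)).
Proof. by apply: (integrable_mkcond _ _).1 => //; exact: measurableX. Qed.

(** After extension by zero from the rectangle Fubini applies on the whole product, and the iterated
    integral has vanishing inner integrals. *)
Lemma integral_prod_eq0l :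
  (forall y, B y -> (\int[m1]_(x in A) (f (x, y))%:E = 0)%E) ->
  (\int[(m1 \x m2)%E]_(z in A `*` B) (f z)%:E = 0)%E.
Proof.
move=> h; rewrite integral_mkcond -(integral21_prod_meas1 Ifp).
apply: integral0_eq => y _; rewrite /fubini_G.
have [By|nBy] := pselect (B y).
  rewrite -[RHS](h y By) [RHS]integral_mkcond; apply: eq_integral => x _.
  rewrite !patchE; congr (if _ then _ else _).
  by apply/idP/idP => /set_mem; [case=> ? _|move=> ?]; exact/mem_set.
by apply: integral0_eq => x _; rewrite patchE ifF//; apply/negP => /set_mem[].
Qed.

Lemma integral_prod_eq0r :
  (forall x, A x -> (\int[m2]_(y in B) (f (x, y))%:E = 0)%E) ->
  (\int[(m1 \x m2)%E]_(z in A `*` B) (f z)%:E = 0)%E.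
Proof.
move=> h; rewrite integral_mkcond -(integral12_prod_meas1 Ifp).
apply: integral0_eq => x _; rewrite /fubini_F.
have [Ax|nAx] := pselect (A x).
  rewrite -[RHS](h x Ax) [RHS]integral_mkcond; apply: eq_integral => y _.
  rewrite !patchE; congr (if _ then _ else _).
  by apply/idP/idP => /set_mem; [case=> ? ?|move=> ?]; exact/mem_set.
by apply: integral0_eq => y _; rewrite patchE ifF//; apply/negP => /set_mem[].
Qed.

End FubiniZero.

Section CharacterIntegral.
Context {R : realType}.
Local Notation mu := (@lebesgue_measure R).
Local Notation I01 := (`[0, 1[%classic : set R).

Lemma sigma_finite_plane : sigma_finite setT (mu \x mu)%E.
Proof.
exists (fun n => box2 n%:R) => [|n]; last first.
  by split; [exact: measurable_box2|exact: mu_box2_fin].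
apply/seteqP; split => // q _.
exists (Num.bound (`|q.1| + `|q.2|)) => //; apply/box2P.
have := archi_boundP (addr_ge0 (normr_ge0 q.1) (normr_ge0 q.2)).
have := normr_ge0 q.1; have := normr_ge0 q.2.
by split; lra.
Qed.

(* The library instance for products of probability measures hides the
   sigma-finite structure of [mu \x mu] from inference. *)
Definition plane_measure :
    {sigma_finite_measure set (measurableTypeR R * measurableTypeR R)%type -> \bar R} :=
  HB.pack (mu \x mu)%E
    (Measure_isSigmaFinite.Build _ _ _ (mu \x mu)%E sigma_finite_plane).

(** The function $a^{-1}G(ax+b)$ is a primitive, and it takes the same value at both ends of the
    interval. *)
Lemma integral_period_eq0 (G g : R -> R) (a b : R) : a != 0 ->
  (forall t : R, is_derive t 1 G (g t)) -> continuous g -> G (a + b) = G b ->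
  (\int[mu]_(x in I01) (g (a * x + b))%:E = 0)%E.
Proof.
move=> a0 dG cg Gab; pose F x := a^-1 * G (a * x + b).
have dF (x : R) : is_derive x 1 F (g (a * x + b)).
  have d1 : is_derive x 1 (fun x => a * x + b) a.
    have := is_deriveD (f := a \*: id) (g := cst b) (is_deriveZ a (is_derive_id x 1)) (is_derive_cst b x 1).
    by rewrite addr0 /GRing.scale /= mulr1.
  have dc : is_derive x 1 (G \o (fun x => a * x + b)) (g (a * x + b) * a).
    exact: is_derive1_comp.
  have := is_deriveZ a^-1 dc.
  by rewrite /GRing.scale /= mulrCA mulVf// mulr1.
have cF : continuous F.
  by move=> x; have [/derivable1_diffP/differentiable_continuous] := dF x.
have cga : continuous (fun x => g (a * x + b)).
  by apply: (@cts_comp _ _ _ (fun x => a * x + b)) => //; cts.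
rewrite integral_itv_bndo_bndc; last first.
  by apply/measurable_EFinP; apply: measurable_funTS; exact: continuous_measurable_fun.
rewrite (@continuous_FTC2 _ _ F) //.
- by rewrite -EFinB /F mulr1 mulr0 add0r Gab subrr.
- exact: continuous_subspaceT.
- split.
  + by move=> x _; have [] := dF x.
  + by apply: cvg_at_right_filter; exact: cF.
  + by apply: cvg_at_left_filter; exact: cF.
- by move=> x _; rewrite derive1E; have [_] := dF x.
Qed.

Lemma periodic_int (g : R -> R) (t : R) (m : int) : periodic g (pi *+ 2) ->
  g (2 * pi * m%:~R + t) = g t.
Proof.
move=> pg; rewrite mulr_natl addrC; case: m => n.
  by rewrite -pmulrn mulr_natr periodicn.
rewrite NegzE mulrNz -pmulrn mulrN mulr_natr.
by rewrite -(periodicn pg n.+1) subrK.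
Qed.

Lemma square_integrable (f : R * R -> R) : continuous f ->
  (mu \x mu)%E.-integrable (I01 `*` I01) (EFin \o f).
Proof.
move=> cf; have [B _ hB] := compact_bound (@compact_box2 R 1) cf.
have mI : measurable (I01 `*` I01) by apply: measurableX; exact: measurable_itv.
have sub : I01 `*` I01 `<=` box2 1.
  have h (t : R) : 0 <= t < 1 -> `|t| <= 1 by move=> /andP[t0 t1]; rewrite ger0_norm// ltW.
  by move=> p [] /=; rewrite !in_itv /= => h1 h2; apply/box2P; split; exact: h.
apply: measurable_bounded_integrable => //.
- apply: le_lt_trans (mu_box2_fin 1).
  by apply: (@le_measure _ _ _ (mu \x mu)%E); rewrite ?inE//; exact: measurable_box2.
- by apply: measurable_funTS; exact: continuous_measurable2.
- exists B; split; first exact: num_real.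
  by move=> M BM p /sub hp; exact: le_trans (hB p hp) (ltW BM).
Qed.

(** Integration starts with a variable whose frequency is nonzero, over which a whole number of
    periods is traversed. The pair [G], [g] is left general to serve the real and the imaginary part
    alike. *)
Lemma cube_integral_eq0 (G g : R -> R) (m1 m2 : int) :
  (forall t : R, is_derive t 1 G (g t)) -> continuous g -> periodic G (pi *+ 2) ->
  ~ (m1 = 0 /\ m2 = 0) ->
  \int[((mu \x mu) \x mu)%E]_(p in cube) g (2 * pi * (m1%:~R * p.1.1 + m2%:~R * p.1.2)) = 0.
Proof.
move=> dG cg pG m0.
have mI : measurable I01 by exact: measurable_itv.
have pi0 m : m != 0 -> 2 * pi * m%:~R != 0 :> R.
  by move=> n0; rewrite !mulf_neq0 ?intr_eq0// gt_eqF ?pi_gt0.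
have cl : continuous (fun p : R * R => g (2 * pi * (m1%:~R * p.1 + m2%:~R * p.2))).
  apply: (@cts_comp _ _ _ (fun p : R * R => 2 * pi * (m1%:~R * p.1 + m2%:~R * p.2))) => //.
  apply: ctsM; first exact: cts_cst.
  apply: ctsD; apply: ctsM; try exact: cts_cst.
    exact: cts_fst (@cts_id _).
  exact: cts_snd (@cts_id _).
have sq0 : (\int[(mu \x mu)%E]_(p in I01 `*` I01)
    (g (2 * pi * (m1%:~R * p.1 + m2%:~R * p.2)))%:E = 0)%E.
  have [m10|m10] := eqVneq m1 0; last first.
    apply: (@integral_prod_eq0l _ _ _ _ R mu mu I01 I01 (fun p => g (2 * pi * (m1%:~R * p.1 + m2%:~R * p.2)))) => //.
      exact: square_integrable.
    move=> y _; rewrite -[RHS](@integral_period_eq0 G g (2 * pi * m1%:~R) (2 * pi * (m2%:~R * y))) ?pi0 ?periodic_int//.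
    by apply: eq_integral => x _ /=; rewrite mulrDr mulrA.
  have m20 : m2 != 0 by apply/eqP => m20; apply: m0.
  apply: (@integral_prod_eq0r _ _ _ _ R mu mu I01 I01 (fun p => g (2 * pi * (m1%:~R * p.1 + m2%:~R * p.2)))) => //.
    exact: square_integrable.
  move=> x _; rewrite -[RHS](@integral_period_eq0 G g (2 * pi * m2%:~R) (2 * pi * (m1%:~R * x))) ?pi0 ?periodic_int//.
  by apply: eq_integral => y _ /=; rewrite addrC mulrDr mulrA.
rewrite /Rintegral; have Ic : ((mu \x mu) \x mu)%E.-integrable cube
    (EFin \o (fun p : R * R * R => g (2 * pi * (m1%:~R * p.1.1 + m2%:~R * p.1.2)))).
  apply: cube_integrable.
  by apply: (@cts_comp _ _ _ (fun p : R * R * R => p.1) (fun p : R * R => g (2 * pi * (m1%:~R * p.1 + m2%:~R * p.2)))); [cts|].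
rewrite cubeE in Ic *.
suff H : (\int[((mu \x mu) \x mu)%E]_(p in (I01 `*` I01) `*` I01)
    (g (2 * pi * (m1%:~R * p.1.1 + m2%:~R * p.1.2)))%:E = 0)%E by rewrite H.
apply: (@integral_prod_eq0l _ _ _ _ R plane_measure mu (I01 `*` I01) I01
  (fun p => g (2 * pi * (m1%:~R * p.1.1 + m2%:~R * p.1.2)))) => //.
exact: measurableX.
Qed.

Lemma int_quotient_psi_eq0 m1 m2 : ~ (m1 = 0 /\ m2 = 0) -> int_quotient (@psi R m1 m2) = 0.
Proof.
move=> m0; apply: complex_eq; rewrite /=.
  rewrite -[RHS](@cube_integral_eq0 sin cos m1 m2) //.
  - by apply: eq_Rintegral => p _; rewrite expR0 mul1r mul0r subr0.
  - exact: continuous_cos.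
  - exact: sinD2pi.
rewrite -[RHS](@cube_integral_eq0 (fun t => - cos t) sin m1 m2) //.
- by apply: eq_Rintegral => p _; rewrite expR0 mul1r mul0r addr0.
- exact: is_derive_negcos.
- exact: continuous_sin.
- by move=> t; rewrite cosD2pi.
Qed.

Lemma int_quotient_psi0 : int_quotient (@psi R 0 0) = 1.
Proof.
have -> : psi 0 0 = (fun=> 1) :> (R * R * R -> R[i]).
  apply/funext => p; rewrite /psi (_ : _ * _ = 0) ?cexp0//.
  by rewrite !mul0r addr0 mulr0.
have m01 : mu I01 = 1%:E by rewrite lebesgue_measure_itv /= lte_fin ltr01 sube0.
have mI : measurable I01 by exact: measurable_itv.
have mc : ((mu \x mu) \x mu)%E (@cube R) = 1%:E.
  rewrite cubeE product_measure1E//; last exact: measurableX.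
  rewrite -[RHS]mule1; congr (_ * _)%E; last exact: m01.
  rewrite [LHS]product_measure1E// -[RHS]mule1.
  by congr (_ * _)%E; exact: m01.
transitivity (int3_on (@cube R) (fun=> 1 : R[i])) => //; apply: complex_eq.
  rewrite [LHS]/= Rintegral_cst; last exact: measurable_cube.
  by rewrite mul1r; exact: (congr1 fine mc).
by rewrite /= Rintegral_cst ?mul0r//; exact: measurable_cube.
Qed.

End CharacterIntegral.


Theorem proposition34 (R : realType) (sigma : SL3 R -> SL3 R -> bool)
    (s : SL3 R -> bool) (lambda : 'rV[R[i]]_3)
    (pair : (Gt R -> 'cV[R[i]]_2) -> functional -> R[i]) (m1 m2 : int) :
  BLS_cocycle sigma ->
  splitting sigma s ->
  \sum_(i < 3) lambda 0 i = 0 ->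
  is_pairing sigma lambda pair ->
  (forall f : Gt R -> 'cV[R[i]]_2, Vsmooth sigma (- lambda) (@tphi_inv R) f ->
     pair f (E_id_coeff sigma lambda s m1 m2) =
     int_quotient (psi m1 m2) * f (emb wlong) 0 0) /\
  (nonzero_dist sigma (E_id_coeff sigma lambda s m1 m2) <-> m1 = 0 /\ m2 = 0).
Proof.
move=> Hs ss _ P; split=> [f Vf|]; first exact: pairing_E_id_coeff.
split=> [[u tu]|[-> ->]].
  rewrite (E_id_coeffE Hs lambda ss); last exact: test_cellnice.
  by apply: contra_neqP => m0; rewrite int_quotient_psi_eq0 ?mul0r.
have tt : test_fun sigma (tau_test sigma lambda).
  by split; [exact: tau_test_smooth|exact: tau_test_supp].
exists (tau_test sigma lambda) => //.
rewrite (E_id_coeffE Hs lambda ss); last exact: test_cellnice.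
by rewrite int_quotient_psi0 mul1r; exact: tau_test_neq0.
Qed.
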